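(* Let $M[*]$ be a generalized product, let $E=D^*\operatorname{null}((\Pi_R)_* )$ be the vector bundle over $M[1]$ defined as the (abstract) pull-back under $D:M[1]\to M[2]$, and let $\mathcal E=\mathcal C^\infty(M[1];E)$ be its space of smooth sections. Then $\mathcal E$ is a Lie algebroid with anchor map $$(\Pi_L)_*:\mathcal E\longrightarrow \mathcal C^\infty(M[1];{}^{b}TM[1]).$$
   Context: Manifolds with corners have embedded boundary hypersurfaces, each boundary hypersurface having a boundary defining function. Adapted coordinates near a point consist of the $x_1,\dots,x_r\ge 0$ defining the boundary hypersurfaces through the point and further functions $y_l$, giving a diffeomorphism of a neighbourhood onto $[0,\epsilon)^r\times(-\epsilon,\epsilon)^{n-r}$. A b-map $F:M_1\to M_2$ is a smooth map such that for each boundary defining function $x'_j$ of $M_2$ either $F^*x'_j\equiv 0$ or $F^*x'_j=\alpha_j\prod_k x_k^{a(j,k)}$ with $\alpha_j>0$ smooth and $a(j,k)$ non-negative integers; it is an interior b-map if the first case does not occur. A p-submanifold is a closed subset which near each of its points is given, in some adapted coordinates, by the vanishing of some of the $x_i$ and some of the $y_l$. A p-embedding is a diffeomorphism onto a p-submanifold. A b-fibration is a surjective b-map $F:M_1\to M_2$ such that near each $m\in M_1$ there are adapted coordinates $x,y$, and adapted coordinates $x',y'$ near $F(m)$, such that the $F^*y'_{l'}$ are amongst the $y_l$ and $F^*x'_{j'}=\prod_{j\in J(j')}x_j$ where the index sets $J(j')$ are disjoint for different $j'$. The bundle ${}^bTM$ is the vector bundle whose smooth sections are the smooth vector fields on $M$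 tangent to all boundary hypersurfaces (local basis $x_j\partial_{x_j},\partial_{y_l}$); an interior b-map $F$ has a b-differential $F_*:{}^bT_mM_1\to{}^bT_{F(m)}M_2$, and $\operatorname{null}(F_* )$ denotes its null space, a subbundle of ${}^bTM_1$ if $F$ is a b-fibration. Let $J(k)=\{1,\dots,k\}$. A generalized product is a contravariant functor from the category with objects the $J(k)$, $k=1,2,\dots$, and morphisms all maps $J(n)\to J(m)$, to manifolds with corners and interior b-maps, $J(k)\mapsto M[k]$, $(I:J(n)\to J(m))\mapsto (S_I:M[m]\to M[n])$, such that $\dim M[k]=\mu+(k-1)\kappa$ for fixed integers $\mu,\kappa$, injective maps $I$ are taken to b-fibrations and surjective maps $I$ are taken to p-embeddings; all manifolds, including the fibres of the b-fibrations, are connected. $\Pi_L,\Pi_R:M[2]\to M[1]$ are the $S_I$ for $I:J(1)\to J(2)$ with $I(1)=1$, respectively $I(1)=2$. $\Pi_S,\Pi_C,\Pi_F:M[3]\to M[2]$ are the $S_I$ for the increasing maps $J(2)\to J(3)$ with images $\{1,2\}$, $\{1,3\}$, $\{2,3\}$ respectively. $D:M[1]\to M[2]$ (and also its image) corresponds to the unique map $J(2)\to J(1)$, and $D_{1,2}\subset M[3]$ is the image of $M[2]$ under the map corresponding to the increasing surjection $J(3)\to J(2)$ identifying $1$ and $2$. A Lie algebroid structure on $\mathcal E$ means a Lie bracket on $\mathcal E$ such that the anchor map $\rho$ is a bundle map intertwining brackets and $[V,fW]=f[V,W]+(\rho(V)f)W$ for smooth functions $f$ on $M[1]$. The bracket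 is as follows. A section $V\in\mathcal E$ is regarded as a smooth section of $\operatorname{null}((\Pi_R)_* )$ over $D\subset M[2]$. It lifts to a unique smooth section $W$ of $\operatorname{null}((\Pi_F)_* )$ over $D_{1,2}$ with $(\Pi_S)_*W(p)=V(\Pi_S(p))$, and, $\Pi_C$ restricting to a diffeomorphism from $D_{1,2}$ to $M[2]$, one sets $\tilde V=(\Pi_C)_*W\in\mathcal C^\infty(M[2];\operatorname{null}((\Pi_R)_* ))$, which satisfies $\tilde V|_D=V$. The bracket is $[V_1,V_2]=[\tilde V_1,\tilde V_2]\big|_{D}$. *)

(* Defs.v *)
From HB Require Import structures.
From mathcomp Require Import all_boot all_order all_algebra.
From mathcomp Require Import all_classical all_reals all_analysis.

Set Implicit Arguments.
Unset Strict Implicit.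
Unset Printing Implicit Defensive.

Import Order.TTheory GRing.Theory Num.Theory numFieldNormedType.Exports.
Local Open Scope classical_set_scope.
Local Open Scope ring_scope.

Fixpoint Ck_on (R : realType) (n : nat) (O : set 'rV[R]_n) (k : nat)
    (h : 'rV[R]_n -> R) : Prop :=
  (forall u, O u -> {for u, continuous h}) /\
  (if k is k'.+1 then
     forall i : 'I_n,
       (forall u, O u -> derivable h u (delta_mx 0 i)) /\
       Ck_on O k' (fun u => 'D_(delta_mx 0 i) h u)
   else True).

Definition smooth_on_open (R : realType) (n : nat) (O : set 'rV[R]_n)
    (h : 'rV[R]_n -> R) : Prop :=
  open O /\ forall k, Ck_on O k h.

(* The model [0,eps)^r x (-eps,eps)^(n-r): the coordinates of index < r are the
   x_i, the other ones are the y_l. *)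
Definition box (R : realType) (n r : nat) (eps : R) : set 'rV[R]_n :=
  [set u | forall i : 'I_n, `|u 0 i| < eps /\ ((i < r)%N -> 0 <= u 0 i)].

Section Structure.
Variables (R : realType) (T : topologicalType) (n : nat) (C : set (T -> R)).

(* phi is a system of adapted coordinates near p, centred at p (so that p lies
   on exactly r local boundary faces): phi restricts to a homeomorphism from an
   open neighbourhood U of p onto the model, and a function is smooth near q in
   U iff, read through phi, it extends near phi q to a smooth function on an
   open subset of R^n. *)
Definition adapted (p : T) (r : nat) (phi : T -> 'rV[R]_n) : Prop :=
  (r <= n)%N /\ phi p = 0 /\
  exists (U : set T) (eps : R),
    [/\ open U /\ U p, 0 < eps,
        phi @` U = box r eps /\
        (forall q q', U q -> U q' -> phi q = phi q' -> q = q'),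
        (forall q (A : set T), U q ->
           (nbhs q A <->
            exists2 O, nbhs (phi q) O & forall q', U q' -> O (phi q') -> A q'))
      & forall q (f : T -> R), U q ->
          ((exists2 g, C g & \forall q' \near q, f q' = g q') <->
           (exists O h, [/\ smooth_on_open O h, O (phi q)
                          & \forall q' \near q, f q' = h (phi q')]))].

(* phi is centred, so its r is the codimension of p. *)
Definition codim1 : set T := [set p | exists phi, adapted p 1 phi].

Definition boundary_hypersurface (H : set T) : Prop :=
  exists2 p, codim1 p & H = closure (connected_component codim1 p).

Definition point_derivation (p : T) (v : (T -> R) -> R) : Prop :=
  (forall (c : R) f g, C f -> C g -> v (c *: f + g) = c * v f + v g) /\
  (forall f g, C f -> C g -> v (f * g) = f p * v g + g p * v f).

(* The last clause is dx <> 0 at the points of H. *)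
Definition boundary_defining (H : set T) (x : T -> R) : Prop :=
  [/\ C x, forall p, 0 <= x p, forall p, x p = 0 <-> H p
    & forall p, H p -> exists2 v, point_derivation p v & v x != 0].

End Structure.

(* The smooth structure is given by the algebra Cinfty of smooth real functions.
   Embeddedness of the boundary hypersurfaces is the existence of the boundary
   defining functions. *)
Record manifold_with_corners (R : realType) := ManifoldWithCorners {
  points :> topologicalType;
  mdim : nat;
  Cinfty : set (points -> R);
  mwc_hausdorff : hausdorff_space points;
  mwc_second_countable : @second_countable points;
  mwc_local : forall f : points -> R,
    (forall p : points, exists2 g, Cinfty g & \forall q \near p, f q = g q) ->
    Cinfty f;
  mwc_coordinates : forall p, exists r (phi : points -> 'rV[R]_mdim),
    adapted Cinfty p r phi;
  mwc_embedded : forall H,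
    boundary_hypersurface mdim Cinfty H ->
    exists x, boundary_defining Cinfty H x }.
Arguments Cinfty {R} m _ : rename.
Arguments mdim {R} m : rename.

Section Maps.
Variable R : realType.
Implicit Types M N : manifold_with_corners R.

Definition coordinates M (p : M) (r : nat) (phi : M -> 'rV[R]_(mdim M)) : Prop :=
  adapted (Cinfty M) p r phi.

Definition bhs M : set (set M) := boundary_hypersurface (mdim M) (Cinfty M).

Definition bdf M (H : set M) (x : M -> R) : Prop :=
  boundary_defining (Cinfty M) H x.

(* Functions of the form alpha * prod_H x_H ^ a(H), alpha > 0 smooth.  As M may
   have infinitely many boundary hypersurfaces the factorization is stated near
   each m, with the (finitely many) hypersurfaces through m; the exponents and
   the x_H do not depend on m.  When there are finitely many hypersurfaces, this
   is equivalent to a single global factorization. *)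
Definition b_function M (g : M -> R) : Prop :=
  exists (x : set M -> M -> R) (a : set M -> nat),
    (forall H, bhs H -> bdf H (x H)) /\
    forall m : M, exists2 alpha, Cinfty M alpha &
      \forall q \near m, 0 < alpha q /\
        g q = alpha q *
              \big[*%R/1]_(H \in [set H | bhs H /\ H m]) x H q ^+ a H.

Definition smooth_map M N (F : M -> N) : Prop :=
  forall f, Cinfty N f -> Cinfty M (f \o F).

Definition b_map M N (F : M -> N) : Prop :=
  smooth_map F /\
  forall H x, bhs H -> bdf H x ->
    (forall m, x (F m) = 0) \/ b_function (x \o F).

Definition interior_b_map M N (F : M -> N) : Prop :=
  b_map F /\ forall H x, bhs H -> bdf H x -> ~ (forall m, x (F m) = 0).

Definition p_submanifold M (A : set M) : Prop :=
  closed A /\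
  forall p, A p -> exists r phi (s : {set 'I_(mdim M)}), coordinates p r phi /\
    \forall q \near p, A q <-> (forall i, i \in s -> phi q 0 i = 0).

(* The last clause is the smoothness of the inverse, the smooth functions on a
   p-submanifold being the local restrictions of smooth functions. *)
Definition p_embedding M N (G : M -> N) : Prop :=
  [/\ smooth_map G, injective G, p_submanifold (range G)
    & forall f m, Cinfty M f -> exists2 g, Cinfty N g &
        \forall q \near G m, forall m', G m' = q -> g q = f m'].

(* s l is the index of the y-coordinate which is the pull-back of y'_l; distinct
   y'_l pull back to distinct coordinates. *)
Definition b_fibration M N (F : M -> N) : Prop :=
  [/\ forall q, exists m, F m = q, b_map F
    & forall m : M, exists r phi r' phi', coordinates m r phi /\
       coordinates (F m) r' phi' /\
       exists (J : 'I_(mdim N) -> {set 'I_(mdim M)})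
              (s : 'I_(mdim N) -> 'I_(mdim M)),
        [/\ (forall l l' : 'I_(mdim N), (r' <= l)%N -> (r' <= l')%N ->
               s l = s l' -> l = l'),
            (forall l : 'I_(mdim N), (r' <= l)%N -> (r <= s l)%N /\
               \forall q \near m, phi' (F q) 0 l = phi q 0 (s l)),
            (forall j j' : 'I_(mdim N), (j < r')%N -> (j' < r')%N -> j != j' ->
               ~~ [exists i, (i \in J j) && (i \in J j')])
          & forall j : 'I_(mdim N), (j < r')%N ->
              (forall i, i \in J j -> (i < r)%N) /\
              \forall q \near m,
                phi' (F q) 0 j = \prod_(i in J j) phi q 0 i]].

End Maps.

Section BTangent.
Variable R : realType.
Implicit Types M N : manifold_with_corners R.

(* Smooth vector fields tangent to all boundary hypersurfaces, as derivations;
   the values off Cinfty M are irrelevant. *)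
Definition b_field M (V : (M -> R) -> (M -> R)) : Prop :=
  [/\ forall f, Cinfty M f -> Cinfty M (V f),
      forall (c : R) f g, Cinfty M f -> Cinfty M g ->
        V (c *: f + g) = c *: V f + V g,
      forall f g, Cinfty M f -> Cinfty M g -> V (f * g) = f * V g + g * V f
    & forall H f, bhs H -> Cinfty M f ->
        (forall p, H p -> f p = 0) -> forall p, H p -> V f p = 0].

(* The smooth function V g / g, for g a b-function; it is unique since the
   interior {g <> 0} is dense. *)
Definition dlog M (V : (M -> R) -> (M -> R)) (g : M -> R) (p : M) : R :=
  xget 0 [set c | exists h, [/\ Cinfty M h, forall q, V g q = h q * g q
                               & c = h p]].

(* The value at p of a b-field V is recorded by its pairings with all df,
   f smooth, and all dg/g, g a b-function (both extended by 0).  In adapted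
   coordinates V = sum a_j x_j d/dx_j + sum b_l d/dy_l pairs at p to a_j(p) with
   dx_j/x_j and to b_l(p) with dy_l, so that the values at p form the fibre
   V_b(M) / I_p V_b(M) of the bundle whose smooth sections are the b-fields. *)
Definition bvec M : lmodType R :=
  (((M -> R) -> R^o) * ((M -> R) -> R^o))%type.

Definition b_value M (V : (M -> R) -> (M -> R)) (p : M) : bvec M :=
  (fun f => if `[< Cinfty M f >] then V f p else 0,
   fun g => if `[< b_function g >] then dlog V g p else 0).

Definition bT M (p : M) : set (bvec M) :=
  [set v | exists2 V, b_field V & v = b_value V p].

(* For F an interior b-map, F^* preserves smooth functions and b-functions, and
   this is the map from bT p to bT (F p) dual to F^*df = d(F^*f) and
   F^*(dg/g) = d(F^*g)/F^*g. *)
Definition b_differential M N (F : M -> N) (v : bvec M) : bvec N :=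
  (fun f => if `[< Cinfty N f >] then v.1 (f \o F) else 0,
   fun g => if `[< b_function g >] then v.2 (g \o F) else 0).

Definition bnull M N (F : M -> N) (p : M) : set (bvec M) :=
  [set v | bT p v /\ b_differential F v = 0].

(* Smooth sections of bTM over A; for A = setT, these are the b-fields. *)
Definition smooth_section_over M (A : set M) (s : M -> bvec M) : Prop :=
  forall p, A p -> exists2 V, b_field V &
    \forall q \near p, A q -> s q = b_value V q.

(* Smooth sections of the pull-back of bTN under G : M -> N *)
Definition smooth_pullback_section M N (G : M -> N) (s : M -> bvec N) : Prop :=
  forall m : M, exists k (c : 'I_k -> M -> R) (V : 'I_k -> (N -> R) -> (N -> R)),
    [/\ forall i, Cinfty M (c i), forall i, b_field (V i)
      & \forall m' \near m, s m' = \sum_(i < k) c i m' *: b_value (V i) (G m')].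

Definition section_apply M (s : M -> bvec M) (f : M -> R) : M -> R :=
  fun p => (s p).1 f.

Definition b_bracket M (s t : M -> bvec M) : M -> bvec M :=
  b_value (fun f => section_apply s (section_apply t f)
                    - section_apply t (section_apply s f)).

(* Lie algebroid structure on the space Gamma of smooth sections of a bundle
   over M with fibres E m inside a fixed vector space B *)
Record lie_algebroid M (B : lmodType R) (E : M -> set B) (Gamma : set (M -> B))
    (br : (M -> B) -> (M -> B) -> (M -> B)) (rho : M -> B -> bvec M) : Prop := {
  br_closed : forall V W, Gamma V -> Gamma W -> Gamma (br V W);
  br_linearl : forall (c : R) V V' W, Gamma V -> Gamma V' -> Gamma W ->
    br (c *: V + V') W = c *: br V W + br V' W;
  br_linearr : forall (c : R) V W W', Gamma V -> Gamma W -> Gamma W' ->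
    br V (c *: W + W') = c *: br V W + br V W';
  br_alternating : forall V, Gamma V -> br V V = 0;
  br_jacobi : forall U V W, Gamma U -> Gamma V -> Gamma W ->
    br U (br V W) + br V (br W U) + br W (br U V) = 0;
  anchor_fibre : forall m v, E m v -> bT m (rho m v);
  anchor_linear : forall m (c : R) v w, E m v -> E m w ->
    rho m (c *: v + w) = c *: rho m v + rho m w;
  anchor_smooth : forall V, Gamma V ->
    smooth_section_over setT (fun m => rho m (V m));
  anchor_bracket : forall V W, Gamma V -> Gamma W ->
    (fun m => rho m (br V W m)) =
    b_bracket (fun m => rho m (V m)) (fun m => rho m (W m));
  br_leibniz : forall f V W, Cinfty M f -> Gamma V -> Gamma W ->
    Gamma (fun m => f m *: W m) /\
    br V (fun m => f m *: W m) =
    (fun m => f m *: br V W m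
              + section_apply (fun m => rho m (V m)) f m *: W m) }.

End BTangent.

(* J(k) is 'I_k, and gp_obj k stands for M[k+1]. *)
Record generalized_product (R : realType) := GeneralizedProduct {
  gp_obj :> nat -> manifold_with_corners R;
  gp_map : forall n m, ('I_n.+1 -> 'I_m.+1) -> gp_obj m -> gp_obj n;
  gp_mu : int;
  gp_kappa : int;
  gp_id : forall m (p : gp_obj m), gp_map id p = p;
  gp_comp : forall l m n (I : 'I_n.+1 -> 'I_m.+1) (K : 'I_m.+1 -> 'I_l.+1)
    (p : gp_obj l), gp_map (K \o I) p = gp_map I (gp_map K p);
  gp_dim : forall k, (mdim (gp_obj k))%:Z = gp_mu + k%:Z * gp_kappa;
  gp_b_map : forall n m (I : 'I_n.+1 -> 'I_m.+1), interior_b_map (gp_map I);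
  gp_b_fibration : forall n m (I : 'I_n.+1 -> 'I_m.+1),
    injective I -> b_fibration (gp_map I);
  gp_p_embedding : forall n m (I : 'I_n.+1 -> 'I_m.+1),
    (forall j, exists i, I i = j) -> p_embedding (gp_map I);
  gp_connected : forall k, connected [set: gp_obj k];
  gp_fibre_connected : forall n m (I : 'I_n.+1 -> 'I_m.+1), injective I ->
    forall q, connected (gp_map I @^-1` [set q]) }.
Arguments gp_map {R} M {n m} I _ : rename.

Section Bracket.
Variables (R : realType) (M : generalized_product R).

Definition PiL : M 1%N -> M 0%N := gp_map M (fun _ : 'I_1 => ord0 : 'I_2).
Definition PiR : M 1%N -> M 0%N := gp_map M (fun _ : 'I_1 => ord_max : 'I_2).

(* lift h is the increasing map whose image omits h *)
Definition PiS : M 2%N -> M 1%N := gp_map M (lift (ord_max : 'I_3)).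
Definition PiC : M 2%N -> M 1%N := gp_map M (lift (Ordinal (isT : (1 < 3)%N))).
Definition PiF : M 2%N -> M 1%N := gp_map M (lift (ord0 : 'I_3)).

Definition diag : M 0%N -> M 1%N := gp_map M (fun _ : 'I_2 => ord0 : 'I_1).
Definition D12 : set (M 2%N) :=
  range (gp_map M (fun i : 'I_3 => if i == ord_max then ord_max else ord0 : 'I_2)).

Definition Efibre (m : M 0%N) : set (bvec (M 1%N)) := bnull PiR (diag m).

Definition Esections : set (M 0%N -> bvec (M 1%N)) :=
  [set V | smooth_pullback_section diag V /\ forall m, Efibre m (V m)].

Definition anchor (m : M 0%N) (v : bvec (M 1%N)) : bvec (M 0%N) :=
  b_differential PiL v.

(* V is regarded as a section over the image of diag, so that V(PiS p) is V m
   for diag m = PiS p. *)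
Definition is_lift (V : M 0%N -> bvec (M 1%N)) (W : M 2%N -> bvec (M 2%N)) : Prop :=
  [/\ smooth_section_over D12 W,
      forall p, D12 p -> bnull PiF p (W p)
    & forall p m, D12 p -> diag m = PiS p -> b_differential PiS (W p) = V m].

Definition tilde (V : M 0%N -> bvec (M 1%N)) : M 1%N -> bvec (M 1%N) :=
  xget (fun=> 0) [set Vt | exists2 W, is_lift V W &
    forall p, D12 p -> Vt (PiC p) = b_differential PiC (W p)].

(* The construction of V~ from V is meaningful. *)
Definition tilde_well_defined (V : M 0%N -> bvec (M 1%N)) : Prop :=
  [/\ exists W, is_lift V W,
      forall W W', is_lift V W -> is_lift V W' -> forall p, D12 p -> W p = W' p,
      forall W, is_lift V W ->
        forall p, D12 p -> tilde V (PiC p) = b_differential PiC (W p),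
      smooth_section_over setT (tilde V) /\ (forall q, bnull PiR q (tilde V q))
    & forall m, tilde V (diag m) = V m].

Definition Ebracket (V1 V2 : M 0%N -> bvec (M 1%N)) : M 0%N -> bvec (M 1%N) :=
  fun m => b_bracket (tilde V1) (tilde V2) (diag m).

End Bracket.

(* Main.v *)
Require Import Defs.
From HB Require Import structures.
From mathcomp Require Import finmap.
From mathcomp Require Import all_boot all_order all_algebra.
From mathcomp Require Import all_classical all_reals all_analysis.
From mathcomp Require Import perm ring lra zify.

(* A b-tangent vector at [p] is a derivation of the germs of smooth functions
   with compatible logarithmic derivatives of the b-functions, and in adapted
   coordinates it is determined by its pairings with the [dx_j/x_j] and the
   [dy_l]; so smoothness, push-forwards and commutators can be checked on
   pairings.  Over [D_{1,2}], the image of [s (x, y) = (x, x, y)], a vector [u]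
   with [(Pi_S)_* u = V] is corrected to the lift [u - s_* (Pi_F)_* u]; the lift
   is unique by a dimension count.  The Jacobi identity follows from
   [[V, W]~ = [V~, W~]].  To see this, lift [V] to [M[4]] over the points
   [(x, x, y, z)] and project by [Pi_134]: this gives a b-field on [M[3]] tangent
   to the fibres of [Pi_F] and related to [V~] by both [Pi_S] and [Pi_C], and the
   commutator of two such fields is the lift of [[V, W]]. *)

Set Implicit Arguments.
Unset Strict Implicit.
Unset Printing Implicit Defensive.

Import Order.TTheory GRing.Theory Num.Theory numFieldNormedType.Exports.
Local Open Scope classical_set_scope.
Local Open Scope ring_scope.

(** * Division by a coordinate *)

(** A function is smooth on the model when it extends locally to an open subset of R^n, so the
    analysis takes place on open cubes of R^n. Dividing a smooth function there by a coordinate,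
    with all derivatives under control, is the one analytic input: it shows that point derivations
    are combinations of partial derivatives, that a defining function is a positive multiple of a
    chart coordinate, and that a b-field has logarithmic derivatives. Embeddedness is given only by
    the existence of defining functions; that two faces of one chart lie in different hypersurfaces
    is deduced from [dx <> 0]. The dimension count works because the dimension of [M[k]] is affine
    in [k]: the null spaces of [(PiF)_*] and [(PiR)_*] have the same dimension, and the corrected
    lifts show that [(PiS)_*] maps the first onto the second over the partial diagonal. The lift is
    transversal to the partial diagonal, being killed by [(PiF)_*] while [PiF \o s = id]. Lifts
    therefore have no commutators there, whence the extension to fields on [M[3]] by way of
    [M[4]]. *)

Section SmoothOnOpen.
Context {R : realType} {n : nat}.
Implicit Types (O : set 'rV[R]_n) (h f g : 'rV[R]_n -> R).

Lemma Ck_on_cont O k h u : Ck_on O k h -> O u -> {for u, continuous h}.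
Proof. by case: k => [|k] [hc _]; exact: hc. Qed.

Lemma Ck_on_intro O k h : (forall u, O u -> {for u, continuous h}) ->
  (forall k', k = k'.+1 -> forall i : 'I_n,
    (forall u, O u -> derivable h u (delta_mx 0 i)) /\
    Ck_on O k' (fun u => 'D_(delta_mx 0 i) h u)) -> Ck_on O k h.
Proof. by case: k => [|k] hc hd; split=> //; exact: hd. Qed.

Lemma Ck_onW O k h : Ck_on O k.+1 h -> Ck_on O k h.
Proof.
elim: k h => [|k IH] h [hc hd]; split=> // i.
by have [di Di] := hd i; split => //; apply: IH.
Qed.

Lemma Ck_on_sub O O' k h : O' `<=` O -> Ck_on O k h -> Ck_on O' k h.
Proof.
move=> sub; elim: k h => [|k IH] h [hc hd]; apply: Ck_on_intro => //.
- by move=> u /sub /hc.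
- by move=> u /sub /hc.
move=> _ [<-] i; have [di Di] := hd i.
by split; [move=> u /sub /di | exact: IH].
Qed.

Lemma Ck_on_eq O k h h' : open O -> (forall u, O u -> h u = h' u) ->
  Ck_on O k h -> Ck_on O k h'.
Proof.
move=> oO; elim: k h h' => [|k IH] h h' hh hC.
all: have nhh u : O u -> \forall v \near u, h v = h' v by
  move=> Ou; near do rewrite hh//; exact: open_nbhs_nbhs.
all: have hc' u : O u -> {for u, continuous h'} by
  move=> Ou; have E : h x @[x --> u] --> h' u by [rewrite -(hh _ Ou); exact: (Ck_on_cont hC)];
  exact: cvg_trans (near_eq_cvg (nhh _ Ou)) E.
  by split.
split=> // i; have [di Di] := hC.2 i; split.
  by move=> u Ou; apply: near_eq_derivable (nhh _ Ou) _; exact: di.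
by apply: IH Di => u Ou; apply: near_eq_derive (nhh _ Ou).
Unshelve. all: by end_near. Qed.

Lemma Ck_on_cst O k (c : R) : Ck_on O k (fun=> c).
Proof.
elim: k c => [|k IH] c; first by split=> // u _; exact: cst_continuous.
split=> [u _|i]; first exact: cst_continuous.
split=> [u _|]; first exact: derivable_cst.
have -> : (fun u => 'D_(delta_mx 0 i) (fun=> c) u) = (fun=> 0) :> ('rV[R]_n -> R).
  by apply/funext => u; exact: derive_cst.
exact: IH.
Qed.

Lemma Ck_onD O k f g : open O -> Ck_on O k f -> Ck_on O k g -> Ck_on O k (f + g).
Proof.
move=> oO; elim: k f g => [|k IH] f g hf hg.
  by split=> // u Ou; exact: (continuousD (Ck_on_cont hf Ou) (Ck_on_cont hg Ou)).
split=> [u Ou|i]; first exact: (continuousD (Ck_on_cont hf Ou) (Ck_on_cont hg Ou)).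
have [fdi fDi] := hf.2 i; have [gdi gDi] := hg.2 i; split=> [u Ou|].
  by apply: derivableD; [exact: fdi|exact: gdi].
apply: Ck_on_eq (IH _ _ fDi gDi) => // u Ou.
by rewrite deriveD//; [exact: fdi|exact: gdi].
Qed.

Lemma Ck_onM O k f g : open O -> Ck_on O k f -> Ck_on O k g -> Ck_on O k (f * g).
Proof.
move=> oO; elim: k f g => [|k IH] f g hf hg.
  by split=> // u Ou; exact: (continuousM (Ck_on_cont hf Ou) (Ck_on_cont hg Ou)).
split=> [u Ou|i]; first exact: (continuousM (Ck_on_cont hf Ou) (Ck_on_cont hg Ou)).
have [fdi fDi] := hf.2 i; have [gdi gDi] := hg.2 i; split=> [u Ou|].
  by apply: derivableM; [exact: fdi|exact: gdi].
have := Ck_onD oO (IH _ _ (Ck_onW hf) gDi) (IH _ _ (Ck_onW hg) fDi).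
apply: Ck_on_eq => // u Ou.
by rewrite deriveM//; [exact: fdi|exact: gdi].
Qed.

Lemma Ck_onV O k f : open O -> (forall u, O u -> f u != 0) -> Ck_on O k f ->
  Ck_on O k (fun u => (f u)^-1).
Proof.
move=> oO f0; elim: k => [|k IH] hf.
  by split=> // u Ou; exact: (continuousV (f0 _ Ou) (Ck_on_cont hf Ou)).
split=> [u Ou|i]; first exact: (continuousV (f0 _ Ou) (Ck_on_cont hf Ou)).
have [fdi fDi] := hf.2 i; split=> [u Ou|].
  by apply: derivableV; [exact: f0|exact: fdi].
have VC := IH (Ck_onW hf).
have := Ck_onM oO (Ck_on_cst O k (-1)) (Ck_onM oO fDi (Ck_onM oO VC VC)).
apply: Ck_on_eq => // u Ou.
rewrite deriveV//; [|exact: f0|exact: fdi].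
by rewrite !fctE /= /GRing.scale/= expr2 invfM; ring.
Qed.

Lemma is_derive_coord (i j : 'I_n) (u : 'rV[R]_n) :
  is_derive u (delta_mx 0 j) (fun v : 'rV[R]_n => v 0 i : R) (i == j)%:R.
Proof.
have E : (fun h : R => h^-1 *: (((h *: (delta_mx 0 j : 'rV[R]_n) + u) 0 i : R) - u 0 i)) @ 0^'
   --> ((i == j)%:R : R).
  have C : (fun=> (i == j)%:R) @ (0 : R)^' --> ((i == j)%:R : R) by exact: cvg_cst.
  apply: cvg_trans C; apply: near_eq_cvg.
  near=> h; rewrite !mxE eqxx /= addrK /GRing.scale /= mulrA mulVf ?mul1r//.
  by near: h; exact: nbhs_dnbhs_neq.
by split; [apply/cvg_ex; exists ((i == j)%:R) | exact: cvg_lim E].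
Unshelve. all: by end_near. Qed.

Lemma Ck_on_coord O k (i : 'I_n) : Ck_on O k (fun u : 'rV[R]_n => u 0 i).
Proof.
apply: Ck_on_intro => [u _|k' _ j]; first exact: coord_continuous.
have D u := is_derive_coord i j u; split=> [u _|].
  exact: (@ex_derive _ _ _ _ _ _ _ (D u)).
rewrite (_ : (fun _ => _) = fun=> (i == j)%:R); first exact: Ck_on_cst.
by apply/funext => u; exact: (@derive_val _ _ _ _ _ _ _ (D u)).
Qed.

End SmoothOnOpen.

(** * Derivatives along a direction and the mean value theorem on segments *)

Section DirectionalDerivative.
Context {R : realType} {n : nat}.
Implicit Types (O : set 'rV[R]_n) (u v c : 'rV[R]_n) (h f g : 'rV[R]_n -> R).

Lemma line_cvg u v : (s *: v + u) @[s --> (0 : R)] --> u.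
Proof.
rewrite -[X in _ --> X](add0r u) -[X in X + _](scale0r v).
by apply: cvgD; [apply: cvgZr_tmp; exact: cvg_id|exact: cvg_cst].
Qed.

Lemma line_near u v (B : set 'rV[R]_n) :
  nbhs u B -> \forall s \near (0 : R), B (s *: v + u).
Proof. exact: line_cvg. Qed.

(** Through this equivalence calculus in several variables reduces to the one-variable chain rule,
    mean value theorem and criterion for minima. *)
Lemma derive_line f u v s d :
  is_derive (s *: v + u) v f d <-> is_derive s (1 : R) (fun t => f (t *: v + u)) d.
Proof.
have E : (fun h : R => h^-1 *: (f (h *: v + (s *: v + u)) - f (s *: v + u))) =
         (fun h : R => h^-1 *: (f ((h *: (1 : R^o) + s) *: v + u) - f (s *: v + u))).
  by apply/funext => h; rewrite [_%:A]mulr1 scalerDl addrA.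
by split=> -[D <-]; (split; [move: D; rewrite /derivable E | rewrite /derive E]).
Qed.

Lemma is_derive_comp1 (F : R -> R) f u v dF df :
  is_derive (f u) (1 : R) F dF -> is_derive u v f df ->
  is_derive u v (F \o f) (dF * df).
Proof.
move=> HF Hf.
have := (derive_line f u v 0 df).1; rewrite scale0r add0r => /(_ Hf) Hl.
have := (derive_line (F \o f) u v 0 (dF * df)).2; rewrite scale0r add0r; apply.
have fu : f (0 *: v + u) = f u by rewrite scale0r add0r.
have HF' : is_derive (f (0 *: v + u)) (1 : R) F dF by rewrite fu.
exact: (@is_derive1_comp _ F (fun t => f (t *: v + u)) 0 dF df HF' Hl).
Qed.

(** The limit of difference quotients, cleared of the division by [s]. In this form the estimate
    passes to limits in the base point, as [removable_derive] requires. *)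
Lemma is_derive_est f u v d :
  (forall e, 0 < e -> \forall s \near (0 : R),
     `|f (s *: v + u) - f u - s * d| <= e * `|s|) ->
  is_derive u v f d.
Proof.
move=> H.
have E : (fun h : R => h^-1 *: (f (h *: v + u) - f u)) @ 0^' --> d.
  apply/cvgrPdist_le => e e0; near=> s.
  have s0 : s != 0 by near: s; exact: nbhs_dnbhs_neq.
  have H1 : `|f (s *: v + u) - f u - s * d| <= e * `|s|.
    by near: s; apply: cvg_within; exact: H.
  rewrite distrC (_ : _ - d = s^-1 * (f (s *: v + u) - f u - s * d)); last first.
    by rewrite mulrBr mulKf.
  by rewrite normrM normfV ler_pdivrMl ?normr_gt0// [leRHS]mulrC.
by split; [apply/cvg_ex; exists d | exact: cvg_lim E].
Unshelve. all: by end_near. Qed.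

(** Parametrizing the segment by [t] in [[0, 1]] and keeping [s] as a factor treats all signs of [s]
    at once. *)
Lemma MVT_line f (G : 'rV[R]_n -> R) u v (s : R) :
  (forall t, 0 < t < 1 -> is_derive ((t * s) *: v + u) v f (G ((t * s) *: v + u))) ->
  (forall t, 0 <= t <= 1 -> {for (t * s) *: v + u, continuous f}) ->
  exists2 t, 0 < t < 1 & f (s *: v + u) - f u = s * G ((t * s) *: v + u).
Proof.
move=> fd fc.
pose F t := f ((t * s) *: v + u).
have [||c] := @MVT R F (fun t => s * G ((t * s) *: v + u)) 0 1 ltr01.
- move=> t; rewrite in_itv/= => /fd D.
  have Hs : is_derive t (1 : R) (fun t => t * s) s.
    have := @is_deriveM R _ id (cst s) t 1 1 0 _ _.
    by rewrite scaler0 add0r [_ *: _]mulr1; apply.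
  have := (derive_line f u v (t * s) (G ((t * s) *: v + u))).1 D => D'.
  by have := @is_derive1_comp _ (fun t => f (t *: v + u)) (fun t => t * s) t _ _ D' Hs;
    rewrite mulrC.
- apply: continuous_in_subspaceT => t; rewrite inE/= in_itv/= => /fc C.
  apply: (@continuous_comp _ _ _ (fun t : R => (t * s) *: v + u) f t _ C).
  apply: cvgD; last exact: cvg_cst.
  by apply: cvgZr_tmp; apply: cvgMr_tmp; exact: cvg_id.
rewrite in_itv/= => c01; rewrite /F mul1r mul0r scale0r add0r subr0 mulr1 => ->.
by exists c.
Qed.

Lemma is_derive_translate f u v w d :
  is_derive (w + u) v f d -> is_derive u v (fun x => f (w + x)) d.
Proof.
have E : (fun h : R => h^-1 *: (f (w + (h *: v + u)) - f (w + u))) =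
         (fun h : R => h^-1 *: (f (h *: v + (w + u)) - f (w + u))).
  by apply/funext => h; rewrite addrCA.
by move=> -[D <-]; (split; [move: D; rewrite /derivable E | rewrite /derive E]).
Qed.

Definition cube (c : 'rV[R]_n) (d : R) : set 'rV[R]_n :=
  [set v | forall i, `|v 0 i - c 0 i| < d].

Lemma nbhs_cubeP c (A : set 'rV[R]_n) :
  nbhs c A <-> exists2 d, 0 < d & cube c d `<=` A.
Proof.
split.
  move=> /nbhs_ballP[d /= d0 H]; exists d => // v Hv; apply: H.
  by split=> // i j; rewrite (ord1 i) -ball_normE /= distrC.
move=> [d d0 H]; apply/nbhs_ballP; exists d => //= v [_ Hv]; apply: H => i.
by have := Hv 0 i; rewrite -ball_normE /= distrC.
Qed.

Lemma open_cube c d : open (cube c d).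
Proof.
rewrite openE => v Hv; apply/nbhs_cubeP.
(* Without coordinates there is nothing to check. Otherwise [m] is the largest deviation of [v] from
   [c], and [d - m] is the room that is left. *)
have [n0|n0] := posnP n.
  by exists 1 => // w _ i; exfalso; case: i => j; rewrite n0.
pose i0 := Ordinal n0; pose m := \big[Order.max/`|v 0 i0 - c 0 i0|]_i `|v 0 i - c 0 i|.
have md : m < d by apply: bigmax_lt => // i _; exact: Hv.
exists (d - m); first by rewrite subr_gt0.
move=> w Hw i; have := Hw i; have : `|v 0 i - c 0 i| <= m by exact: le_bigmax.
have := ler_distD (v 0 i) (w 0 i) (c 0 i); lra.
Qed.

End DirectionalDerivative.

(** * The flat functions behind the bump functions *)

Section FlatFunction.
Context {R : realType}.

(** These are [x^(-k) exp(-1/x)] continued by zero. The derivative of one member is a linear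
    combination of members with larger [k], so the whole family is treated by one induction. *)
Definition flat (k : nat) (x : R) : R :=
  if 0 < x then x^-1 ^+ k * expR (- x^-1) else 0.

Lemma flat_gt0 k x : 0 < x -> 0 < flat k x.
Proof. by move=> x0; rewrite /flat x0 mulr_gt0 ?expR_gt0// exprn_gt0 ?invr_gt0. Qed.

Lemma flat_eq0 k x : x <= 0 -> flat k x = 0.
Proof. by move=> x0; rewrite /flat ltNge x0. Qed.

Lemma flat_ge0 k x : 0 <= flat k x.
Proof. by case: (ltP 0 x) => [/(flat_gt0 k)/ltW//|/flat_eq0->]. Qed.

(** With [y = 1/x] this is [y^(k+1) <= (k+1)! exp y], a single term of the exponential series. *)
Lemma flat_le k x : flat k x <= (k.+1)`!%:R * `|x|.
Proof.
case: (ltP 0 x) => [x0|/flat_eq0 ->]; last by rewrite mulr_ge0.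
rewrite /flat x0 (gtr0_norm x0); set y := x^-1; have y0 : 0 < y by rewrite invr_gt0.
have -> : x = y^-1 by rewrite invrK.
rewrite expRN.
rewrite ler_pdivrMr ?expR_gt0// mulrAC ler_pdivlMr// -exprSr mulrC.
rewrite -ler_pdivrMr ?ltr0n ?fact_gt0//.
apply: le_trans (expR_ge1Dxn k (ltW y0)); lra.
Qed.

Lemma exprfE (T : Type) (f : T -> R) k x : (f ^+ k) x = f x ^+ k.
Proof. by elim: k => [//|k IH]; rewrite !exprS -IH. Qed.

Lemma mulfctE (T : Type) (f g : T -> R) x : (f * g) x = f x * g x.
Proof. by []. Qed.

Lemma is_derive_flat k x :
  is_derive x (1 : R) (flat k) (flat k.+2 x - k%:R * flat k.+1 x).
Proof.
have [x0|x0|->] := ltgtP x 0.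
- rewrite !flat_eq0 ?(ltW x0)// mulr0 subr0.
  have H : is_derive x (1 : R) (cst (0 : R)) (0 : R) by exact: is_derive_cst.
  apply: near_eq_is_derive H.
  by near=> y; rewrite flat_eq0//; apply: ltW; near: y; exact: lt_nbhsl.
- have D : is_derive x (1 : R) (fun y => y^-1) (- (x ^- 2)).
    have x0' : id x != 0 :> R by rewrite gt_eqF.
    have := @is_deriveV R id x 1 1 x0' (is_derive_id _ _).
    by rewrite [_ *: _]mulr1.
  apply: (@near_eq_is_derive _ _ _ ((fun y : R => y^-1) ^+ k * (fun y => expR (- y^-1)))).
    near=> y; rewrite /flat ifT; last by near: y; exact: lt_nbhsr.
    by rewrite mulfctE exprfE.
  have DE : is_derive x (1 : R) (fun y => expR (- y^-1)) (expR (- x^-1) * (x ^- 2)).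
    apply: (@is_derive1_comp _ expR (fun y => - y^-1)).
    by have := is_deriveN D; rewrite opprK.
  apply: (is_derive_eq (is_deriveM (is_deriveX k D) DE)); rewrite /flat x0 !exprfE /GRing.scale/= -exprVn.
  by case: k => [|k]; rewrite ?mul0r ?mulr0 ?mulN1r ?exprS/=; ring.
(* At the origin the difference quotient of [flat k] is [flat k.+1], which tends to zero by
   [flat_le]. *)
- rewrite !flat_eq0// mulr0 subr0.
  have E : (fun h : R => h^-1 *: (flat k (h *: (1 : R^o) + 0) - flat k 0)) @ 0^' --> (0 : R).
    apply/cvgrPdist_le => e e0; near=> s.
    have s0 : s != 0 by near: s; exact: nbhs_dnbhs_neq.
    rewrite sub0r normrN addr0 [_%:A]mulr1 [flat k 0]flat_eq0// subr0.
    have -> : s^-1 *: flat k s = flat k.+1 s.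
      by rewrite /GRing.scale /= /flat; case: ifP => _; rewrite ?mulr0// exprS mulrA.
    rewrite ger0_norm ?flat_ge0//; apply: le_trans (flat_le _ _) _.
    rewrite -ler_pdivlMl ?ltr0n ?fact_gt0//.
    apply: ltW; near: s; apply: dnbhs0_lt.
    by rewrite mulr_gt0 ?invr_gt0 ?ltr0n ?fact_gt0.
  by split; [apply/cvg_ex; exists 0 | exact: cvg_lim E].
Unshelve. all: by end_near. Qed.

Lemma continuous_flat k : continuous (flat k).
Proof.
move=> x; apply: differentiable_continuous; apply/derivable1_diffP.
exact: (@ex_derive _ _ _ _ _ _ _ (is_derive_flat k x)).
Qed.

(** The induction on [m] keeps [k] general, since differentiating brings in [flat k.+1] and
    [flat k.+2]. *)
Lemma Ck_on_flat n (O : set 'rV[R]_n) k m w : open O -> Ck_on O m w ->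
  Ck_on O m (fun u => flat k (w u)).
Proof.
move=> oO; have C (i : nat) p u : Ck_on O p w -> O u ->
    {for u, continuous (fun u => flat i (w u))}.
  move=> wC Ou; apply: (@continuous_comp _ _ _ w (flat i) u); last exact: continuous_flat.
  exact: Ck_on_cont wC Ou.
elim: m k => [|m IH] k wC; first by split=> // u Ou; exact: C wC Ou.
split=> [u Ou|i]; first exact: C wC Ou.
have [wi wD] := wC.2 i.
have D u : O u -> is_derive u (delta_mx 0 i) (fun u => flat k (w u))
    ((flat k.+2 (w u) - k%:R * flat k.+1 (w u)) * 'D_(delta_mx 0 i) w u).
  move=> Ou; apply: is_derive_comp1; first exact: is_derive_flat.
  exact: derivableP (wi _ Ou).
split=> [u Ou|]; first exact: (@ex_derive _ _ _ _ _ _ _ (D u Ou)).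
have wC' := Ck_onW wC.
have := Ck_onM oO (Ck_onD oO (IH k.+2 wC')
   (Ck_onM oO (Ck_on_cst O m (- k%:R)) (IH k.+1 wC'))) wD.
apply: Ck_on_eq => // u Ou.
by rewrite (@derive_val _ _ _ _ _ _ _ (D u Ou)) !fctE mulNr.
Qed.

End FlatFunction.

Section Substitution.
Context {R : realType} {n : nat}.
Implicit Types (O : set 'rV[R]_n) (u v c : 'rV[R]_n) (h f g : 'rV[R]_n -> R).

(* Affine substitutions sending coordinate lines to coordinate lines or points;
   no chain rule is needed for these. *)
Definition coordinate_map (A : 'rV[R]_n -> 'rV[R]_n) :=
  continuous A /\
  forall i, (exists j, forall s u, A (s *: delta_mx 0 i + u) = s *: delta_mx 0 j + A u) \/
            (forall s u, A (s *: delta_mx 0 i + u) = A u).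

Lemma Ck_on_subst O k A h : coordinate_map A -> Ck_on O k h ->
  Ck_on (A @^-1` O) k (h \o A).
Proof.
move=> [cA HA].
have C h' k' u : Ck_on O k' h' -> O (A u) -> {for u, continuous (h' \o A)}.
  by move=> hC Ou; apply: continuous_comp; [exact: cA|exact: Ck_on_cont hC Ou].
elim: k h => [|k IH] h hC; first by split=> // u Ou; exact: C hC Ou.
split=> [u Ou|i]; first exact: C hC Ou.
have [[j Hj]|Hi] := HA i.
  have E u : (fun t : R => t^-1 *: ((h \o A) (t *: delta_mx 0 i + u) - (h \o A) u)) =
             (fun t : R => t^-1 *: (h (t *: delta_mx 0 j + A u) - h (A u))).
    by apply/funext => t; rewrite /= Hj.
  have [hj hD] := hC.2 j; split.
    by move=> u Ou; rewrite /derivable E; exact: hj.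
  rewrite (_ : (fun u => _) = (fun u => 'D_(delta_mx 0 j) h u) \o A); first exact: IH.
  by apply/funext => u; rewrite /derive E.
have E u : (fun t : R => t^-1 *: ((h \o A) (t *: delta_mx 0 i + u) - (h \o A) u)) = fun=> 0.
  by apply/funext => t; rewrite /= Hi subrr scaler0.
split; first by move=> u Ou; rewrite /derivable E; exact: is_cvg_cst.
rewrite (_ : (fun u => _) = (fun=> 0 : R)); first exact: Ck_on_cst.
by apply/funext => u; rewrite /derive E; exact: lim_cst.
Qed.

Definition set_coord (i : 'I_n) (a : R) u : 'rV[R]_n :=
  \row_j (if j == i then a else u 0 j).

Lemma rV_continuous (T : topologicalType) (A : T -> 'rV[R]_n) x :
  (forall i, {for x, continuous (fun y => A y 0 i)}) -> {for x, continuous A}.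
Proof.
move=> H B /nbhs_cubeP[d d0 dB].
have : \forall y \near x, forall i, `|A y 0 i - A x 0 i| < d.
  apply: filter_forall => i; have := H i; move=> /cvgrPdist_lt/(_ d d0).
  by apply: filterS => y; rewrite distrC.
by apply: filterS => y Hy; exact: dB.
Qed.

Lemma coordinate_map_set_coord i a : coordinate_map (set_coord i a).
Proof.
split=> [u|j].
  apply: rV_continuous => j.
  have [ji|ji] := eqVneq j i.
    rewrite (_ : (fun y => _) = fun=> a); first exact: cst_continuous.
    by apply/funext => y; rewrite mxE ji eqxx.
  rewrite (_ : (fun y => _) = fun y : 'rV[R]_n => y 0 j); first exact: coord_continuous.
  by apply/funext => y; rewrite mxE (negbTE ji).
have [->|ji] := eqVneq j i; [right|left; exists j] => s u;
  apply/rowP => k; rewrite !mxE !eqxx /=; have [ki|ki] := eqVneq k i => //.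
- by rewrite mulr0 add0r.
- by rewrite ki eq_sym (negbTE ji) mulr0 add0r.
Qed.

Lemma coordinate_map_perm (s : 'I_n -> 'I_n) c : injective s ->
  coordinate_map (fun u => \row_j (u 0 (s j)) + c).
Proof.
move=> si; split=> [u|i].
  apply: rV_continuous => j.
  rewrite (_ : (fun y => _) = fun y : 'rV[R]_n => y 0 (s j) + c 0 j); last first.
    by apply/funext => y; rewrite !mxE.
  apply: (@continuousD _ _ _ (fun y : 'rV[R]_n => y 0 (s j)) (cst (c 0 j))).
    exact: coord_continuous.
  exact: cst_continuous.
left; have [t st ts] := injF_bij si; exists (t i) => r u.
apply/rowP => k; rewrite !mxE !eqxx /= addrA; congr (_ * _%:R + _ + _).
by rewrite -{1}(ts i) (inj_eq si).
Qed.

End Substitution.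

(** * Symmetry of second derivatives, removable hyperplanes, and Hadamard's lemma *)

Section Division.
Context {R : realType} {n : nat}.
Implicit Types (O : set 'rV[R]_n) (u v c : 'rV[R]_n) (h f g : 'rV[R]_n -> R).
Local Notation e_ i := (delta_mx 0 i : 'rV[R]_n).

Lemma continuous_cubeP f u : {for u, continuous f} <->
  forall e, 0 < e -> exists2 d, 0 < d & forall v, cube u d v -> `|f u - f v| < e.
Proof.
split=> [fC e e0|H].
  by move: fC => /cvgrPdist_lt/(_ _ e0)/nbhs_cubeP[d d0 D]; exists d.
have : f x @[x --> nbhs u] --> f u by apply/cvgrPdist_lt => e /H ?; exact/nbhs_cubeP.
by [].
Qed.

Lemma cube_shift c d v i s : cube c (d / 2) v -> `|s| < d / 2 -> cube c d (s *: e_ i + v).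
Proof.
move=> Hv Hs j; rewrite !mxE eqxx /=; have := Hv j.
have : `|s * (j == i)%:R| <= `|s|.
  by rewrite normrM; case: (j == i); rewrite ?normr1 ?normr0 ?mulr1 ?mulr0.
have := ler_normD (s * (j == i)%:R) (v 0 j - c 0 j); rewrite addrA; lra.
Qed.

Lemma cube_center c d : 0 < d -> cube c d c.
Proof. by move=> d0 i; rewrite subrr normr0. Qed.

Lemma cube_le c d d' : d <= d' -> cube c d `<=` cube c d'.
Proof. by move=> dd v Hv i; exact: lt_le_trans (Hv i) dd. Qed.

(** For [i = j] the two shifts add up to as much as [2 * s], and the cube is open: hence the radius
    [3 * s]. *)
Lemma cube_shift2 u (i j : 'I_n) (r t : R) s : 0 <= r <= s -> 0 <= t <= s -> 0 < s ->
  cube u (3 * s) (r *: e_ i + (t *: e_ j + u)).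
Proof.
move=> r01 t01 s0 k; rewrite !mxE eqxx /= !addrA addrK.
have A (x : R) (b : bool) : 0 <= x <= s -> 0 <= x * b%:R <= s.
  by case: b => /andP[x0 x1]; rewrite ?mulr1 ?mulr0 ?lexx ?(ltW s0)// x0.
have /andP[A1 A2] := A r (k == i) r01; have /andP[A3 A4] := A t (k == j) t01.
by rewrite ger0_norm; lra.
Qed.

(** The mean value theorem is applied twice: along [e_i] to the increment [ph] of [h] in the
    direction [e_j], then along [e_j] to [Di]. *)
Lemma double_difference O h (Di Dij : 'rV[R]_n -> R) i j u s : 0 < s ->
  cube u (3 * s) `<=` O ->
  (forall v, O v -> {for v, continuous h}) -> (forall v, O v -> {for v, continuous Di}) ->
  (forall v, O v -> is_derive v (e_ i) h (Di v)) ->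
  (forall v, O v -> is_derive v (e_ j) Di (Dij v)) ->
  exists2 v, cube u (3 * s) v &
   h (s *: e_ j + (s *: e_ i + u)) - h (s *: e_ i + u) - (h (s *: e_ j + u) - h u)
   = s * (s * Dij v).
Proof.
move=> s0 dO hC DiC hD DiD.
have inO r t k l : 0 <= r <= 1 -> 0 <= t <= 1 ->
    O ((r * s) *: e_ k + ((t * s) *: e_ l + u)).
  move=> /andP[r0 r1] /andP[t0 t1]; apply/dO/cube_shift2 => //.
    by rewrite mulr_ge0 ?(ltW s0)//= ler_piMl ?(ltW s0).
  by rewrite mulr_ge0 ?(ltW s0)//= ler_piMl ?(ltW s0).
have inO1 r k : 0 <= r <= 1 -> O ((r * s) *: e_ k + u).
  by move=> r01; have := @inO r 0 k k r01; rewrite mul0r scale0r add0r lexx ler01; apply.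
have inO2 t : 0 <= t <= 1 -> O (s *: e_ j + ((t * s) *: e_ i + u)).
  by move=> t01; have := @inO 1 t j i _ t01; rewrite mul1r lexx ler01; apply.
pose ph v := h (s *: e_ j + v) - h v.
have [||t /andP[t0 t1]] := @MVT_line _ _ ph (fun v => Di (s *: e_ j + v) - Di v) u (e_ i) s.
- move=> t /andP[/ltW t0 /ltW t1]; have t01 : 0 <= t <= 1 by rewrite t0.
  apply: is_deriveB; first by apply/is_derive_translate/hD/inO2.
  by apply/hD/inO1.
- move=> t t01; apply: (@continuousB _ _ _ (fun v => h (s *: e_ j + v)) h); last exact/hC/inO1.
  apply: (@continuous_comp _ _ _ (fun v => s *: e_ j + v) h); last exact/hC/inO2.
  by apply: (@continuousD _ _ _ (cst (s *: e_ j)) id); [exact: cst_continuous | exact: cvg_id].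
rewrite /ph => ->.
have t01 : 0 <= t <= 1 by rewrite !ltW.
have [||r /andP[r0 r1] ->] := @MVT_line _ _ Di Dij ((t * s) *: e_ i + u) (e_ j) s.
- by move=> r /andP[/ltW r0 /ltW r1]; apply/DiD/inO => //; rewrite r0.
- by move=> r r01; apply/DiC/inO.
exists ((r * s) *: e_ j + ((t * s) *: e_ i + u)) => //.
by apply: cube_shift2 => //; rewrite mulr_ge0 ?(ltW s0) ?(ltW r0) ?(ltW t0)//= ler_piMl// ltW.
Qed.

Lemma difference_sym (A A' B C D x y : R) :
  A = A' -> A - B - (C - D) = x -> A' - C - (B - D) = y -> x = y.
Proof. by move=> -> <- <-; ring. Qed.

Lemma dist_split (a b x e : R) : `|a - x| < e / 2 -> `|b - x| < e / 2 -> `|a - b| < e.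
Proof.
move=> A B; have -> : a - b = (a - x) - (b - x) by rewrite opprB addrA subrK.
by apply: le_lt_trans (ler_normB _ _) _; rewrite (splitr e) ltrD.
Qed.

Lemma dist_eq (a b : R) : (forall e, 0 < e -> `|a - b| < e) -> a = b.
Proof.
move=> H; apply/eqP; rewrite -subr_eq0 -normr_le0; apply/ler_addgt0Pl => e e0.
by rewrite addr0 ltW// H.
Qed.

(** The double difference is symmetric in [i] and [j], so the two mixed derivatives take the same
    value at two points arbitrarily close to [u]; their continuity at [u] does the rest. *)
Lemma Schwarz O h i j u : open O -> O u -> Ck_on O 2 h ->
  'D_(e_ j) (fun w => 'D_(e_ i) h w) u = 'D_(e_ i) (fun w => 'D_(e_ j) h w) u.
Proof.
move=> oO Ou hC.
set a := LHS; set b := RHS.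
apply: dist_eq => e e0.
have Ca : {for u, continuous (fun v => 'D_(e_ j) (fun w => 'D_(e_ i) h w) v)}.
  exact: ((hC.2 i).2.2 j).2.1 u Ou.
have Cb : {for u, continuous (fun v => 'D_(e_ i) (fun w => 'D_(e_ j) h w) v)}.
  exact: ((hC.2 j).2.2 i).2.1 u Ou.
have e20 : 0 < e / 2 by rewrite divr_gt0.
move: (Ca) => /cvgrPdist_lt/(_ _ e20)/nbhs_cubeP[d1 d10 H1].
move: (Cb) => /cvgrPdist_lt/(_ _ e20)/nbhs_cubeP[d2 d20 H2].
have /nbhs_cubeP[d3 d30 H3] : nbhs u O by exact: open_nbhs_nbhs.
(* The cube of radius [3 * s] has to lie in both cubes of continuity and in [O]. *)
pose s := Num.min d1 (Num.min d2 d3) / 3.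
have s3 : 3 * s = Num.min d1 (Num.min d2 d3) by rewrite /s mulrCA divff// mulr1.
have s0 : 0 < s by rewrite divr_gt0// !lt_min d10 d20.
have dO : cube u (3 * s) `<=` O.
  by apply: subset_trans H3; apply: cube_le; rewrite s3 !ge_min lexx !orbT.
have DD k l : exists2 v, cube u (3 * s) v &
   h (s *: e_ l + (s *: e_ k + u)) - h (s *: e_ k + u) - (h (s *: e_ l + u) - h u)
   = s * (s * 'D_(e_ l) (fun w => 'D_(e_ k) h w) v).
  have [hk hDk] := hC.2 k; have [hkl _] := hDk.2 l.
  apply: (double_difference s0 dO) => w Ow.
  - exact: hC.1.
  - exact: hDk.1.
  - exact: derivableP (hk _ Ow).
  - exact: derivableP (hkl _ Ow).
have [v Hv E1] := DD i j; have [w Hw E2] := DD j i.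
have : 'D_(e_ j) (fun w => 'D_(e_ i) h w) v = 'D_(e_ i) (fun w => 'D_(e_ j) h w) w.
  apply: (mulfI (lt0r_neq0 s0)); apply: (mulfI (lt0r_neq0 s0)).
  exact: difference_sym (congr1 h (addrCA _ _ _)) E1 E2.
have := H1 v (cube_le _ Hv); rewrite s3 !ge_min lexx => /(_ isT).
have := H2 w (cube_le _ Hw); rewrite s3 !ge_min lexx !orbT => /(_ isT).
move=> B A E.
by apply: dist_split (B); rewrite -E.
Qed.

(** On a segment whose interior avoids the hyperplane, the mean value theorem and the continuity of
    [G] bound the error of the linear approximation; [K] below is this estimate. *)
Lemma removable_derive O f (G : 'rV[R]_n -> R) i j a : open O ->
  (forall u, O u -> {for u, continuous f}) -> (forall u, O u -> {for u, continuous G}) ->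
  (forall u, O u -> u 0 i != a -> is_derive u (e_ j) f (G u)) ->
  forall u, O u -> is_derive u (e_ j) f (G u).
Proof.
move=> oO fC GC fD u Ou; have [ua|ua] := eqVneq (u 0 i) a; last exact: fD.
apply: is_derive_est => e e0.
move: (GC _ Ou) => /cvgrPdist_lt/(_ _ e0)/nbhs_cubeP[d1 d10 H1].
have /nbhs_cubeP[d2 d20 H2] : nbhs u O by exact: open_nbhs_nbhs.
pose d := Num.min d1 d2.
have d0 : 0 < d by rewrite lt_min d10.
have dO : cube u d `<=` O by apply: subset_trans H2; apply: cube_le; rewrite ge_min lexx orbT.
have dG v : cube u d v -> `|G v - G u| <= e.
  move=> Hv; rewrite distrC ltW//; apply: H1; apply: cube_le Hv.
  by rewrite ge_min lexx.
have K s w : (forall t, 0 <= t <= 1 -> cube u d ((t * s) *: e_ j + w)) ->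
    (forall t, 0 < t < 1 -> ((t * s) *: e_ j + w) 0 i != a) ->
    `|f (s *: e_ j + w) - f w - s * G u| <= e * `|s|.
  move=> Hw Hwa; have [t t01|t t01|t /andP[t0 t1] ->] := @MVT_line _ _ f G w (e_ j) s.
  - apply: fD; [apply/dO/Hw; case/andP: t01 => *; by rewrite !ltW | exact: Hwa].
  - by apply/fC/dO/Hw.
  - rewrite -mulrBr normrM mulrC ler_wpM2r//; apply/dG/Hw.
    by rewrite !ltW.
near=> s.
have sd : `|s| < d / 2.
  by near: s; apply: (@nbhs0_lt R R^o); rewrite divr_gt0.
have d20' : 0 < d / 2 by rewrite divr_gt0.
have tsd t : 0 <= t <= 1 -> `|t * s| < d / 2.
  move=> /andP[t0 t1]; rewrite normrM ger0_norm//; apply: le_lt_trans sd.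
  by rewrite ler_piMl.
have [->|s0] := eqVneq s 0.
  by rewrite scale0r add0r subrr mul0r subrr normr0 mulr0.
(* A segment starting at [u] in the direction [e_i] meets the hyperplane only at its end point. *)
have [ij|ij] := eqVneq i j.
  apply: K => t.
    by move=> t01; apply: cube_shift; [exact: cube_center|exact: tsd].
  move=> /andP[t0 t1]; rewrite !mxE ij !eqxx mulr1 -ij ua -subr_eq0 addrK.
  by rewrite mulf_neq0// gt_eqF.
(* For [j <> i] the segment lies inside the hyperplane. It is pushed off by [r *: e_ i], and the
   estimate survives the limit [r -> 0] because [f] is continuous. *)
have L : (fun r : R => `|f (s *: e_ j + (r *: e_ i + u)) - f (r *: e_ i + u) - s * G u|) @ 0^'
    --> `|f (s *: e_ j + u) - f u - s * G u|.
  apply: cvg_norm; apply: cvgB; last exact: cvg_cst.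
  have C w : O w -> f (r *: e_ i + w) @[r --> (0:R)^'] --> f w.
    move=> Ow; apply: cvg_within_filter.
    have A := @line_cvg _ _ w (e_ i); exact: cvg_comp A (fC _ Ow).
  apply: cvgB; last exact: C.
  have -> : (fun r : R => f (s *: e_ j + (r *: e_ i + u))) = (fun r => f (r *: e_ i + (s *: e_ j + u))).
    by apply/funext => r; rewrite addrCA.
  by apply/C/dO/cube_shift => //; exact: cube_center.
apply: cvgr_to_le L _; near=> r.
have r0 : r != 0 by near: r; exact: nbhs_dnbhs_neq.
have rd : `|r| < d / 2 / 2 by near: r; apply: dnbhs0_lt; rewrite divr_gt0.
apply: K => t.
  move=> t01; apply: cube_shift; last exact: tsd.
  by apply: cube_shift => //; apply: cube_center; rewrite divr_gt0.
move=> _; rewrite !mxE !eqxx (negbTE ij) mulr0 add0r mulr1 ua -subr_eq0 addrK.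
exact: r0.
Unshelve. all: by end_near. Qed.

(* [divpow m h] is [h / (u_i - a)^m], continued to the hyperplane [u_i = a] by
   [D_i^m h / m!]; it is only used for [h] vanishing to order [m] there. *)
Fixpoint divpow i (a : R) (m : nat) h u : R :=
  if u 0 i == a then
    (if m is m'.+1 then divpow i a m' (fun w => 'D_(e_ i) h w) u / m%:R else h u)
  else h u / (u 0 i - a) ^+ m.

Fixpoint vanishes O i (a : R) (m : nat) h : Prop :=
  if m is m'.+1 then (forall u, O u -> u 0 i = a -> h u = 0) /\
     vanishes O i a m' (fun w => 'D_(e_ i) h w) else True.

Lemma divpowE i a m h u : u 0 i != a -> divpow i a m h u = h u / (u 0 i - a) ^+ m.
Proof. by case: m => [|m] /= /negbTE ->. Qed.

Lemma divpowE0 i a m h u : u 0 i = a ->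
  divpow i a m.+1 h u = divpow i a m (fun w => 'D_(e_ i) h w) u / m.+1%:R.
Proof. by move=> /= ->; rewrite eqxx. Qed.

Lemma vanishes_eq O i a m h h' : open O -> (forall u, O u -> h u = h' u) ->
  vanishes O i a m h -> vanishes O i a m h'.
Proof.
move=> oO; elim: m h h' => //= m IH h h' hh [h0 hV]; split.
  by move=> u Ou ua; rewrite -hh//; exact: h0.
apply: IH hV => u Ou; apply: near_eq_derive.
by near do rewrite hh//; exact: open_nbhs_nbhs.
Unshelve. all: by end_near. Qed.

(** The direction [e_j] is tangent to the hyperplane, so zero values there give zero
    [j]-derivatives; higher orders follow because [D_j] and [D_i] commute. *)
Lemma vanishes_derive O i j a m h : open O -> i != j -> (forall k, Ck_on O k h) ->
  vanishes O i a m h -> vanishes O i a m (fun w => 'D_(e_ j) h w).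
Proof.
move=> oO ij; elim: m h => //= m IH h hC [h0 hV]; split.
  move=> u Ou ua; rewrite /derive; apply: lim_near_cst => //.
  have [d d0 dO] := (nbhs_cubeP _ _).1 (open_nbhs_nbhs (conj oO Ou)).
  near=> t; rewrite /= (h0 u Ou ua) h0 ?subrr ?scaler0//.
    apply/dO; apply: cube_shift; first by apply: cube_center; rewrite divr_gt0.
    by near: t; apply: dnbhs0_lt; rewrite divr_gt0.
  by rewrite !mxE (negbTE ij) mulr0 add0r.
apply: (vanishes_eq oO) (IH _ _ hV) => [u Ou|k].
  exact: Schwarz (hC 2%N).
by have [_ /(_ i)[]] := hC k.+1.
Unshelve. all: by end_near. Qed.

(** The function is the numerator of the [i]-derivative of [h / (u_i - a)^m] over the denominator
    [(u_i - a)^(m+1)]. Applying [D_i] to it for [m+1] and [h] gives the same expression for [m] and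
    [D_i h], which drives the induction. *)
Lemma vanishes_S O i a m h : open O -> (forall k, Ck_on O k h) -> vanishes O i a m h ->
  vanishes O i a m.+1 (fun w => (w 0 i - a) * 'D_(e_ i) h w - m%:R * h w).
Proof.
move=> oO; elim: m h => [|m IH] h hC hV.
  by split=> // u Ou ua; rewrite ua subrr !mul0r subrr.
have hDC k : Ck_on O k (fun w => 'D_(e_ i) h w) by have [_ /(_ i)[]] := hC k.+1.
have [h0 hV'] := hV; split.
  by move=> u Ou ua; rewrite ua subrr mul0r h0// mulr0 subrr.
apply: (vanishes_eq oO) (IH _ hDC hV') => u Ou.
have D1 : is_derive u (e_ i) (fun w : 'rV[R]_n => w 0 i - a) 1.
  have := is_deriveB (is_derive_coord i i u) (is_derive_cst a u (e_ i)).
  by rewrite eqxx subr0.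
have D2 := derivableP (((hDC 1%N).2 i).1 u Ou).
have D3 := derivableP (((hC 1%N).2 i).1 u Ou).
have D4 := is_deriveB (is_deriveM D1 D2) (is_deriveZ (m.+1%:R : R) D3).
apply/esym; have -> : (fun w : 'rV[R]_n => (w 0 i - a) * 'D_(e_ i) h w - m.+1%:R * h w) =
  (fun w : 'rV[R]_n => w 0 i - a) * (fun w => 'D_(e_ i) h w) - m.+1%:R *: h by [].
rewrite (@derive_val _ _ _ _ _ _ _ D4).
move: ('D_(e_ i) (fun w => _) u) ('D_(e_ i) h u) => x y.
by rewrite /GRing.scale /= -natr1; ring.
Qed.

(** This is l'Hopital's rule in mean value form: Rolle's theorem is applied to [G], which subtracts
    [t^(m+1) h v] from [h] along the segment joining [v] to its projection on the hyperplane. *)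
Lemma Rolle_quotient O h (Di : 'rV[R]_n -> R) i a m v : v 0 i != a ->
  (forall t, 0 <= t <= 1 -> O (((t - 1) * (v 0 i - a)) *: e_ i + v)) ->
  (forall w, O w -> is_derive w (e_ i) h (Di w)) ->
  (forall w, O w -> w 0 i = a -> h w = 0) ->
  exists2 t, 0 < t < 1 &
    h v / (v 0 i - a) ^+ m.+1 =
    Di (((t - 1) * (v 0 i - a)) *: e_ i + v) / (t * (v 0 i - a)) ^+ m / m.+1%:R.
Proof.
move=> va inO hD h0; set T := v 0 i - a; have T0 : T != 0 by rewrite subr_eq0.
pose G t := h (((t - 1) * T) *: e_ i + v) - t ^+ m.+1 * h v.
have HG (t : R) : 0 <= t <= 1 -> is_derive t (1 : R) G
    (Di (((t - 1) * T) *: e_ i + v) * T - (m.+1%:R * t ^+ m) * h v).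
  move=> t01; apply: is_deriveB.
    have D := (derive_line h v (e_ i) ((t - 1) * T) (Di (((t - 1) * T) *: e_ i + v))).1 (hD _ (inO _ t01)).
    have Hs : is_derive t (1 : R) (fun t => (t - 1) * T) T.
      have := @is_deriveM _ _ (fun t : R => t - 1) (cst T) t 1 1 0 _ _.
      rewrite scaler0 add0r [_ *: _]mulr1; apply.
        by have := is_deriveB (is_derive_id t (1 : R)) (is_derive_cst (1 : R) t 1); rewrite subr0.
    exact: (@is_derive1_comp _ (fun t => h (t *: e_ i + v)) (fun t => (t - 1) * T) t _ _ D Hs).
  have := is_deriveM (is_deriveX m.+1 (is_derive_id t (1 : R))) (is_derive_cst (h v) t 1).
  rewrite scaler0 add0r /= => H.
  have -> : (fun x : R => x ^+ m.+1 * h v) = (id ^+ m.+1) * cst (h v).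
    by apply/funext => x; rewrite mulfctE exprfE.
  by apply: (is_derive_eq H); rewrite /GRing.scale /= mulr1 mulrC.
have [|||c] := @Rolle R G 0 1 ltr01.
- move=> t; rewrite in_itv/= => /andP[/ltW t0 /ltW t1].
  by apply: (@ex_derive _ _ _ _ _ _ _ (HG t _)); rewrite t0.
- apply: derivable_within_continuous => t; rewrite in_itv /= => t01.
  exact: (@ex_derive _ _ _ _ _ _ _ (HG t t01)).
- rewrite /G sub0r mulN1r subrr mul0r scale0r add0r expr0n /= mul0r subr0 expr1n mul1r subrr.
  apply: h0; last by rewrite !mxE !eqxx mulr1 opprB subrK.
  by have := inO 0; rewrite sub0r mulN1r; apply; rewrite lexx ler01.
rewrite in_itv/= => /andP[c0 c1] /(@derive_val _ _ _ _ _ _ _).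
have c01 : 0 <= c <= 1 by rewrite !ltW.
rewrite (@derive_val _ _ _ _ _ _ _ (HG c c01)).
set x := Di _ => /eqP; rewrite subr_eq0 => /eqP E.
exists c; first by rewrite c0.
have m0 : m.+1%:R != 0 :> R by rewrite pnatr_eq0.
have c00 : c ^+ m != 0 by rewrite expf_neq0// gt_eqF.
have Tm : T ^+ m != 0 by rewrite expf_neq0.
rewrite exprMn exprS -/x; move: (h v) (c ^+ m) (T ^+ m) (m.+1%:R : R) E m0 c00 Tm.
clearbody x T; clear -T0 => y cm Tm k E k0 cm0 Tm0.
have -> : x = k * cm * y / T by rewrite -E mulfK.
by field; rewrite k0 T0 cm0 Tm0.
Qed.

(** Near a point of the hyperplane, [Rolle_quotient] replaces the quotient of [h] by that of [D_i h]
    with exponent one less, whose continuity is the induction hypothesis. *)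
Lemma continuous_divpow c d i m h : 0 < d -> (forall k, Ck_on (cube c d) k h) ->
  vanishes (cube c d) i (c 0 i) m h ->
  forall u, cube c d u -> {for u, continuous (divpow i (c 0 i) m h)}.
Proof.
move=> d0; set a := c 0 i; set O := cube c d.
have Coff g k u : (forall k, Ck_on O k g) -> O u -> u 0 i != a ->
    {for u, continuous (divpow i a k g)}.
  move=> gC Ou ua.
  have oO : open (O `&` [set v | v 0 i != a]).
    apply: openI; first exact: open_cube.
    by apply: (@open_comp _ _ (fun v : 'rV[R]_n => v 0 i) [set x | x != a]);
      [move=> v _; exact: coord_continuous | exact: open_neq].
  have : Ck_on (O `&` [set v | v 0 i != a]) 0 (fun v => g v / (v 0 i - a) ^+ k).
    apply: Ck_onM => //; first by apply: (Ck_on_sub _ (gC _)) => v [].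
    apply: Ck_onV => // [v [_ /=]|].
      by move=> va; rewrite expf_neq0// subr_eq0.
    rewrite (_ : (fun _ => _) = (fun v : 'rV[R]_n => v 0 i - a) ^+ k); last first.
      by apply/funext => v; rewrite exprfE.
    elim: k => [|k IH]; first exact: Ck_on_cst.
    rewrite exprS; apply: Ck_onM => //.
    by apply: Ck_onD => //; [exact: Ck_on_coord|exact: Ck_on_cst].
  move=> /(Ck_on_eq (h' := divpow i a k g) oO) H; apply: (Ck_on_cont (H _)) => //.
  by move=> v [_ va]; rewrite divpowE.
elim: m h => [|m IH] h hC hV u Ou.
  have [ua|] := eqVneq (u 0 i) a; last exact: Coff.
  rewrite (_ : divpow i a 0 h = h); first exact: (Ck_on_cont (hC 0%N)).
  by apply/funext => v; rewrite /= expr0 divr1; case: ifP.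
have [ua|] := eqVneq (u 0 i) a; last exact: Coff.
have [hV1 hV2] := hV.
have hDC k : Ck_on O k (fun w => 'D_(e_ i) h w) by have [_ /(_ i)[]] := hC k.+1.
have hD w : O w -> is_derive w (e_ i) h ('D_(e_ i) h w).
  by move=> Ow; apply: derivableP; exact: (((hC 1%N).2 i).1 w Ow).
have C := IH _ hDC hV2 _ Ou.
apply/continuous_cubeP => e e0.
move: C => /cvgrPdist_lt/(_ _ e0)/nbhs_cubeP[d1 d10 H1].
have /nbhs_cubeP[d2 d20 H2] : nbhs u O by apply: open_nbhs_nbhs; split => //; exact: open_cube.
exists (Num.min d1 d2); first by rewrite lt_min d10.
have key x y : `|x - y| < e -> `|x / m.+1%:R - y / m.+1%:R| < e.
  move=> xy; rewrite -mulrBl normrM; apply: le_lt_trans xy.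
  by rewrite ler_piMr// normfV normr_nat invf_le1 ?ltr0n// ler1n.
move=> v Hv; have Hv1 : cube u d1 v by apply: cube_le Hv; rewrite ge_min lexx.
have Hv2 : cube u d2 v by apply: cube_le Hv; rewrite ge_min lexx orbT.
have [va|va] := eqVneq (v 0 i) a.
  by rewrite (divpowE0 _ _ ua) (divpowE0 _ _ va); apply: key; exact: H1.
(* As [u] lies on the hyperplane, moving [v] towards the hyperplane along [e_i] does not leave a
   cube about [u]. *)
have cubev d' t : cube u d' v -> 0 <= t <= 1 -> cube u d' (((t - 1) * (v 0 i - a)) *: e_ i + v).
  move=> Hd /andP[t0 t1] j; rewrite !mxE eqxx /=; have [->|ji] := eqVneq j i; last first.
    by rewrite mulr0 add0r; exact: Hd.
  rewrite mulr1 ua; have -> : (t - 1) * (v 0 i - a) + v 0 i - a = t * (v 0 i - a) by ring.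
  rewrite normrM ger0_norm//; have := Hd i; rewrite ua; apply: le_lt_trans.
  by rewrite ler_piMl.
have inO (t : R) : 0 <= t <= 1 -> O (((t - 1) * (v 0 i - a)) *: e_ i + v).
  by move=> t01; apply/H2/cubev.
have [t /andP[t0 t1] E] := Rolle_quotient m va inO hD hV1.
rewrite (divpowE0 _ _ ua) (divpowE _ _ va) E; apply: key.
set w := _ + v; have wa : w 0 i - a = t * (v 0 i - a).
  by rewrite !mxE !eqxx mulr1; ring.
have w0 : w 0 i != a by rewrite -(subr_eq0 _ a) wa mulf_neq0 ?(gt_eqF t0)// subr_eq0.
have -> : 'D_(e_ i) h w / (t * (v 0 i - a)) ^+ m = divpow i a m (fun w => 'D_(e_ i) h w) w.
  by rewrite divpowE// wa.
apply: H1; apply: cubev => //.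
by rewrite !ltW.
Qed.

(** Off the hyperplane this is the quotient rule. The right-hand side is again of the form [divpow],
    hence continuous, and [removable_derive] carries the formula across. *)
Lemma is_derive_divpow c d i j m h : 0 < d -> (forall k, Ck_on (cube c d) k h) ->
  vanishes (cube c d) i (c 0 i) m h ->
  forall u, cube c d u -> is_derive u (e_ j) (divpow i (c 0 i) m h)
   (if j == i then divpow i (c 0 i) m.+1 (fun w => (w 0 i - c 0 i) * 'D_(e_ i) h w - m%:R * h w) u
    else divpow i (c 0 i) m (fun w => 'D_(e_ j) h w) u).
Proof.
move=> d0; set a := c 0 i; set O := cube c d => hC hV.
have oO : open O by exact: open_cube.
have hDC l k : Ck_on O k (fun w => 'D_(e_ l) h w) by have [_ /(_ l)[]] := hC k.+1.
have D1 u : is_derive u (e_ j) (fun w : 'rV[R]_n => w 0 i - a) (i == j)%:R.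
  have := is_deriveB (is_derive_coord i j u) (is_derive_cst a u (e_ j)).
  by rewrite subr0.
apply: (removable_derive (i := i) (a := a) oO).
- exact: (continuous_divpow d0 hC hV).
- move=> u Ou; case: eqVneq => ij.
    apply: (continuous_divpow d0) => //; last exact: vanishes_S.
    move=> k; apply: Ck_onD => //; last first.
      have := Ck_onM oO (Ck_on_cst O k (- m%:R)) (hC k).
      by apply: Ck_on_eq => // w _; rewrite mulfctE mulNr.
    by apply: Ck_onM => //; apply: Ck_onD => //; [exact: Ck_on_coord|exact: Ck_on_cst].
  apply: (continuous_divpow d0) => //; apply: vanishes_derive => //.
  by rewrite eq_sym.
move=> u Ou ua.
have ua0 : (u 0 i - a) ^+ m != 0 by rewrite expf_neq0// subr_eq0.
have D2 := derivableP (((hC 1%N).2 j).1 u Ou).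
have P0 : ((fun w : 'rV[R]_n => w 0 i - a) ^+ m) u != 0 by rewrite exprfE.
have D3 := is_deriveX m (D1 u).
have D4 : is_derive u (e_ j) (fun w => (((fun w : 'rV[R]_n => w 0 i - a) ^+ m) w)^-1)
   (- ((u 0 i - a) ^+ m) ^- 2 * (m%:R * (u 0 i - a) ^+ m.-1 * (i == j)%:R)).
  split; first exact: derivableV P0 (@ex_derive _ _ _ _ _ _ _ D3).
  by rewrite (deriveV P0 (@ex_derive _ _ _ _ _ _ _ D3)) (@derive_val _ _ _ _ _ _ _ D3) exprfE.
have D5 := is_deriveM D2 D4.
have : is_derive u (e_ j) (divpow i a m h) (h u *: (- ((u 0 i - a) ^+ m) ^- 2 *
     (m%:R * (u 0 i - a) ^+ m.-1 * (i == j)%:R))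
   + (((fun w : 'rV[R]_n => w 0 i - a) ^+ m) u)^-1 *: 'D_(e_ j) h u).
  apply: near_eq_is_derive D5.
  have : nbhs u [set w : 'rV[R]_n | w 0 i != a].
    apply: open_nbhs_nbhs; split => //.
    by apply: (@open_comp _ _ (fun v : 'rV[R]_n => v 0 i) [set x | x != a]);
      [move=> v _; exact: coord_continuous | exact: open_neq].
  by apply: filterS => w wa; rewrite mulfctE divpowE// exprfE.
move=> /is_derive_eq; apply; rewrite exprfE eq_sym; case: eqVneq => ij.
  rewrite divpowE// ij; move: ('D_(e_ i) h u) (h u) ua0 ua => x y; rewrite /GRing.scale /= -(subr_eq0 _ a).
  move: (u 0 i - a) => z; clear; case: m => [|m] zm z0.
    by rewrite expr0 expr1; field.
  rewrite /= !exprS; have z1 : z ^+ m != 0 by rewrite expf_neq0.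
  by move: (z ^+ m) (m.+1%:R : R) z1 => t k t0; field; rewrite z0 t0.
by rewrite divpowE// !mulr0 scaler0 add0r /GRing.scale /= mulrC.
Qed.

(** The exponent [m] is general because each [i]-derivative raises it by one; division by a
    coordinate is the case [m = 1]. *)
Lemma Ck_on_divpow c d i m k h : 0 < d -> (forall k, Ck_on (cube c d) k h) ->
  vanishes (cube c d) i (c 0 i) m h -> Ck_on (cube c d) k (divpow i (c 0 i) m h).
Proof.
move=> d0; set a := c 0 i; set O := cube c d.
have oO : open O by exact: open_cube.
elim: k m h => [|k IH] m h hC hV.
  by split=> // u Ou; exact: (continuous_divpow d0 hC hV).
split=> [u Ou|j]; first exact: (continuous_divpow d0 hC hV).
have D := is_derive_divpow j d0 hC hV.
have hDC l k' : Ck_on O k' (fun w => 'D_(e_ l) h w) by have [_ /(_ l)[]] := hC k'.+1.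
split=> [u Ou|]; first exact: (@ex_derive _ _ _ _ _ _ _ (D u Ou)).
have [ij|ij] := eqVneq j i.
  have H : Ck_on O k (divpow i a m.+1 (fun w => (w 0 i - a) * 'D_(e_ i) h w - m%:R * h w)).
    apply: IH; last exact: vanishes_S.
    move=> k'; apply: Ck_onD => //; last first.
      have := Ck_onM oO (Ck_on_cst O k' (- m%:R)) (hC k').
      by apply: Ck_on_eq => // w _; rewrite mulfctE mulNr.
    by apply: Ck_onM => //; apply: Ck_onD => //; [exact: Ck_on_coord|exact: Ck_on_cst].
  apply: Ck_on_eq H => // u Ou.
  by rewrite (@derive_val _ _ _ _ _ _ _ (D u Ou)) ij eqxx.
have H : Ck_on O k (divpow i a m (fun w => 'D_(e_ j) h w)).
  by apply: IH => //; apply: vanishes_derive => //; rewrite eq_sym.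
apply: Ck_on_eq H => // u Ou.
by rewrite (@derive_val _ _ _ _ _ _ _ (D u Ou)) (negbTE ij).
Qed.

Lemma smooth_division c d h i : 0 < d -> smooth_on_open (cube c d) h ->
  exists2 g, smooth_on_open (cube c d) g &
    forall u, cube c d u -> h u - h (set_coord i (c 0 i) u) = (u 0 i - c 0 i) * g u.
Proof.
move=> d0 [oO hC]; pose h1 := h - (h \o set_coord i (c 0 i)).
have sub : cube c d `<=` set_coord i (c 0 i) @^-1` (cube c d).
  by move=> u Hu j; rewrite mxE; case: eqP => [->|_]; rewrite ?subrr ?normr0//; exact: Hu.
have h1C k : Ck_on (cube c d) k h1.
  apply: Ck_onD => //.
  have H := Ck_on_sub sub (Ck_on_subst (coordinate_map_set_coord i (c 0 i)) (hC k)).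
  by apply: (Ck_on_eq oO) (Ck_onM oO (Ck_on_cst _ k (-1)) H) => u _; rewrite mulfctE mulN1r.
have h1V : vanishes (cube c d) i (c 0 i) 1 h1.
  split=> // u Hu ui; have -> : h1 u = h u - h (set_coord i (c 0 i) u) by [].
  rewrite (_ : set_coord _ _ u = u) ?subrr//.
  by apply/rowP => j; rewrite mxE; case: eqP => // ->.
exists (divpow i (c 0 i) 1 h1); first by split=> // k; exact: Ck_on_divpow.
move=> u Hu; have [uc|uc] := eqVneq (u 0 i) (c 0 i).
  by rewrite uc subrr mul0r; exact: (h1V.1 u Hu uc).
by rewrite divpowE// expr1 mulrC divfK ?subr_eq0.
Qed.

Lemma Hadamard c d h : 0 < d -> smooth_on_open (cube c d) h ->
  exists2 g : 'I_n -> 'rV[R]_n -> R, (forall i, smooth_on_open (cube c d) (g i)) &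
    forall u, cube c d u -> h u - h c = \sum_i (u 0 i - c 0 i) * g i u.
Proof.
move=> d0 hC.
(* The difference [h u - h c] telescopes over the points [Z k u], which lead from [u] to [c] by
   freezing one coordinate at a time. *)
pose Z k u : 'rV[R]_n := \row_j (if (j < k)%N then c 0 j else u 0 j).
have Zsub k : cube c d `<=` Z k @^-1` (cube c d).
  by move=> u Hu j; rewrite mxE; case: ifP => _; rewrite ?subrr ?normr0//; exact: Hu.
have ZS (i : 'I_n) u : Z i.+1 u = Z i (set_coord i (c 0 i) u).
  by apply/rowP => j; rewrite !mxE ltnS -val_eqE /=; case: ltngtP => //= /val_inj ->.
have ZC k : (k <= n)%N -> smooth_on_open (cube c d) (h \o Z k).
  elim: k => [_|k IH kn].
    rewrite (_ : h \o Z 0%N = h)//; apply/funext => u /=; congr h.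
    by apply/rowP => j; rewrite mxE.
  split=> [|l]; first exact: open_cube.
  rewrite (_ : h \o Z k.+1 = (h \o Z k) \o set_coord (Ordinal kn) (c 0 (Ordinal kn))); last first.
    by apply/funext => u /=; rewrite -(ZS (Ordinal kn)).
  have sub : cube c d `<=` set_coord (Ordinal kn) (c 0 (Ordinal kn)) @^-1` (cube c d).
    by move=> u Hu j; rewrite mxE; case: eqP => [->|_]; rewrite ?subrr ?normr0//; exact: Hu.
  exact: Ck_on_sub sub (Ck_on_subst (coordinate_map_set_coord _ _) ((IH (ltnW kn)).2 l)).
have H (i : 'I_n) : exists g, smooth_on_open (cube c d) g /\
    forall u, cube c d u -> h (Z i u) - h (Z i.+1 u) = (u 0 i - c 0 i) * g u.
  have [g gC gE] := smooth_division i d0 (ZC i (ltnW (ltn_ord i))).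
  by exists g; split => // u Hu; rewrite ZS -gE.
have [g gP] := choice H; exists g => [i|u Hu]; first by have [] := gP i.
have T k : (k <= n)%N -> h u - h (Z k u) = \sum_(i < n | (i < k)%N) (u 0 i - c 0 i) * g i u.
  elim: k => [_|k IH kn].
    rewrite big_pred0// (_ : Z 0%N u = u) ?subrr//.
    by apply/rowP => j; rewrite mxE.
  rewrite (bigD1 (Ordinal kn))//= -(gP (Ordinal kn)).2//=.
  rewrite (eq_bigl (fun i : 'I_n => (i < k)%N)); last first.
    by move=> i; rewrite ltnS -val_eqE /= andbC -ltn_neqAle.
  by rewrite -IH ?(ltnW kn)// [RHS]addrC subrKA.
have := T n (leqnn n); rewrite (eq_bigl xpredT) => [<-|i]; last by rewrite ltn_ord.
by congr (_ - h _); apply/rowP => j; rewrite mxE ltn_ord.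
Qed.

End Division.

(** * Charts, bump functions and partial derivatives *)

Section Chart.
Context {R : realType} {M : manifold_with_corners R}.
Implicit Types (p q : M) (f g : M -> R) (A U : set M).
Local Notation n := (mdim M).
Local Notation e_ i := (delta_mx 0 i : 'rV[R]_n).

(** The content of [adapted] with domain and radius exposed and the centre dropped, so that one
    chart serves all points of [U]. *)
Definition chart r (phi : M -> 'rV[R]_n) U (eps : R) : Prop :=
  [/\ (r <= n)%N /\ open U, 0 < eps,
      phi @` U = box r eps /\
      (forall q q', U q -> U q' -> phi q = phi q' -> q = q'),
      (forall q A, U q ->
        (nbhs q A <->
         exists2 O, nbhs (phi q) O & forall q', U q' -> O (phi q') -> A q'))
    & forall q f, U q ->
        ((exists2 g, Cinfty M g & \forall q' \near q, f q' = g q') <->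
         (exists O h, [/\ smooth_on_open O h, O (phi q)
                        & \forall q' \near q, f q' = h (phi q')]))].

Lemma coordinates_chart p r phi : coordinates p r phi ->
  phi p = 0 /\ exists U eps, chart r phi U eps /\ U p.
Proof.
move=> [rn [p0 [U [eps [[oU Up] e0 im nb sm]]]]]; split=> //.
by exists U, eps; split.
Qed.

Definition smooth_at p f := exists2 g, Cinfty M g & \forall q \near p, f q = g q.

Lemma smooth_atP f : Cinfty M f <-> forall p, smooth_at p f.
Proof.
split=> [Cf p|H]; last by apply: mwc_local => p; exact: H.
by exists f => //; near=> q.
Unshelve. all: by end_near. Qed.

Lemma smooth_at_near p f g : (\forall q \near p, f q = g q) -> smooth_at p f -> smooth_at p g.
Proof.
move=> fg [h Ch fh]; exists h => //; near=> q; transitivity (f q).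
  by apply/esym; near: q.
by near: q.
Unshelve. all: by end_near. Qed.

End Chart.

Section InChart.
Context {R : realType} {M : manifold_with_corners R}.
Local Notation n := (mdim M).
Context (r : nat) (phi : M -> 'rV[R]_n) (U : set M) (eps : R).
Context (HU : chart r phi U eps).
Implicit Types (p q : M) (f g : M -> R) (A : set M).
Local Notation e_ i := (delta_mx 0 i : 'rV[R]_n).

Lemma chart_open : open U. Proof. by case: HU => -[]. Qed.
Lemma chart_eps : 0 < eps. Proof. by case: HU. Qed.
Lemma chart_rank : (r <= n)%N. Proof. by case: HU => -[]. Qed.

Lemma chart_near q : U q -> \forall q' \near q, U q'.
Proof. by move=> Uq; apply: open_nbhs_nbhs; split => //; exact: chart_open. Qed.

Lemma chart_box q : U q -> box r eps (phi q).
Proof. by case: HU => _ _ [<- _] _ _ Uq; exists q. Qed.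

Lemma chart_inj q q' : U q -> U q' -> phi q = phi q' -> q = q'.
Proof. by case: HU => _ _ [_ H] _ _; exact: H. Qed.

Lemma chart_ge0 q (i : 'I_n) : U q -> (i < r)%N -> 0 <= phi q 0 i.
Proof. by move=> /chart_box/(_ i)[_ H] /H. Qed.

Lemma chart_nbhs q A : U q ->
  nbhs q A <-> exists2 O, nbhs (phi q) O & forall q', U q' -> O (phi q') -> A q'.
Proof. by case: HU => _ _ _ + _; apply. Qed.

Lemma chart_near_preim q O : U q -> nbhs (phi q) O -> \forall q' \near q, O (phi q').
Proof. by move=> Uq HO; apply/(chart_nbhs _ Uq); exists O. Qed.

Lemma chart_coord_continuous q (i : 'I_n) : U q -> {for q, continuous (fun q => phi q 0 i)}.
Proof.
move=> Uq A HA; apply: (chart_near_preim Uq (O := (fun u : 'rV[R]_n => u 0 i) @^-1` A)).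
exact: coord_continuous.
Qed.

Lemma chart_smooth q f : U q -> smooth_at q f <->
  exists O h, [/\ smooth_on_open O h, O (phi q) & \forall q' \near q, f q' = h (phi q')].
Proof. by case: HU => _ _ _ _; apply. Qed.

Definition psi (p0 : M) u : M := xget p0 [set q | U q /\ phi q = u].

Lemma psiP p0 u : box r eps u -> U (psi p0 u) /\ phi (psi p0 u) = u.
Proof.
case: HU => _ _ [<- _] _ _ [q Uq <-]; rewrite /psi.
by case: xgetP => [q' _ []//|/(_ q)[]].
Qed.

Lemma psiK p0 q : U q -> psi p0 (phi q) = q.
Proof.
move=> Uq; have [U' E] := psiP p0 (chart_box Uq).
exact: chart_inj.
Qed.

Lemma smooth_at_cst_in q (c : R) : U q -> smooth_at q (fun=> c).
Proof.
move=> Uq; apply/(chart_smooth _ Uq); exists setT, (fun=> c); split=> //; last by near=> q'.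
by split; [exact: openT | move=> k; exact: Ck_on_cst].
Unshelve. all: by end_near. Qed.

Lemma smooth_atD_in q f g : U q -> smooth_at q f -> smooth_at q g -> smooth_at q (f + g).
Proof.
move=> Uq /(chart_smooth _ Uq)[ O [h [[oO hC] Oq E]]] /(chart_smooth _ Uq)[ O' [h' [[oO' hC'] Oq' E']]].
apply/(chart_smooth _ Uq); exists (O `&` O'), (h + h'); split=> //.
  split=> [|k]; first exact: openI.
  apply: Ck_onD; first exact: openI.
    exact: Ck_on_sub (@subIsetl _ _ _) (hC k).
  exact: Ck_on_sub (@subIsetr _ _ _) (hC' k).
by near=> q'; congr (_ + _); near: q'.
Unshelve. all: by end_near. Qed.

Lemma smooth_atM_in q f g : U q -> smooth_at q f -> smooth_at q g -> smooth_at q (f * g).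
Proof.
move=> Uq /(chart_smooth _ Uq)[ O [h [[oO hC] Oq E]]] /(chart_smooth _ Uq)[ O' [h' [[oO' hC'] Oq' E']]].
apply/(chart_smooth _ Uq); exists (O `&` O'), (h * h'); split=> //.
  split=> [|k]; first exact: openI.
  apply: Ck_onM; first exact: openI.
    exact: Ck_on_sub (@subIsetl _ _ _) (hC k).
  exact: Ck_on_sub (@subIsetr _ _ _) (hC' k).
by near=> q'; congr (_ * _); near: q'.
Unshelve. all: by end_near. Qed.

Lemma smooth_at_cont_in q f : U q -> smooth_at q f -> {for q, continuous f}.
Proof.
move=> Uq /(chart_smooth _ Uq)[ O [h [[oO hC] Oq E]]] A HA.
have hc : {for phi q, continuous h} by exact: Ck_on_cont (hC 0%N) Oq.
have : nbhs (phi q) (h @^-1` A).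
  by apply: hc; rewrite /= -(nbhs_singleton E).
move=> /(chart_near_preim Uq) H.
have : nbhs q (f @^-1` A); last by [].
near=> q' => /=; have -> : f q' = h (phi q') by near: q'.
by near: q'.
Unshelve. all: by end_near. Qed.

Lemma smooth_atV_in q f : U q -> f q != 0 -> smooth_at q f ->
  smooth_at q (fun q => (f q)^-1).
Proof.
move=> Uq fq /(chart_smooth _ Uq)[ O [h [[oO hC] Oq E]]].
have hc : {for phi q, continuous h} by exact: Ck_on_cont (hC 0%N) Oq.
have hq : h (phi q) != 0 by rewrite -(nbhs_singleton E).
pose O' := interior (O `&` h @^-1` [set x | x != 0]).
have sub : O' `<=` O `&` h @^-1` [set x | x != 0] by exact: interior_subset.
apply/(chart_smooth _ Uq); exists O', (fun u => (h u)^-1); split=> //.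
- split=> [|k]; first exact: open_interior.
  apply: Ck_onV; first exact: open_interior.
    by move=> u /sub[].
  by apply: Ck_on_sub (hC k) => u /sub[].
- apply: filterI; first exact: open_nbhs_nbhs.
  by apply: hc; apply: open_nbhs_nbhs; split => //; exact: open_neq.
by near=> q'; congr (_^-1); near: q'.
Unshelve. all: by end_near. Qed.

Lemma smooth_at_coord q O h : U q -> smooth_on_open O h -> O (phi q) ->
  smooth_at q (fun q' => h (phi q')).
Proof.
by move=> Uq hC Oq; apply/(chart_smooth _ Uq); exists O, h; split => //; near=> q'.
Unshelve. all: by end_near. Qed.

Lemma smooth_at_phi q (i : 'I_n) : U q -> smooth_at q (fun q' => phi q' 0 i).
Proof.
move=> Uq; apply: (@smooth_at_coord _ setT (fun u => u 0 i)) => //.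
by split; [exact: openT | move=> k; exact: Ck_on_coord].
Qed.

Lemma psi_continuous p0 B : B `<=` box r eps -> {within B, continuous (psi p0)}.
Proof.
move=> sub; apply/subspace_continuousP => u Bu A HA.
have [Uu E] := psiP p0 (sub _ Bu).
have [ O HO OA] := (chart_nbhs A Uu).1 HA.
rewrite E in HO; rewrite /nbhs /= /within /=; near=> v => Bv.
have [Uv Ev] := psiP p0 (sub _ Bv).
by apply: OA => //; rewrite Ev; near: v.
Unshelve. all: by end_near. Qed.

Definition closed_box (d : R) : set 'rV[R]_n :=
  [set u | forall i : 'I_n, (if (i < r)%N then 0 else - d) <= u 0 i <= d].

Lemma closed_box_box d : 0 < d -> d < eps -> closed_box d `<=` box r eps.
Proof.
move=> d0 de u Hu i; have := Hu i; case: ifP => ir /andP[u1 u2]; split => //.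
  by rewrite ger0_norm//; exact: le_lt_trans de.
by apply: le_lt_trans de; rewrite ler_norml u1.
Qed.

Lemma compact_chart_box p0 d : 0 < d -> d < eps -> compact (psi p0 @` closed_box d).
Proof.
move=> d0 de; apply: continuous_compact.
  exact/psi_continuous/closed_box_box.
have := @rV_compact R n (fun i => `[(if (i < r)%N then 0 else - d), d]%classic).
rewrite (_ : [set v | _] = closed_box d); last first.
  by apply/seteqP; split => u Hu i; have := Hu i; rewrite /= in_itv.
by apply => i; exact: segment_compact.
Qed.

(** The set is closed in the whole of [M] and not only in [U]: it is the image of a compact box
    under [psi], and [M] is Hausdorff. This permits functions supported in it to be extended by
    zero. *)
Lemma closed_chart_cube p0 d : 0 < d -> d < eps ->
  closed [set q | U q /\ forall i, `|phi q 0 i| <= d].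
Proof.
move=> d0 de; have := compact_closed (@mwc_hausdorff _ M) (compact_chart_box (p0 := p0) d0 de).
congr closed; apply/seteqP; split => [q [u Hu <-]|q [Uq Hq]].
  have [Uu E] := psiP p0 (closed_box_box d0 de Hu); split=> // i.
  rewrite E ler_norml; have := Hu i; case: ifP => _ /andP[u1 u2]; rewrite u2 ?andbT//.
  by apply: le_trans u1; rewrite oppr_le0 ltW.
exists (phi q); last exact: psiK.
move=> i; have := Hq i; rewrite ler_norml => /andP[u1 ->]; rewrite andbT.
by case: ifP => // ir; exact: chart_ge0.
Qed.

End InChart.

Section SmoothAt.
Context {R : realType} {M : manifold_with_corners R}.
Local Notation n := (mdim M).
Implicit Types (p q : M) (f g : M -> R) (A : set M).

Lemma chart_exists p : exists r (phi : M -> 'rV[R]_n) U eps,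
  [/\ chart r phi U eps, U p & phi p = 0].
Proof.
have [r [phi H]] := mwc_coordinates p.
have [p0 [U [e [H' Up]]]] := coordinates_chart H.
by exists r, phi, U, e.
Qed.

Lemma smooth_at_cst p (c : R) : smooth_at p (fun=> c).
Proof. by have [r [phi [U [e [H Up _]]]]] := chart_exists p; exact: smooth_at_cst_in H _ _ Up. Qed.

Lemma smooth_atD p f g : smooth_at p f -> smooth_at p g -> smooth_at p (f + g).
Proof. by have [r [phi [U [e [H Up _]]]]] := chart_exists p; exact: smooth_atD_in H _ _ _ Up. Qed.

Lemma smooth_atM p f g : smooth_at p f -> smooth_at p g -> smooth_at p (f * g).
Proof. by have [r [phi [U [e [H Up _]]]]] := chart_exists p; exact: smooth_atM_in H _ _ _ Up. Qed.

Lemma smooth_atV p f : f p != 0 -> smooth_at p f -> smooth_at p (fun q => (f q)^-1).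
Proof. by have [r [phi [U [e [H Up _]]]]] := chart_exists p; exact: smooth_atV_in H _ _ Up. Qed.

Lemma smooth_at_continuous p f : smooth_at p f -> {for p, continuous f}.
Proof. by have [r [phi [U [e [H Up _]]]]] := chart_exists p; exact: smooth_at_cont_in H _ _ Up. Qed.

Lemma smooth_atW p f : Cinfty M f -> smooth_at p f.
Proof. by move=> Cf; exact: (smooth_atP f).1. Qed.

Lemma Cinfty_cst (c : R) : Cinfty M (fun=> c).
Proof. by apply/smooth_atP => p; exact: smooth_at_cst. Qed.

Lemma CinftyD f g : Cinfty M f -> Cinfty M g -> Cinfty M (f + g).
Proof. by move=> Cf Cg; apply/smooth_atP => p; apply: smooth_atD; exact: smooth_atW. Qed.

Lemma CinftyM f g : Cinfty M f -> Cinfty M g -> Cinfty M (f * g).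
Proof. by move=> Cf Cg; apply/smooth_atP => p; apply: smooth_atM; exact: smooth_atW. Qed.

Lemma CinftyZ (c : R) f : Cinfty M f -> Cinfty M (c *: f).
Proof. by move=> Cf; exact: CinftyM (Cinfty_cst c) Cf. Qed.

Lemma CinftyN f : Cinfty M f -> Cinfty M (- f).
Proof. by move=> /(CinftyZ (-1)); rewrite scaleN1r. Qed.

Lemma CinftyB f g : Cinfty M f -> Cinfty M g -> Cinfty M (f - g).
Proof. by move=> Cf /CinftyN; exact: CinftyD. Qed.

Lemma Cinfty_sum (I : Type) (s : seq I) (P : pred I) (F : I -> M -> R) :
  (forall i, P i -> Cinfty M (F i)) -> Cinfty M (\sum_(i <- s | P i) F i).
Proof.
by move=> H; apply: big_ind H; [exact: Cinfty_cst | move=> f g; exact: CinftyD].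
Qed.

Lemma Cinfty_prod (I : Type) (s : seq I) (P : pred I) (F : I -> M -> R) :
  (forall i, P i -> Cinfty M (F i)) -> Cinfty M (\prod_(i <- s | P i) F i).
Proof.
by move=> H; apply: big_ind H; [exact: Cinfty_cst | move=> f g; exact: CinftyM].
Qed.

Lemma Cinfty_continuous f : Cinfty M f -> continuous f.
Proof. by move=> Cf p; apply: smooth_at_continuous; exact: smooth_atW. Qed.

Lemma Cinfty_inv p f : Cinfty M f -> f p != 0 ->
  exists2 g, Cinfty M g & \forall q \near p, g q = (f q)^-1.
Proof.
move=> Cf fp; have [g Cg E] := smooth_atV fp (smooth_atW p Cf).
by exists g => //; apply: filterS E => q ->.
Qed.

End SmoothAt.

Section InChart.
Context {R : realType} {M : manifold_with_corners R}.
Local Notation n := (mdim M).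
Context (r : nat) (phi : M -> 'rV[R]_n) (U : set M) (eps : R).
Context (HU : chart r phi U eps).
Implicit Types (p q : M) (f g : M -> R) (A : set M).
Local Notation e_ i := (delta_mx 0 i : 'rV[R]_n).

Lemma sqr_ltE (x y : R) : 0 <= y -> (x ^+ 2 < y ^+ 2) = (`|x| < y).
Proof. by move=> y0; rewrite -(real_normK (num_real x)) ltr_pXn2r ?nnegrE. Qed.

Lemma sqr_leE (x y : R) : 0 <= y -> (x ^+ 2 <= y ^+ 2) = (`|x| <= y).
Proof. by move=> y0; rewrite -(real_normK (num_real x)) ler_pXn2r ?nnegrE. Qed.

Lemma chart_bump p A : U p -> phi p = 0 -> nbhs p A ->
  exists chi, [/\ Cinfty M chi, \forall q \near p, chi q = 1, forall q, 0 <= chi q <= 1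
    & forall q, ~ A q -> \forall q' \near q, chi q' = 0].
Proof.
move=> Up p0 HA.
have [ O HO OA] := (chart_nbhs HU A Up).1 HA.
have [d1 d10 H1] := (nbhs_cubeP _ _).1 HO; rewrite p0 in H1.
(* Halving makes the closed cube of radius [d] fit strictly inside both the chart and the given
   neighbourhood. *)
pose d := Num.min d1 eps / 2.
have e0 := chart_eps HU.
have d0 : 0 < d by rewrite divr_gt0// lt_min d10.
have d20 : 0 < d / 2 by rewrite divr_gt0.
have dd1 : d < d1.
  by rewrite ltr_pdivrMr// gt_min mulr_natr mulr2n ltrDl d10.
have de : d < eps.
  by rewrite ltr_pdivrMr// gt_min (mulr_natr eps) mulr2n ltrDl e0 orbT.
have Kc := closed_chart_cube HU p d0 de.
set K := [set q | _] in Kc.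
(* Here [a] is positive exactly where all [|u_i| < d], and [b] vanishes exactly where all
   [|u_i| <= d / 2]. Hence [a + b] never vanishes, and [a / (a + b)] is one on the small cube and
   zero off the large one. *)
pose a (u : 'rV[R]_n) := \prod_i flat 0 (d ^+ 2 - u 0 i ^+ 2).
pose b (u : 'rV[R]_n) := \sum_i flat 0 (u 0 i ^+ 2 - (d / 2) ^+ 2).
have a0 u : 0 <= a u by apply: prodr_ge0 => i _; exact: flat_ge0.
have b0 u : 0 <= b u by apply: sumr_ge0 => i _; exact: flat_ge0.
have ab u : 0 < a u + b u.
  have [H|/existsNP[i /negP]] := pselect (forall i, `|u 0 i| < d).
    apply: ltr_wpDr => //; apply: prodr_gt0 => i _; apply: flat_gt0.
    by rewrite subr_gt0 sqr_ltE// ltW.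
  rewrite -leNgt => di; apply: ltr_wpDl => //.
  rewrite /b (bigD1 i)//=; apply: ltr_wpDr; first by apply: sumr_ge0 => j _; exact: flat_ge0.
  apply: flat_gt0; rewrite subr_gt0 ltNge sqr_leE ?(ltW d20)// -ltNge.
  by apply: lt_le_trans di; rewrite ltr_pdivrMr// mulr_natr mulr2n ltrDl.
have sq k (i : 'I_n) : Ck_on setT k (fun u : 'rV[R]_n => u 0 i ^+ 2).
  apply: (Ck_on_eq openT _ (Ck_onM openT (Ck_on_coord setT k i) (Ck_on_coord setT k i))).
  by move=> u _; rewrite mulfctE expr2.
have aC k : Ck_on setT k a.
  rewrite (_ : a = \prod_(i < n) (fun u : 'rV[R]_n => flat 0 (d ^+ 2 - u 0 i ^+ 2))); last first.
    by apply/funext => u; rewrite fct_prodE.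
  apply: big_ind; first exact: Ck_on_cst.
    by move=> f g; apply: Ck_onM; exact: openT.
  move=> i _; apply: Ck_on_flat; first exact: openT.
  apply: (Ck_on_eq openT _ (Ck_onD openT (Ck_on_cst setT k (d ^+ 2))
    (Ck_onM openT (Ck_on_cst setT k (-1)) (sq k i)))).
  by move=> u _; rewrite -[LHS]/(_ + -1 * _) mulN1r.
have bC k : Ck_on setT k b.
  rewrite (_ : b = \sum_(i < n) (fun u : 'rV[R]_n => flat 0 (u 0 i ^+ 2 - (d / 2) ^+ 2))); last first.
    by apply/funext => u; rewrite fct_sumE.
  apply: big_ind; first exact: Ck_on_cst.
    by move=> f g; apply: Ck_onD; exact: openT.
  move=> i _; apply: Ck_on_flat; first exact: openT.
  exact: (Ck_onD openT (sq k i) (Ck_on_cst setT k (- (d / 2) ^+ 2))).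
pose h u := a u / (a u + b u).
have hC : smooth_on_open setT h.
  split=> [|k]; first exact: openT.
  apply: Ck_onM => //; first exact: openT.
  apply: (@Ck_onV _ _ _ _ (a + b)); first exact: openT.
    by move=> u _; rewrite gt_eqF//; exact: ab.
  by apply: Ck_onD => //; exact: openT.
have h01 u : 0 <= h u <= 1.
  by rewrite /h divr_ge0 ?(ltW (ab u))//= ler_pdivrMr// mul1r lerDl.
pose chi q := if `[< U q >] then h (phi q) else 0.
have chiU q : U q -> chi q = h (phi q) by move=> Uq; rewrite /chi asboolT.
have offK q : ~ K q -> chi q = 0.
  move=> nK; rewrite /chi; case: asboolP => // Uq.
  have /existsNP[i /negP] : ~ forall i, `|phi q 0 i| <= d by move=> H; exact: nK.
  rewrite -ltNge => di; rewrite /h /a (bigD1 i)//= flat_eq0 ?mul0r//.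
  by rewrite subr_le0 leNgt sqr_ltE ?(ltW d0)// -leNgt ltW.
have nearoffK q : ~ K q -> \forall q' \near q, chi q' = 0.
  move=> nK; have : nbhs q (~` K) by apply: open_nbhs_nbhs; split => //; exact: closed_openC.
  by apply: filterS => q' /offK.
exists chi; split.
- apply/smooth_atP => q; have [Uq|nU] := pselect (U q).
    apply: smooth_at_near (smooth_at_coord HU Uq hC I).
    by apply: filterS (chart_near HU Uq) => q' /chiU ->.
  have nK : ~ K q by move=> [].
  apply: smooth_at_near (smooth_at_cst q 0).
  by apply: filterS (nearoffK q nK) => q' ->.
- have : nbhs (phi p) (cube 0 (d / 2)).
    rewrite p0; apply/nbhs_cubeP; exists (d / 2) => //; exact: divr_gt0.
  move=> /(chart_near_preim HU Up) H; have H' := chart_near HU Up; near=> q.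
  have Uq : U q by near: q.
  have Hq : cube 0 (d / 2) (phi q) by near: q.
  rewrite chiU// /h; have b1 : b (phi q) = 0.
    rewrite /b big1// => i _; apply: flat_eq0; rewrite subr_le0 sqr_leE ?(ltW d20)//.
    by have := Hq i; rewrite mxE subr0 => /ltW.
  by have := ab (phi q); rewrite b1 addr0 => aq; rewrite divff// gt_eqF.
- by move=> q; rewrite /chi; case: asboolP => // _; rewrite lexx ler01.
- move=> q nA; apply: nearoffK => -[Uq Hq]; apply: nA; apply: OA => //.
  by apply: H1 => i; rewrite mxE subr0; exact: le_lt_trans (Hq i) dd1.
Unshelve. all: by end_near. Qed.

End InChart.

(** * Continuity of smooth maps and locality of point derivations *)

Section Bump.
Context {R : realType} {M : manifold_with_corners R}.
Implicit Types (p q : M) (f g : M -> R) (A : set M).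

Lemma bump p A : nbhs p A ->
  exists chi, [/\ Cinfty M chi, \forall q \near p, chi q = 1, forall q, 0 <= chi q <= 1
    & forall q, ~ A q -> \forall q' \near q, chi q' = 0].
Proof.
by have [r [phi [U [e [H Up p0]]]]] := chart_exists p; exact: chart_bump H _ _ Up p0.
Qed.

(** A smooth map is only known to pull back smooth functions. Applied to a bump function supported
    in the given neighbourhood of [F p], this already gives continuity. *)
Lemma smooth_map_continuous (N : manifold_with_corners R) (F : M -> N) :
  smooth_map F -> continuous F.
Proof.
move=> FC p A HA; have := HA => HA'.
have [r [phi [U [e [H Up p0]]]]] := chart_exists (F p).
have [chi [Cchi chi1 _ chi0]] := chart_bump H Up p0 HA.
have C := Cinfty_continuous (FC _ Cchi) (x := p).
have : nbhs p ((chi \o F) @^-1` [set x | x != 0]).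
  apply: C; apply: open_nbhs_nbhs; split; first exact: open_neq.
  by rewrite /= (nbhs_singleton chi1) oner_neq0.
apply: filterS => q /= /eqP Hq; apply: contrapT => nA; apply: Hq.
exact: (nbhs_singleton (chi0 _ nA)).
Qed.

Lemma pd_cst p v (c : R) : point_derivation (Cinfty M) p v -> v (fun=> c) = 0.
Proof.
move=> [vL vM].
have v0 : v (fun=> 0) = 0.
  have := vL 1 _ _ (Cinfty_cst 0) (Cinfty_cst 0).
  rewrite scale1r (_ : (fun=> 0) + (fun=> 0) = (fun=> 0)); last first.
    by apply/funext => q; rewrite -[LHS]/(0 + 0) addr0.
  by rewrite mul1r => /eqP; rewrite -subr_eq0 opprD addNKr oppr_eq0 => /eqP.
have v1 : v (fun=> 1) = 0.
  have := vM _ _ (Cinfty_cst 1) (Cinfty_cst 1).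
  rewrite (_ : (fun=> 1) * (fun=> 1) = (fun=> 1)); last first.
    by apply/funext => q; rewrite mulfctE mulr1.
  by rewrite mul1r => /eqP; rewrite -subr_eq0 opprD addNKr oppr_eq0 => /eqP.
have := vL c _ _ (Cinfty_cst 1) (Cinfty_cst 0).
rewrite v0 v1 mulr0 [X in _ = X]addr0 => <-; congr v; apply/funext => q.
by rewrite -[RHS]/(c * 1 + 0) mulr1 addr0.
Qed.

Lemma pdD p v f g : point_derivation (Cinfty M) p v -> Cinfty M f -> Cinfty M g ->
  v (f + g) = v f + v g.
Proof. by move=> [vL _] Cf Cg; rewrite -[f in LHS]scale1r vL// mul1r. Qed.

Lemma pdZ p v c f : point_derivation (Cinfty M) p v -> Cinfty M f -> v (c *: f) = c * v f.
Proof.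
move=> vp Cf; have [vL _] := vp.
by rewrite -[c *: f]addr0 vL ?(pd_cst _ vp) ?addr0//; exact: Cinfty_cst.
Qed.

Lemma pdB p v f g : point_derivation (Cinfty M) p v -> Cinfty M f -> Cinfty M g ->
  v (f - g) = v f - v g.
Proof.
move=> vp Cf Cg; rewrite (pdD vp)//; last exact: CinftyN.
by congr (_ + _); rewrite -scaleN1r (pdZ _ vp)// mulN1r.
Qed.

Lemma pd_sum p v (I : Type) (s : seq I) (F : I -> M -> R) :
  point_derivation (Cinfty M) p v -> (forall i, Cinfty M (F i)) ->
  v (\sum_(i <- s) F i) = \sum_(i <- s) v (F i).
Proof.
move=> vp CF; elim: s => [|i s IH]; first by rewrite !big_nil (pd_cst _ vp).
by rewrite !big_cons (pdD vp)// ?IH//; exact: Cinfty_sum.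
Qed.

(** With [chi] equal to one near [p] and zero where [f] and [g] differ, [chi * (f - g)] is
    identically zero; the product rule then gives [v (f - g) = 0]. *)
Lemma pd_near p v f g : point_derivation (Cinfty M) p v -> Cinfty M f -> Cinfty M g ->
  (\forall q \near p, f q = g q) -> v f = v g.
Proof.
move=> vp Cf Cg fg; have [chi [Cchi chi1 _ chi0]] := bump fg.
have [vL vM] := vp.
have Cfg := CinftyB Cf Cg.
have : v (chi * (f - g)) = v (fun=> 0).
  congr v; apply/funext => q; rewrite mulfctE -[(f - g) q]/(f q - g q).
  have [->|nfg] := pselect (f q = g q); first by rewrite subrr mulr0.
  by rewrite (nbhs_singleton (chi0 q nfg)) mul0r.
rewrite (pd_cst _ vp) vM// (nbhs_singleton chi1) mul1r -[(f - g) p]/(f p - g p).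
rewrite (nbhs_singleton fg) subrr mul0r addr0 (pdB vp)// => /eqP.
by rewrite subr_eq0 => /eqP.
Qed.

End Bump.

Section PartialDerivative.
Context {R : realType} {M : manifold_with_corners R}.
Local Notation n := (mdim M).
Context (r : nat) (phi : M -> 'rV[R]_n) (U : set M) (eps : R).
Context (HU : chart r phi U eps).
Implicit Types (p q : M) (f g : M -> R) (A : set M).
Local Notation e_ i := (delta_mx 0 i : 'rV[R]_n).

(* One-sided, so that it only involves the values of [f] on the model. *)
Definition partial (i : 'I_n) f q : R :=
  lim ((fun s : R => s^-1 *: (f (psi phi U q (s *: e_ i + phi q)) - f q)) @ 0^'+).

Lemma box_ray q (i : 'I_n) : U q -> \forall s \near (0 : R)^'+, box r eps (s *: e_ i + phi q).
Proof.
move=> Uq; have Hq := chart_box HU Uq.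
have d0 : 0 < eps - `|phi q 0 i| by rewrite subr_gt0; case: (Hq i).
near=> s; have s0 : 0 < s by near: s; exact: nbhs_right_gt.
have sd : s < eps - `|phi q 0 i| by near: s; exact: nbhs_right_lt.
move=> j; rewrite !mxE eqxx /=; have [->|ji] := eqVneq j i; last first.
  by rewrite mulr0 add0r; exact: Hq.
rewrite mulr1; split.
  by apply: le_lt_trans (ler_normD _ _) _; rewrite gtr0_norm// -ltrBrDr.
by move=> ir; rewrite addr_ge0 ?(ltW s0)//; case: (Hq i) => _; apply.
Unshelve. all: by end_near. Qed.

(** The ray in the direction [e_i] stays in the model, so the derivative of the extension [h] is
    seen by [f] alone and is the same for all extensions. *)
Lemma partialE q (i : 'I_n) f O h : U q -> smooth_on_open O h -> O (phi q) ->
  (\forall q' \near q, f q' = h (phi q')) -> partial i f q = 'D_(e_ i) h (phi q).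
Proof.
move=> Uq [oO hC] Oq fh.
have D := ((hC 1%N).2 i).1 _ Oq.
have [ O' HO' OE] := (chart_nbhs HU _ Uq).1 fh.
have L : (fun s : R => s^-1 *: (h (s *: e_ i + phi q) - h (phi q))) @ 0^'+ --> 'D_(e_ i) h (phi q).
  exact: cvg_dnbhs_at_right D.
apply: cvg_lim => //; apply: cvg_trans L; apply: near_eq_cvg.
have B := box_ray i Uq.
have B' : \forall s \near (0 : R)^'+, O' (s *: e_ i + phi q).
  by have A := line_near (e_ i) HO'; exact: cvg_at_right_filter A.
near=> s; have Bs : box r eps (s *: e_ i + phi q) by near: s.
have [Us Es] := psiP HU q Bs.
rewrite (OE _ Us) ?Es ?(nbhs_singleton fh)//.
by near: s.
Unshelve. all: by end_near. Qed.

Lemma smooth_rep q f : U q -> Cinfty M f -> exists O h,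
  [/\ smooth_on_open O h, O (phi q) & \forall q' \near q, f q' = h (phi q')].
Proof. by move=> Uq Cf; apply/(chart_smooth HU _ Uq); exact: smooth_atW. Qed.

Lemma partial_derivation q i : U q -> point_derivation (Cinfty M) q (fun f => partial i f q).
Proof.
move=> Uq; split=> [c f g Cf Cg|f g Cf Cg].
all: have [ O [h [[oO hC] Oq fh]]] := smooth_rep Uq Cf.
all: have [ O' [h' [[oO' hC'] Oq' gh]]] := smooth_rep Uq Cg.
all: have oI := openI oO oO'.
all: have SC k := Ck_on_sub (@subIsetl _ O O') (hC k).
all: have SC' k := Ck_on_sub (@subIsetr _ O O') (hC' k).
all: have D := ((hC 1%N).2 i).1 _ Oq.
all: have D' := ((hC' 1%N).2 i).1 _ Oq'.
all: rewrite (partialE i Uq (conj oO hC) Oq fh) (partialE i Uq (conj oO' hC') Oq' gh).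
- rewrite (@partialE _ _ _ (O `&` O') (c *: h + h'))//; last 2 first.
  + by split=> // k; apply: Ck_onD => //; exact: Ck_onM oI (Ck_on_cst _ k c) (SC k).
  + near=> q'; congr (c * _ + _); near: q' => //.
  by rewrite deriveD ?deriveZ//; exact: derivableZ.
- rewrite (@partialE _ _ _ (O `&` O') (h * h'))//; last 2 first.
  + by split=> // k; apply: Ck_onM.
  + near=> q'; congr (_ * _); near: q' => //.
  by rewrite deriveM// (nbhs_singleton fh) (nbhs_singleton gh).
Unshelve. all: by end_near. Qed.

Lemma smooth_at_partial q i f : U q -> Cinfty M f -> smooth_at q (partial i f).
Proof.
move=> Uq Cf; have [ O [h [[oO hC] Oq fh]]] := smooth_rep Uq Cf.
have hD : smooth_on_open O (fun u => 'D_(e_ i) h u).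
  by split=> // k; have [_ /(_ i)[]] := hC k.+1.
apply: smooth_at_near (smooth_at_coord HU Uq hD Oq).
have H1 := near_join fh; have H2 := chart_near HU Uq.
have H3 : \forall q' \near q, O (phi q').
  by apply: (chart_near_preim HU Uq); exact: open_nbhs_nbhs.
near=> q'; apply/esym; apply: partialE; [near: q'|split|near: q'|near: q'] => //.
Unshelve. all: by end_near. Qed.

Lemma coord_ext q (i : 'I_n) : U q -> exists2 z, Cinfty M z & \forall q' \near q, z q' = phi q' 0 i.
Proof.
move=> Uq; have [z Cz E] := smooth_at_phi HU i Uq; exists z => //.
by apply: filterS E => q' ->.
Qed.

Lemma partial_coord q i j z : U q -> (\forall q' \near q, z q' = phi q' 0 j) ->
  partial i z q = (j == i)%:R.
Proof.
move=> Uq zE; rewrite (@partialE _ _ _ setT (fun u : 'rV[R]_n => u 0 j))//.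
  exact: (@derive_val _ _ _ _ _ _ _ (is_derive_coord j i (phi q))).
by split=> [|k]; [exact: openT | exact: Ck_on_coord].
Qed.

(** Hadamard's lemma writes [f] near [q] as [f q] plus the sum of [(z i - z i q) * GG i], so every
    derivation sends [f] to the sum of [GG i q * v (z i)]. Taking the partial derivatives for [v]
    identifies the numbers [GG i q]. *)
Lemma derivation_partial q v f (z : 'I_n -> M -> R) : U q ->
  point_derivation (Cinfty M) q v -> Cinfty M f -> (forall i, Cinfty M (z i)) ->
  (forall i, \forall q' \near q, z i q' = phi q' 0 i) ->
  v f = \sum_i partial i f q * v (z i).
Proof.
move=> Uq vq Cf Cz zE.
have [ O [h [[oO hC] Oq fh]]] := smooth_rep Uq Cf.
have [d d0 dO] := (nbhs_cubeP _ _).1 (open_nbhs_nbhs (conj oO Oq)).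
have hd : smooth_on_open (cube (phi q) d) h.
  by split=> [|k]; [exact: open_cube | exact: Ck_on_sub dO (hC k)].
have [g gC gE] := Hadamard d0 hd.
have G i : exists G, Cinfty M G /\ \forall q' \near q, G q' = g i (phi q').
  have [G CG E] := smooth_at_coord HU Uq (gC i) (cube_center _ d0).
  by exists G; split => //; apply: filterS E => q' ->.
have [GG GP] := choice G.
pose F := (fun=> f q) + \sum_i ((z i - (fun=> z i q)) * GG i).
have CF i : Cinfty M ((z i - (fun=> z i q)) * GG i).
  by apply: CinftyM; [apply: CinftyB => //; exact: Cinfty_cst | case: (GP i)].
have fF : \forall q' \near q, f q' = F q'.
  have H1 : \forall q' \near q, forall i, GG i q' = g i (phi q').
    by apply: filter_forall => i; case: (GP i).
  have H2 : \forall q' \near q, forall i, z i q' = phi q' 0 i by exact: filter_forall.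
  have H3 : \forall q' \near q, cube (phi q) d (phi q').
    by apply: (chart_near_preim HU Uq); apply: open_nbhs_nbhs; split; [exact: open_cube|exact: cube_center].
  near=> q'.
  have -> : f q' = h (phi q') by near: q'.
  have E : h (phi q') - h (phi q) = \sum_i (phi q' 0 i - phi q 0 i) * g i (phi q').
    by apply: gE; near: q'.
  rewrite /F -[RHS]/(f q + (\sum_i ((z i - (fun=> z i q)) * GG i)) q') (nbhs_singleton fh).
  apply/eqP; rewrite addrC -subr_eq E fct_sumE; apply/eqP; apply: eq_bigr => i _.
  rewrite mulfctE -[X in _ = X * _]/(z i q' - z i q).
  have -> : z i q' = phi q' 0 i by move: (i); near: q'.
  by rewrite (nbhs_singleton (zE i)); congr (_ * _); apply/esym; move: (i); near: q'.
have key w : point_derivation (Cinfty M) q w -> w f = \sum_i GG i q * w (z i).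
  move=> wq; rewrite (pd_near wq Cf _ fF); last first.
    by apply: CinftyD; [exact: Cinfty_cst | exact: Cinfty_sum].
  rewrite /F (pdD wq) ?(pd_cst _ wq) ?add0r ?(pd_sum _ wq)//; last 2 first.
  - exact: Cinfty_cst.
  - exact: Cinfty_sum.
  apply: eq_bigr => i _; rewrite wq.2//; last 2 first.
  - by apply: CinftyB => //; exact: Cinfty_cst.
  - by case: (GP i).
  rewrite -[X in X * _ + _]/(z i q - z i q) subrr mul0r add0r (pdB wq)//; last exact: Cinfty_cst.
  by rewrite (pd_cst _ wq) subr0.
rewrite key//; apply: eq_bigr => i _; congr (_ * _).
rewrite (key _ (partial_derivation i Uq)) (bigD1 i)//= (partial_coord _ Uq (zE i)) eqxx mulr1.
by rewrite big1 ?addr0// => j ji; rewrite (partial_coord _ Uq (zE j)) (negbTE ji) mulr0.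
Unshelve. all: by end_near. Qed.

End PartialDerivative.

(** * Boundary hypersurfaces *)

Section Corners.
Context {R : realType} {M : manifold_with_corners R}.
Local Notation n := (mdim M).
Context (r : nat) (phi : M -> 'rV[R]_n) (U : set M) (eps : R).
Context (HU : chart r phi U eps).
Implicit Types (p q : M) (f g : M -> R) (A H : set M).
Local Notation e_ i := (delta_mx 0 i : 'rV[R]_n).
Local Notation codim1 := (codim1 n (Cinfty M)).

Lemma box_line q (i : 'I_n) : U q -> ~ ((i < r)%N /\ phi q 0 i = 0) ->
  \forall s \near (0 : R), box r eps (s *: e_ i + phi q).
Proof.
move=> Uq Hi; have Hq := chart_box HU Uq.
have : nbhs (phi q) [set u : 'rV[R]_n | `|u 0 i| < eps /\ ((i < r)%N -> 0 <= u 0 i)].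
  have H1 : nbhs (phi q) [set u : 'rV[R]_n | `|u 0 i| < eps].
    apply: open_nbhs_nbhs; split; last by case: (Hq i).
    apply: (@open_comp _ _ (fun v : 'rV[R]_n => `|v 0 i|) [set x | x < eps]); last exact: open_lt.
    move=> v _; apply: (@continuous_comp _ _ _ (fun v : 'rV[R]_n => v 0 i) (@Num.norm R R)).
      exact: coord_continuous.
    exact: norm_continuous.
  have [ir|ir] := boolP (i < r)%N; last by apply: filterS H1 => u; split.
  have : nbhs (phi q) [set u : 'rV[R]_n | 0 < u 0 i].
    apply: open_nbhs_nbhs; split.
      by apply: (@open_comp _ _ (fun v : 'rV[R]_n => v 0 i) [set x | 0 < x]);
        [move=> v _; exact: coord_continuous | exact: open_gt].
    rewrite /= lt_neqAle (chart_ge0 HU Uq ir) andbT eq_sym; apply/eqP => H; exact: Hi.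
  by move=> H2; near=> u; split; [near: u|move=> _; apply: ltW; near: u].
move=> /(line_near (e_ i)); apply: filterS => s Hs j.
have [->//|ji] := eqVneq j i.
by rewrite !mxE eqxx (negbTE ji) mulr0 add0r; exact: Hq.
Unshelve. all: by end_near. Qed.

(** Unless [i] is a boundary coordinate that vanishes at [q], the coordinate line stays in the model
    on both sides of [q], and [f] has an interior minimum on it. *)
Lemma nonneg_partial q f (i : 'I_n) : U q -> Cinfty M f -> (\forall q' \near q, 0 <= f q') -> f q = 0 ->
  ~ ((i < r)%N /\ phi q 0 i = 0) -> partial phi U i f q = 0.
Proof.
move=> Uq Cf f0 fq Hi.
have [ O [h [[oO hC] Oq fh]]] := smooth_rep HU Uq Cf.
rewrite (partialE HU i Uq (conj oO hC) Oq fh).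
have : \forall q' \near q, 0 <= h (phi q').
  by near=> q'; have <- : f q' = h (phi q') by [near: q']; near: q'.
move=> /(chart_nbhs HU _ Uq)[ O' HO' OE].
have H1 := box_line Uq Hi.
have H2 := line_near (e_ i) HO'.
have H3 := line_near (e_ i) (open_nbhs_nbhs (conj oO Oq)).
have : \forall s \near (0 : R), [/\ box r eps (s *: e_ i + phi q), O' (s *: e_ i + phi q) & O (s *: e_ i + phi q)].
  by near=> s; split; near: s.
move=> /nbhs_ballP[d /= d0 H].
have Hd s : s \in `]- d, d[ -> [/\ box r eps (s *: e_ i + phi q), O' (s *: e_ i + phi q) & O (s *: e_ i + phi q)].
  by rewrite in_itv/= -ltr_norml => sd; apply: H; rewrite -ball_normE /= sub0r normrN.
have D0 := derivableP (((hC 1%N).2 i).1 _ Oq).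
rewrite -[in LHS](add0r (phi q)) -[X in X + _](scale0r (e_ i)).
have [] := @derive1_at_min R (fun s : R => h (s *: e_ i + phi q)) (- d) d 0.
- by rewrite ltW// gtrN.
- move=> s /Hd[_ _ Os]; have D := derivableP (((hC 1%N).2 i).1 _ Os).
  exact: (@ex_derive _ _ _ _ _ _ _ ((derive_line _ _ _ _ _).1 D)).
- by rewrite in_itv /= oppr_lt0 d0.
- move=> s /Hd[Bs Os _]; rewrite scale0r add0r -(nbhs_singleton fh) fq.
  by have [Us Es] := psiP HU q Bs; rewrite -Es; apply: OE; rewrite ?Es.
move=> D E; have := (derive_line h (phi q) (e_ i) 0 0).2.
by move=> /(_ _) H4; apply: (@derive_val _ _ _ _ _ _ _ (H4 _)); split.
Unshelve. all: by end_near. Qed.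

Lemma coord_exts q : U q -> exists z : 'I_n -> M -> R, (forall i, Cinfty M (z i)) /\
  (forall i, \forall q' \near q, z i q' = phi q' 0 i).
Proof.
move=> Uq; have H i : exists z, Cinfty M z /\ \forall q' \near q, z q' = phi q' 0 i.
  by have [z Cz E] := coord_ext HU i Uq; exists z.
by have [z zP] := choice H; exists z; split => i; case: (zP i).
Qed.

Lemma nonneg_derivation q v f (z : 'I_n -> M -> R) : U q ->
  point_derivation (Cinfty M) q v -> Cinfty M f -> (forall i, Cinfty M (z i)) ->
  (forall i, \forall q' \near q, z i q' = phi q' 0 i) ->
  (\forall q' \near q, 0 <= f q') -> f q = 0 ->
  v f = \sum_(i < n | (i < r)%N && (phi q 0 i == 0)) partial phi U i f q * v (z i).
Proof.
move=> Uq vq Cf Cz zE f0 fq; rewrite (derivation_partial HU Uq vq Cf Cz zE).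
rewrite [RHS]big_mkcond /=; apply: eq_bigr => i _; case: ifP => // /negP Hi.
by rewrite nonneg_partial ?mul0r// => -[ir /eqP iq]; apply: Hi; rewrite ir.
Qed.

End Corners.

Section Faces.
Context {R : realType} {M : manifold_with_corners R}.
Local Notation n := (mdim M).
Context (r : nat) (phi : M -> 'rV[R]_n) (U : set M) (eps : R).
Context (HU : chart r phi U eps).
Implicit Types (p q : M) (f g : M -> R) (A H : set M).
Local Notation e_ i := (delta_mx 0 i : 'rV[R]_n).
Local Notation codim1 := (codim1 n (Cinfty M)).

(* Invariance of the codimension: at a point of codimension one the
   differentials of the non-negative functions vanishing there are all
   proportional. *)
Lemma codim1_zero q : U q -> codim1 q ->
  exists j : 'I_n, [/\ (j < r)%N, phi q 0 j = 0
    & forall i : 'I_n, (i < r)%N -> phi q 0 i = 0 -> i = j].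
Proof.
move=> Uq [phi' /coordinates_chart[q0 [U' [e' [HU' Uq']]]]].
have [z [Cz zE]] := coord_exts HU Uq.
have [z' [Cz' zE']] := coord_exts HU' Uq'.
have n0 : (0 < n)%N by exact: chart_rank HU'.
pose i0 := Ordinal n0.
have one (i : 'I_n) : (i < 1)%N && (phi' q 0 i == 0) = (i == i0).
  by rewrite q0 mxE eqxx andbT -val_eqE /= ltnS leqn0.
have key v f : point_derivation (Cinfty M) q v -> Cinfty M f ->
    (\forall q' \near q, 0 <= f q') -> f q = 0 ->
    v f = partial phi' U' i0 f q * v (z' i0).
  move=> vq Cf f0 fq; rewrite (nonneg_derivation HU' Uq' vq Cf Cz' zE' f0 fq).
  by rewrite (eq_bigl _ _ one) big_pred1_eq.
have zpos (i : 'I_n) : (i < r)%N -> \forall q' \near q, 0 <= z i q'.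
  move=> ir; have H1 := zE i; have H2 := chart_near HU Uq; near=> q'.
  have -> : z i q' = phi q' 0 i by near: q'.
  by apply: (chart_ge0 HU) => //; near: q'.
have zpos' : \forall q' \near q, 0 <= z' i0 q'.
  have H1 := zE' i0; have H2 := chart_near HU' Uq'; near=> q'.
  have -> : z' i0 q' = phi' q' 0 i0 by near: q'.
  by apply: (chart_ge0 HU') => //; near: q'.
have zq i : z i q = phi q 0 i by exact: (nbhs_singleton (zE i)).
have zq' : z' i0 q = 0 by rewrite (nbhs_singleton (zE' i0)) q0 mxE.
have pdz i j : partial phi U i (z j) q = (j == i)%:R.
  exact: (partial_coord HU i Uq (zE j)).
have PD i := partial_derivation HU i Uq.
have [[j /andP[jr /eqP j0]]|Hn] := pselect (exists j : 'I_n, (j < r)%N && (phi q 0 j == 0)).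
  (* A second vanishing boundary coordinate would make the differentials of [z i] and [z j] both
     multiples of one functional, although they are linearly independent. *)
  exists j; split=> // i ir i0'; apply: contrapT => /eqP ij.
  have zi0 : z i q = 0 by rewrite zq.
  have zj0 : z j q = 0 by rewrite zq.
  have E1 := key _ _ (PD i) (Cz i) (zpos _ ir) zi0.
  have E2 := key _ _ (PD i) (Cz j) (zpos _ jr) zj0.
  have E3 := key _ _ (PD j) (Cz j) (zpos _ jr) zj0.
  move: E1 E2 E3; rewrite !pdz !eqxx eq_sym (negbTE ij).
  move=> E1 /esym/eqP; rewrite mulf_eq0 => /orP[/eqP->|/eqP E0].
    by rewrite mul0r => /eqP; rewrite oner_eq0.
  by move: E1; rewrite E0 mulr0 => /eqP; rewrite oner_eq0.
(* If no boundary coordinate of [phi] vanished at [q], every non-negative function vanishing at [q]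
   would have zero differential; the boundary coordinate of [phi'] does not. *)
have := nonneg_derivation HU Uq (partial_derivation HU' i0 Uq') (Cz' i0) Cz zE zpos' zq'.
rewrite (partial_coord HU' i0 Uq' (zE' i0)) eqxx big_pred0.
  by move=> /eqP; rewrite oner_eq0.
by move=> i; apply/negP => Hi; apply: Hn; exists i.
Unshelve. all: by end_near. Qed.

Lemma chart_change (A B : 'rV[R]_n -> 'rV[R]_n) (V : set M) r' d :
  coordinate_map A -> coordinate_map B -> cancel A B -> cancel B A ->
  open V -> V `<=` U -> (r' <= n)%N -> 0 < d -> (A \o phi) @` V = box r' d ->
  chart r' (A \o phi) V d.
Proof.
move=> cA cB AB BA oV VU rn d0 im; split=> //.
- split=> // q q' Vq Vq' /= /(can_inj AB); exact: (chart_inj HU (VU _ Vq) (VU _ Vq')).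
- move=> q S Vq; split.
    move=> /(chart_nbhs HU S (VU _ Vq))[ O HO OS].
    exists (B @^-1` O); first by apply: cB.1; rewrite /= AB.
    by move=> q' Vq' /=; rewrite AB; apply: OS; exact: VU.
  move=> [ O HO OS]; have H1 : nbhs q V by exact: open_nbhs_nbhs.
  have : nbhs (phi q) (A @^-1` O) by exact: cA.1.
  move=> /(chart_near_preim HU (VU _ Vq)) H2.
  by near=> q'; apply: OS; near: q'.
- move=> q f Vq; apply: (iff_trans (chart_smooth HU f (VU _ Vq))); split.
    move=> [ O [h [[oO hC] Oq fh]]]; exists (B @^-1` O), (h \o B); split.
    + split; first by apply: open_comp => // u _; exact: cB.1.
      by move=> k; exact: Ck_on_subst.
    + by rewrite /= AB.
    + by near=> q'; rewrite /= AB; near: q'.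
  move=> [ O [h [[oO hC] Oq fh]]]; exists (A @^-1` O), (h \o A); split => //.
  split; first by apply: open_comp => // u _; exact: cA.1.
  by move=> k; exact: Ck_on_subst.
Unshelve. all: by end_near. Qed.

Definition open_face (j : 'I_n) : set M :=
  [set q | [/\ U q, phi q 0 j = 0 & forall i : 'I_n, (i < r)%N -> i != j -> 0 < phi q 0 i]].

Lemma open_face_near (j : 'I_n) (u : 'rV[R]_n) : (forall i : 'I_n, `|u 0 i| < eps) ->
  (forall i : 'I_n, (i < r)%N -> i != j -> 0 < u 0 i) ->
  exists2 d, 0 < d & forall v : 'rV[R]_n, cube u d v ->
    (forall i : 'I_n, `|v 0 i| < eps) /\ (forall i : 'I_n, (i < r)%N -> i != j -> 0 < v 0 i).
Proof.
move=> H1 H2; apply/nbhs_cubeP.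
have N1 : nbhs u [set v : 'rV[R]_n | forall i : 'I_n, `|v 0 i| < eps].
  apply: (@filter_forall _ _ _ (nbhs u) (nbhs_filter u)) => i; apply: open_nbhs_nbhs; split; last exact: H1.
  apply: (@open_comp _ _ (fun v : 'rV[R]_n => `|v 0 i|) [set x | x < eps]); last exact: open_lt.
  move=> v _; apply: (@continuous_comp _ _ _ (fun v : 'rV[R]_n => v 0 i) (@Num.norm R R)).
    exact: coord_continuous.
  exact: norm_continuous.
have N2 : nbhs u [set v : 'rV[R]_n | forall i : 'I_n, (i < r)%N -> i != j -> 0 < v 0 i].
  apply: (@filter_forall _ _ _ (nbhs u) (nbhs_filter u)) => i; have [ir|] := boolP (i < r)%N; last by move=> ir; near=> v.
  have [ij|ij] := eqVneq i j; first by near=> v.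
  have : nbhs u [set v : 'rV[R]_n | 0 < v 0 i].
    apply: open_nbhs_nbhs; split; last exact: H2.
    by apply: (@open_comp _ _ (fun v : 'rV[R]_n => v 0 i) [set x | 0 < x]);
      [move=> v _; exact: coord_continuous | exact: open_gt].
  exact: filterS.
by near=> v; split; near: v.
Unshelve. all: by end_near. Qed.

Lemma open_face_codim1 (j : 'I_n) : (j < r)%N -> open_face j `<=` codim1.
Proof.
move=> jr q [Uq qj qi].
have [d d0 Hd] := open_face_near (fun i => (chart_box HU Uq i).1) qi.
have n0 : (0 < n)%N by exact: leq_ltn_trans (ltn_ord j).
(* The definition of [codim1] asks for a centred chart whose only boundary coordinate has index
   zero: [A] translates [q] to the origin and exchanges the indices [0] and [j]. *)
pose i0 := Ordinal n0; pose s := tperm i0 j.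
pose A (u : 'rV[R]_n) : 'rV[R]_n := \row_k u 0 (s k) + (- \row_k (phi q) 0 (s k)).
pose B (u : 'rV[R]_n) : 'rV[R]_n := \row_k u 0 (s k) + phi q.
have AB : cancel A B by move=> u; apply/rowP => k; rewrite !mxE /s !tpermK subrK.
have BA : cancel B A by move=> u; apply/rowP => k; rewrite !mxE /s !tpermK addrK.
have cA : coordinate_map A by apply: coordinate_map_perm; exact: perm_inj.
have cB : coordinate_map B by apply: coordinate_map_perm; exact: perm_inj.
pose V := [set q' | U q' /\ cube (phi q) d (phi q')].
have oV : open V.
  rewrite openE => q' [Uq' Hq']; have N1 := chart_near HU Uq'.
  have N2 := chart_near_preim HU Uq' (open_nbhs_nbhs (conj (@open_cube _ _ _ _) Hq')).
  have : nbhs q' V; last by [].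
  by near=> x; split; near: x.
exists (A \o phi); have im : (A \o phi) @` V = box 1 d.
  apply/seteqP; split=> [_ [q' [Uq' Hq'] <-] i|u Hu].
    rewrite /= !mxE; split; first exact: Hq'.
    rewrite ltnS leqn0 => /eqP i00; have -> : i = i0 by exact: val_inj.
    by rewrite /s tpermL qj subr0; exact: (chart_ge0 HU Uq' jr).
  have Hc : cube (phi q) d (B u) by move=> i; rewrite !mxE addrK; case: (Hu (s i)).
  have HB : box r eps (B u).
    have [H1 H2] := Hd _ Hc; move=> i; split; first exact: H1.
    move=> ir; have [->|ij] := eqVneq i j; last exact/ltW/H2.
    by rewrite !mxE /s tpermR qj addr0; apply: (Hu i0).2.
  have [Ub Eb] := psiP HU q HB; exists (psi phi U q (B u)); last by rewrite /= Eb BA.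
  by split => //; rewrite Eb.
have [] := chart_change cA cB AB BA oV (fun q' => @proj1 _ _) _ d0 im.
  exact: leq_ltn_trans (leq0n _) n0.
move=> _ _ im' nb sm; split; first exact: leq_ltn_trans (leq0n _) n0.
split; first by apply/rowP => k; rewrite !mxE subrr.
exists V, d; split => //; split => //; split => //; exact: cube_center.
Unshelve. all: by end_near. Qed.

Lemma face_convex (j : 'I_n) q q' (t : R) : open_face j q -> open_face j q' -> 0 <= t <= 1 ->
  box r eps ((1 - t) *: phi q + t *: phi q') /\ open_face j (psi phi U q ((1 - t) *: phi q + t *: phi q')).
Proof.
move=> [Uq qj qi] [Uq' qj' qi'] /andP[t0 t1].
set u := (X in box r eps X /\ _).
have uE (i : 'I_n) : u 0 i = (1 - t) * phi q 0 i + t * phi q' 0 i by rewrite !mxE.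
have uj : u 0 j = 0 by rewrite uE qj qj' !mulr0 addr0.
have upos (i : 'I_n) : (i < r)%N -> i != j -> 0 < u 0 i.
  move=> ir ij; rewrite uE; have a0 := qi i ir ij; have b0 := qi' i ir ij.
  have [->|tn] := eqVneq t 0; first by rewrite subr0 mul1r mul0r addr0.
  by apply: ltr_wpDl; rewrite ?mulr_ge0 ?subr_ge0 ?(ltW a0)// mulr_gt0// lt_neqAle eq_sym tn.
have ub : box r eps u.
  move=> i; split; last first.
    by move=> ir; have [->|ij] := eqVneq i j; rewrite ?uj// ltW// upos.
  rewrite uE; apply: le_lt_trans (ler_normD _ _) _.
  rewrite !normrM (ger0_norm t0) ger0_norm ?subr_ge0//.
  have A := (chart_box HU Uq i).1; have B := (chart_box HU Uq' i).1.
  have [->|tn] := eqVneq t 0; first by rewrite subr0 mul1r mul0r addr0.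
  have -> : eps = (1 - t) * eps + t * eps by rewrite -mulrDl subrK mul1r.
  by rewrite ler_ltD ?ler_wpM2l ?subr_ge0// ?(ltW A)// ltr_pM2l// lt_neqAle eq_sym tn.
have [Uu Eu] := psiP HU q ub.
split=> //; split; rewrite ?Eu //.
Qed.

(** In coordinates the open face is convex, so the segment from [q] to [q'] is a connected set of
    points of codimension one. *)
Lemma face_component (j : 'I_n) q q' : (j < r)%N -> open_face j q -> open_face j q' ->
  connected_component codim1 q q'.
Proof.
move=> jr fq fq'.
pose ga (t : R) := (1 - t) *: phi q + t *: phi q'.
pose I := [set t : R | 0 <= t <= 1].
have IE : I = `[0, 1]%classic by apply/seteqP; split => t; rewrite /= in_itv.
have sub : ga @` I `<=` box r eps.
  by move=> _ [t It <-]; case: (face_convex fq fq' It).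
have cga : continuous ga.
  move=> t; apply: (@continuousD _ _ _ (fun t : R => (1 - t) *: phi q) (fun t => t *: phi q')).
    by apply: cvgZr_tmp; apply: cvgB; [exact: cvg_cst|exact: cvg_id].
  by apply: cvgZr_tmp; exact: cvg_id.
have cI : connected I by rewrite IE; exact: segment_connected.
have c1 : connected (ga @` I).
  by apply: connected_continuous_connected => //; exact: continuous_subspaceT.
have c2 : connected (psi phi U q @` (ga @` I)).
  by apply: connected_continuous_connected => //; exact: (psi_continuous HU).
have I0 : I 0 by rewrite /I /= lexx ler01.
have I1 : I 1 by rewrite /I /= lexx ler01.
exists (psi phi U q @` (ga @` I)); last first.
  exists (ga 1); first by exists 1.
  by rewrite /ga subrr scale0r add0r scale1r (psiK HU)//; case: fq'.
split=> //.
- exists (ga 0); first by exists 0.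
  by rewrite /ga subr0 scale0r addr0 scale1r (psiK HU)//; case: fq.
- move=> _ [_ [t It <-] <-]; apply: (open_face_codim1 jr).
  by case: (face_convex fq fq' It).
Qed.

Definition face_point (p0 : M) (j : 'I_n) : M :=
  psi phi U p0 (\row_i (if (i < r)%N && (i != j) then eps / 2 else 0)).

Lemma face_pointP p0 j : open_face j (face_point p0 j).
Proof.
have e0 := chart_eps HU.
have [|Uq E] := psiP HU p0 (u := \row_i (if (i < r)%N && (i != j) then eps / 2 else 0)).
  move=> i; rewrite mxE; case: ifP => _.
    split=> [|_]; last by rewrite divr_ge0// ltW.
    by rewrite gtr0_norm ?divr_gt0// ltr_pdivrMr// mulr_natr mulr2n ltrDl.
  by split; rewrite ?normr0.
split=> //; rewrite E.
  by rewrite mxE eqxx andbF.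
by move=> i ir ij; rewrite mxE ir ij divr_gt0.
Qed.

Definition face_hyp (p0 : M) (j : 'I_n) : set M :=
  closure (connected_component codim1 (face_point p0 j)).

Lemma face_hyp_bhs p0 (j : 'I_n) : (j < r)%N -> bhs (face_hyp p0 j).
Proof.
move=> jr; exists (face_point p0 j) => //.
by apply: (open_face_codim1 jr); exact: face_pointP.
Qed.

(** Increasing all other boundary coordinates slightly moves [q] into the open face, so [q] is in
    its closure. The converse, [face_hypE], has to wait for the defining functions. *)
Lemma face_hyp_coord p0 (j : 'I_n) q : (j < r)%N -> U q -> phi q 0 j = 0 -> face_hyp p0 j q.
Proof.
move=> jr Uq qj A HA.
have [ O HO OA] := (chart_nbhs HU A Uq).1 HA.
pose v : 'rV[R]_n := \row_i (if (i < r)%N && (i != j) then 1 else 0).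
have H1 := line_near v HO.
have d0 (i : 'I_n) : 0 < eps - `|phi q 0 i| by rewrite subr_gt0; case: (chart_box HU Uq i).
have : \forall s \near (0 : R)^'+, [/\ 0 < s, O (s *: v + phi q) & forall i, s < eps - `|phi q 0 i|].
  have H2 : \forall s \near (0 : R)^'+, O (s *: v + phi q) by exact: cvg_at_right_filter H1.
  have H3 : \forall s \near (0 : R)^'+, forall i, s < eps - `|phi q 0 i|.
    by apply: filter_forall => i; exact: nbhs_right_lt.
  by near=> s; split; near: s => //; exact: nbhs_right_gt.
move=> /filter_ex[s [s0 Os sd]].
have pos (i : 'I_n) : (i < r)%N -> i != j -> 0 < (s *: v + phi q) 0 i.
  by move=> ir ij; rewrite !mxE ir ij mulr1 ltr_pwDl// (chart_ge0 HU Uq).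
have bj : (s *: v + phi q) 0 j = 0 by rewrite !mxE eqxx andbF mulr0 add0r.
have B : box r eps (s *: v + phi q).
  move=> i; split.
    rewrite !mxE; apply: le_lt_trans (ler_normD _ _) _; case: ifP => _.
      by rewrite mulr1 gtr0_norm// -ltrBrDr.
    by rewrite mulr0 normr0 add0r; case: (chart_box HU Uq i).
  by move=> ir; have [->|ij] := eqVneq i j; rewrite ?bj// ltW// pos.
have [Us Es] := psiP HU q B.
exists (psi phi U q (s *: v + phi q)); split; last by apply: OA; rewrite ?Es.
have fq : open_face j (psi phi U q (s *: v + phi q)) by split; rewrite ?Es.
exact: (face_component jr (face_pointP p0 j) fq).
Unshelve. all: by end_near. Qed.

(** Near [q] there is a point [q'] of codimension one in the component defining [H], and exactly one
    boundary coordinate vanishes at it. If [q'] is close enough, coordinates positive at [q] stay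
    positive, so this coordinate also vanishes at [q]. *)
Lemma bhs_face_hyp p0 H q : bhs H -> H q -> U q ->
  exists2 j : 'I_n, (j < r)%N /\ phi q 0 j = 0 & H = face_hyp p0 j.
Proof.
move=> [q0 cq0 HE] Hq Uq.
have N1 : \forall q' \near q, forall i : 'I_n, (i < r)%N -> 0 < phi q 0 i -> 0 < phi q' 0 i.
  apply: filter_forall => i; have [qi|] := pselect (0 < phi q 0 i); last by move=> qi; near=> q'.
  have : \forall q' \near q, 0 < phi q' 0 i.
    have C := @chart_coord_continuous _ _ _ _ _ _ HU q i Uq.
    apply: (C [set x | 0 < x]).
    by apply: open_nbhs_nbhs; split => //; exact: open_gt.
  by apply: filterS.
have N2 := chart_near HU Uq.
have [q' [cq' [Uq' Hq']]] : connected_component codim1 q0 `&` [set q' | U q' /\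
    forall i : 'I_n, (i < r)%N -> 0 < phi q 0 i -> 0 < phi q' 0 i] !=set0.
  move: Hq; rewrite HE => /(_ [set q' | U q' /\
    forall i : 'I_n, (i < r)%N -> 0 < phi q 0 i -> 0 < phi q' 0 i]); apply.
  by near=> q'; split; near: q'.
have c1 : codim1 q' by exact: (connected_component_sub cq').
have [j [jr qj' ju]] := codim1_zero Uq' c1.
exists j.
  split=> //; apply/eqP; rewrite eq_le (chart_ge0 HU Uq jr) andbT leNgt.
  by apply/negP => /(Hq' j jr); rewrite qj' ltxx.
rewrite HE /face_hyp; congr closure.
have fq' : open_face j q'.
  split=> // i ir ij; rewrite lt_neqAle (chart_ge0 HU Uq' ir) andbT eq_sym.
  by apply/eqP => /(ju _ ir) /eqP; rewrite (negbTE ij).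
rewrite (same_connected_component cq').
by apply/esym; apply: same_connected_component; apply: face_component (face_pointP _ _) fq'.
Unshelve. all: by end_near. Qed.

(** Embeddedness enters here: if two faces at [p] belonged to one hypersurface, its defining
    function [x] would vanish on both, which forces [dx = 0] at [p]. *)
Lemma face_hyp_disjoint p0 (i j : 'I_n) p : U p -> phi p = 0 -> (i < r)%N -> (j < r)%N ->
  face_hyp p0 i = face_hyp p0 j -> i = j.
Proof.
move=> Up pp0 ir jr ijE; apply: contrapT => /eqP ij.
have [x [Cx x0 xH dx]] := mwc_embedded (face_hyp_bhs p0 ir).
have pz (k : 'I_n) : phi p 0 k = 0 by rewrite pp0 mxE.
have Hp : face_hyp p0 i p by exact: face_hyp_coord.
have [v vp] := dx p Hp; apply/negP; rewrite negbK.
have xp : x p = 0 by apply/xH.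
have [z [Cz zE]] := coord_exts HU Up.
have xpos : \forall q \near p, 0 <= x q by near=> q.
rewrite (nonneg_derivation HU Up vp Cx Cz zE xpos xp) big1// => k /andP[kr _].
suff -> : partial phi U k x p = 0 by rewrite mul0r.
(* At least one of the two faces has an index [l] other than [k]; it contains the ray from [p] along
   [e_k], on which [x] is therefore zero. *)
have [l [lr lk lH]] : exists l : 'I_n, [/\ (l < r)%N, l != k & face_hyp p0 l = face_hyp p0 i].
  have [ki|ki] := eqVneq k i; first by exists j; rewrite ki eq_sym.
  by exists i; rewrite eq_sym.
have B := box_ray HU k Up.
rewrite /partial; apply: lim_near_cst => //; near=> s.
have Bs : box r eps (s *: e_ k + phi p) by near: s.
have [Us Es] := psiP HU p Bs.
have -> : x (psi phi U p (s *: e_ k + phi p)) = 0.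
  apply/xH; rewrite -lH; apply: face_hyp_coord => //.
  by rewrite Es !mxE (negbTE lk) andbF mulr0 add0r pz.
by rewrite xp subrr scaler0.
Unshelve. all: by end_near. Qed.

End Faces.

(** * Defining functions in terms of the chart coordinates *)

Section BoundaryDefining.
Context {R : realType} {M : manifold_with_corners R}.
Local Notation n := (mdim M).
Context (r : nat) (phi : M -> 'rV[R]_n) (U : set M) (eps : R).
Context (HU : chart r phi U eps).
Context (p : M).
Hypotheses (Up : U p) (phip : phi p = 0).
Implicit Types (q : M) (f g : M -> R) (A H : set M).
Local Notation e_ i := (delta_mx 0 i : 'rV[R]_n).

Let Hj (j : 'I_n) := face_hyp r phi U eps p j.

Lemma face_hypE (j : 'I_n) q : (j < r)%N -> U q -> Hj j q <-> phi q 0 j = 0.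
Proof.
move=> jr Uq; split; last exact: (face_hyp_coord HU).
move=> Hq; have [k [kr kq] E] := bhs_face_hyp HU p (face_hyp_bhs HU p jr) Hq Uq.
by rewrite (face_hyp_disjoint HU Up phip jr kr E).
Qed.

Lemma chart_division (j : 'I_n) q f : (j < r)%N -> U q -> phi q 0 j = 0 -> Cinfty M f ->
  (forall q', U q' -> phi q' 0 j = 0 -> f q' = 0) ->
  exists2 g, Cinfty M g & \forall q' \near q, f q' = g q' * phi q' 0 j.
Proof.
move=> jr Uq qj Cf f0.
have [ O [h [[oO hC] Oq fh]]] := smooth_rep HU Uq Cf.
have [ O' HO' OE] := (chart_nbhs HU _ Uq).1 fh.
have N1 := open_nbhs_nbhs (conj oO Oq).
have [d d0 dO] := (nbhs_cubeP _ _).1 (filterI N1 HO').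
have hd : smooth_on_open (cube (phi q) d) h.
  by split=> [|k]; [exact: open_cube | apply: Ck_on_sub (hC k) => u /dO[]].
have [g gC gE] := smooth_division j d0 hd.
have [G CG E] := smooth_at_coord HU Uq gC (cube_center _ d0).
exists G => //.
have N2 := chart_near HU Uq.
have N3 := chart_near_preim HU Uq (open_nbhs_nbhs (conj (@open_cube _ _ _ _) (cube_center (phi q) d0))).
near=> q'; have Uq' : U q' by near: q'.
have cq' : cube (phi q) d (phi q') by near: q'.
have -> : f q' = h (phi q') by near: q'.
have -> : G q' = g (phi q') by apply/esym; near: q'.
have := gE _ cq'; rewrite qj subr0 mulrC => <-.
have cz : cube (phi q) d (set_coord j 0 (phi q')).
  by move=> i; rewrite mxE; case: eqP => [->|_]; [rewrite qj subrr normr0 | exact: cq'].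
have bz : box r eps (set_coord j 0 (phi q')).
  move=> i; rewrite mxE; case: eqP => _; last exact: (chart_box HU Uq' i).
  by rewrite normr0; split => //; exact: chart_eps HU.
have [Uz Ez] := psiP HU q bz.
have := OE _ Uz; rewrite Ez => /(_ (dO _ cz).2) <-.
by rewrite f0 ?subr0// Ez mxE eqxx.
Unshelve. all: by end_near. Qed.

(** Division gives the factor [g]. Its value at [q] is non-zero because [dx <> 0], and non-negative
    because it is the one-sided derivative of [x >= 0] into the manifold. *)
Lemma bdf_coord (j : 'I_n) x q : (j < r)%N -> bdf (Hj j) x -> U q -> phi q 0 j = 0 ->
  exists2 g, Cinfty M g & 0 < g q /\ \forall q' \near q, x q' = g q' * phi q' 0 j.
Proof.
move=> jr [Cx x0 xH dx] Uq qj.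
have [|g Cg gE] := chart_division jr Uq qj Cx.
  by move=> q' Uq' q'j; apply/xH; apply/face_hypE.
exists g => //; split => //.
have [z [Cz zE]] := coord_exts HU Uq.
have xE : \forall q' \near q, x q' = (g * z j) q'.
  have zEj := zE j; near=> q'; rewrite mulfctE.
  have -> : z j q' = phi q' 0 j by near: q'.
  by near: q'.
have xq : x q = 0 by apply/xH; apply/face_hypE.
have zq : z j q = 0 by rewrite (nbhs_singleton (zE j)).
have E v : point_derivation (Cinfty M) q v -> v x = g q * v (z j).
  move=> vq; rewrite (pd_near vq Cx _ xE); last exact: CinftyM.
  by rewrite vq.2// zq mul0r addr0.
have gn0 : g q != 0.
  have [v vq] := dx q ((face_hypE jr Uq).2 qj).
  by rewrite (E v vq); apply: contraNneq => ->; rewrite mul0r.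
rewrite lt_neqAle eq_sym gn0 /=.
have := E _ (partial_derivation HU j Uq).
rewrite (partial_coord HU j Uq (zE j)) eqxx mulr1 => <-.
have B := box_ray HU j Uq.
have D : cvg ((fun s : R => s^-1 *: (x (psi phi U q (s *: e_ j + phi q)) - x q)) @ 0^'+).
  have [ O [h [[oO hC] Oq fh]]] := smooth_rep HU Uq Cx.
  have [ O' HO' OE] := (chart_nbhs HU _ Uq).1 fh.
  have D := ((hC 1%N).2 j).1 _ Oq.
  have L : (fun s : R => s^-1 *: (h (s *: e_ j + phi q) - h (phi q))) @ 0^'+ --> 'D_(e_ j) h (phi q).
    exact: cvg_dnbhs_at_right D.
  apply/cvg_ex; exists ('D_(e_ j) h (phi q)); apply: cvg_trans L; apply: near_eq_cvg.
  have B' : \forall s \near (0 : R)^'+, O' (s *: e_ j + phi q).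
    by have H1 := line_near (e_ j) HO'; exact: cvg_at_right_filter H1.
  near=> s; have Bs : box r eps (s *: e_ j + phi q) by near: s.
  have [Us Es] := psiP HU q Bs.
  by rewrite (OE _ Us) ?Es ?(nbhs_singleton fh)//; near: s.
rewrite /partial; apply: limr_ge => //; near=> s.
by rewrite xq subr0 /GRing.scale /= mulr_ge0// invr_ge0 ltW//.
Unshelve. all: by end_near. Qed.

End BoundaryDefining.

(** * b-functions and b-tangent vectors *)

Section BFunctions.
Context {R : realType} {M : manifold_with_corners R}.
Local Notation n := (mdim M).
Implicit Types (p q m : M) (f g x : M -> R) (A H : set M).

Definition bdf_of H : M -> R := xget (fun=> 0) [set x | bdf H x].

Lemma bdf_ofP H : bhs H -> bdf H (bdf_of H).
Proof.
move=> /mwc_embedded[x Hx]; rewrite /bdf_of.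
by case: xgetP => [y _ //|/(_ x)]; case.
Qed.

Lemma bdf_smooth H x : bdf H x -> Cinfty M x. Proof. by case. Qed.
Lemma bdf_ge0 H x q : bdf H x -> 0 <= x q. Proof. by case. Qed.
Lemma bdf_eq0 H x q : bdf H x -> x q = 0 <-> H q. Proof. by case. Qed.

Lemma bdf_gt0 H x q : bdf H x -> ~ H q -> 0 < x q.
Proof.
move=> Hx nH; rewrite lt_neqAle (bdf_ge0 q Hx) andbT eq_sym.
by apply/eqP => /(bdf_eq0 q Hx).
Qed.

Lemma near_open q f (B : set R) : Cinfty M f -> open B -> B (f q) -> \forall q' \near q, B (f q').
Proof.
move=> Cf oB Bq; have C := Cinfty_continuous Cf (x := q).
by apply: (C B); exact: open_nbhs_nbhs.
Qed.

Lemma smooth_at_ratio q x y : Cinfty M x -> Cinfty M y -> y q != 0 ->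
  exists2 g, Cinfty M g & \forall q' \near q, x q' = g q' * y q'.
Proof.
move=> Cx Cy yq; have [z Cz zE] := Cinfty_inv Cy yq.
exists (x * z); first exact: CinftyM.
have N : \forall q' \near q, y q' != 0.
  exact: (near_open Cy (open_neq (y := 0))).
near=> q'; rewrite mulfctE; have -> : z q' = (y q')^-1 by near: q'.
by rewrite mulfVK//; near: q'.
Unshelve. all: by end_near. Qed.

Lemma pos_near q g : Cinfty M g -> 0 < g q -> \forall q' \near q, 0 < g q'.
Proof.
move=> Cg gq; exact: (near_open Cg (open_gt (y := 0))).
Qed.

Lemma bdf_ratio H x y q : bhs H -> bdf H x -> bdf H y ->
  exists2 g, Cinfty M g & 0 < g q /\ \forall q' \near q, x q' = g q' * y q'.
Proof.
move=> bH Hx Hy; have Cx := bdf_smooth Hx; have Cy := bdf_smooth Hy.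
have [Hq|nHq] := pselect (H q); last first.
  have yq := bdf_gt0 Hy nHq; have [g Cg gE] := smooth_at_ratio Cx Cy (lt0r_neq0 yq).
  exists g => //; split=> //; have := bdf_gt0 Hx nHq.
  by rewrite (nbhs_singleton gE) pmulr_lgt0.
have [r [phi [U [e [HU Uq q0]]]]] := chart_exists q.
have [j [jr qj] HE] := bhs_face_hyp HU q bH Hq Uq.
rewrite HE in Hx Hy.
have [g Cg [gq gE]] := bdf_coord HU Uq q0 jr Hx Uq qj.
have [h Ch [hq hE]] := bdf_coord HU Uq q0 jr Hy Uq qj.
have [k Ck kE] := smooth_at_ratio Cg Ch (lt0r_neq0 hq).
exists k => //; split.
  by have := gq; rewrite (nbhs_singleton kE) pmulr_lgt0.
near=> q'; have -> : x q' = g q' * phi q' 0 j by near: q'.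
have -> : y q' = h q' * phi q' 0 j by near: q'.
by have -> : g q' = k q' * h q' by [near: q']; rewrite mulrA.
Unshelve. all: by end_near. Qed.

Lemma bdf_divide H x f q : bhs H -> bdf H x -> Cinfty M f -> (forall p, H p -> f p = 0) ->
  exists2 g, Cinfty M g & \forall q' \near q, f q' = g q' * x q'.
Proof.
move=> bH Hx Cf f0; have Cx := bdf_smooth Hx.
have [Hq|nHq] := pselect (H q); last first.
  exact: smooth_at_ratio Cf Cx (lt0r_neq0 (bdf_gt0 Hx nHq)).
have [r [phi [U [e [HU Uq q0]]]]] := chart_exists q.
have [j [jr qj] HE] := bhs_face_hyp HU q bH Hq Uq.
rewrite HE in Hx f0.
have [g Cg [gq gE]] := bdf_coord HU Uq q0 jr Hx Uq qj.
have [|h Ch hE] := chart_division HU jr Uq qj Cf.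
  by move=> q' Uq' q'j; apply: f0; apply: (face_hyp_coord HU).
have [k Ck kE] := smooth_at_ratio Ch Cg (lt0r_neq0 gq).
exists k => //; near=> q'.
have -> : f q' = h q' * phi q' 0 j by near: q'.
have -> : x q' = g q' * phi q' 0 j by near: q'.
by have -> : h q' = k q' * g q' by [near: q']; rewrite mulrA.
Unshelve. all: by end_near. Qed.

Definition hyps m : set (set M) := [set H | bhs H /\ H m].

Lemma finite_hyps m : finite_set (hyps m).
Proof.
have [r [phi [U [e [HU Um m0]]]]] := chart_exists m.
apply: (@sub_finite_set _ _ (face_hyp r phi U e m @` setT)).
  by move=> H [bH Hm]; have [j _ ->] := bhs_face_hyp HU m bH Hm Um; exists j.
by apply: finite_image; exact: finite_finset.
Qed.

Definition hyp_seq m : seq (set M) := fset_set (hyps m).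

Lemma hyp_seqP m H : reflect (bhs H /\ H m) (H \in hyp_seq m).
Proof.
rewrite /hyp_seq in_fset_set; last exact: finite_hyps.
by apply: (iffP idP); rewrite in_setE.
Qed.

Lemma hyp_seq_uniq m : uniq (hyp_seq m). Proof. exact: fset_uniq. Qed.

Definition interior_pt q := forall H, bhs H -> ~ H q.

Lemma interior_dense p A : nbhs p A -> exists2 q, A q & interior_pt q.
Proof.
move=> HA; have [r [phi [U [e [HU Up p0]]]]] := chart_exists p.
have [ O HO OA] := (chart_nbhs HU A Up).1 HA; rewrite p0 in HO.
pose v : 'rV[R]_n := const_mx 1.
have H1 : \forall s \near (0 : R)^'+, O (s *: v + 0).
  by have H1 := line_near v HO; exact: cvg_at_right_filter H1.
have : \forall s \near (0 : R)^'+, [/\ 0 < s, O (s *: v + 0) & s < e].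
  by near=> s; split; near: s => //; [exact: nbhs_right_gt|apply: nbhs_right_lt; exact: chart_eps HU].
move=> /filter_ex[s [s0 Os se]].
have B : box r e (s *: v + 0).
  by move=> i; rewrite !mxE mulr1 addr0 gtr0_norm//; split => // _; exact: ltW.
have [Us Es] := psiP HU p B.
exists (psi phi U p (s *: v + 0)); first by apply: OA; rewrite ?Es.
move=> H bH Hq; have [j [_ +] _] := bhs_face_hyp HU p bH Hq Us.
by rewrite Es !mxE mulr1 addr0 => E; move: s0; rewrite E ltxx.
Unshelve. all: by end_near. Qed.

Lemma dense_eq p f g : Cinfty M f -> Cinfty M g ->
  (\forall q \near p, interior_pt q -> f q = g q) -> \forall q \near p, f q = g q.
Proof.
move=> Cf Cg /near_join; apply: filterS => q H; apply: contrapT => /eqP fg.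
have : \forall q' \near q, (f - g) q' != 0.
  apply: (near_open (CinftyB Cf Cg) (open_neq (y := 0))).
  by rewrite /= subr_eq0.
move=> H'; have [q' [E1 E2] iq'] := interior_dense (filterI H H').
by move: E2; rewrite -[(f - g) q']/(f q' - g q') E1// subrr eqxx.
Qed.

(** Local quotients are unique because [g] is non-zero on a dense set; they thus agree on overlaps,
    and their values at the base points form a smooth function. *)
Lemma glue_division f g : Cinfty M g -> (forall q, interior_pt q -> g q != 0) ->
  (forall p, exists2 h, Cinfty M h & \forall q \near p, f q = h q * g q) ->
  exists2 h, Cinfty M h & forall q, f q = h q * g q.
Proof.
move=> Cg g0 H.
have H' p : exists h, Cinfty M h /\ \forall q \near p, f q = h q * g q.
  by have [h Ch E] := H p; exists h.
have [h hP] := choice H'; exists (fun q => h q q).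
  apply/smooth_atP => p; have [Cp pE] := hP p; exists (h p) => //.
  apply: filterS (near_join pE) => q qE; have [Cq qE'] := hP q.
  apply: (nbhs_singleton (dense_eq Cq Cp _)); near=> q' => iq'.
  apply: (mulIf (g0 _ iq')); transitivity (f q'); first by apply/esym; near: q'.
  by near: q'.
by move=> q; have [_ E] := hP q; exact: nbhs_singleton E.
Unshelve. all: by end_near. Qed.

Definition hyp_prod (a : set M -> nat) m q : R := \prod_(H <- hyp_seq m) bdf_of H q ^+ a H.

Lemma hyp_prodE a m : hyp_prod a m = \prod_(H <- hyp_seq m) (bdf_of H ^+ a H).
Proof. by apply/funext => q; rewrite /hyp_prod fct_prodE; apply: eq_bigr => H _; rewrite exprfE. Qed.

Lemma CinftyX f k : Cinfty M f -> Cinfty M (f ^+ k).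
Proof.
by move=> Cf; elim: k => [|k IH]; [exact: Cinfty_cst | rewrite exprS; exact: CinftyM].
Qed.

Lemma Cinfty_hyp_prod a m : Cinfty M (hyp_prod a m).
Proof.
rewrite hyp_prodE big_seq_cond; apply: Cinfty_prod => H.
by rewrite andbT => /hyp_seqP[bH _]; apply: CinftyX; exact: bdf_smooth (bdf_ofP bH).
Qed.

(** The defining functions are normalized to the fixed choice [bdf_of]. The exponents stay the same,
    since two defining functions of one hypersurface differ locally by a positive smooth factor. *)
Lemma b_functionP g : b_function g <-> exists a : set M -> nat, forall m,
  exists2 alpha, Cinfty M alpha & \forall q \near m, 0 < alpha q /\ g q = alpha q * hyp_prod a m q.
Proof.
split=> [[x [a [Hx xE]]]|[a aE]]; last first.
  exists bdf_of, a; split; first exact: bdf_ofP.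
  move=> m; have [al Cal alE] := aE m; exists al => //.
  apply: filterS alE => q [aq ->]; split => //; congr (_ * _).
  by rewrite /hyp_prod (fsbig_finite _ _ (finite_hyps m)).
exists a => m; have [al Cal alE] := xE m.
have key (s : seq (set M)) : (forall H, H \in s -> bhs H) ->
  exists2 rho, Cinfty M rho & \forall q \near m, 0 < rho q /\
     \prod_(H <- s) x H q ^+ a H = rho q * \prod_(H <- s) bdf_of H q ^+ a H.
  elim: s => [|H s IH] bs.
    exists (fun=> 1); first exact: Cinfty_cst.
    by near=> q; rewrite !big_nil mulr1.
  have [|rho Crho rhoE] := IH; first by move=> K Ks; apply: bs; rewrite inE Ks orbT.
  have bH : bhs H by apply: bs; rewrite inE eqxx.
  have [g' Cg' [g'q g'E]] := bdf_ratio m bH (Hx _ bH) (bdf_ofP bH).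
  exists (g' ^+ a H * rho); first by apply: CinftyM => //; exact: CinftyX.
  have N := pos_near Cg' g'q.
  near=> q; rewrite !big_cons mulfctE exprfE.
  have [r0 ->] : 0 < rho q /\
     \prod_(H <- s) x H q ^+ a H = rho q * \prod_(H <- s) bdf_of H q ^+ a H by near: q.
  have -> : x H q = g' q * bdf_of H q by near: q.
  split; first by rewrite mulr_gt0// exprn_gt0//; near: q.
  by rewrite exprMn; ring.
have [|rho Crho rhoE] := key (hyp_seq m); first by move=> H /hyp_seqP[].
exists (al * rho); first exact: CinftyM.
near=> q; rewrite mulfctE.
have [a0 ->] : 0 < al q /\ g q = al q * \big[*%R/1]_(H \in hyps m) x H q ^+ a H by near: q.
have [r0 rE] : 0 < rho q /\ \prod_(H <- hyp_seq m) x H q ^+ a H = rho q * hyp_prod a m q by near: q.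
rewrite (fsbig_finite _ _ (finite_hyps m)) /=.
by split; [exact: mulr_gt0 | rewrite -[fset_set _ : seq _]/(hyp_seq m) rE mulrA].
Unshelve. all: by end_near. Qed.

Lemma b_function_smooth g : b_function g -> Cinfty M g.
Proof.
move=> /b_functionP[a aE]; apply/smooth_atP => m; have [al Cal alE] := aE m.
exists (al * hyp_prod a m); first by apply: CinftyM => //; exact: Cinfty_hyp_prod.
by apply: filterS alE => q [].
Qed.

Lemma b_function_interior g q : b_function g -> interior_pt q -> 0 < g q.
Proof.
move=> /b_functionP[a aE] iq; have [al Cal alE] := aE q.
have [a0 ->] := nbhs_singleton alE; rewrite mulr_gt0//.
rewrite /hyp_prod big_seq_cond big1 ?ltr01// => H /andP[/hyp_seqP[bH Hq] _].
by case: (iq H bH Hq).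
Qed.

Lemma b_functionM g h : b_function g -> b_function h -> b_function (g * h).
Proof.
move=> /b_functionP[a aE] /b_functionP[b bE]; apply/b_functionP.
exists (fun H => a H + b H)%N => m; have [al Cal alE] := aE m; have [be Cbe beE] := bE m.
exists (al * be); first exact: CinftyM.
near=> q; rewrite !mulfctE.
have [a0 ->] : 0 < al q /\ g q = al q * hyp_prod a m q by near: q.
have [b0 ->] : 0 < be q /\ h q = be q * hyp_prod b m q by near: q.
split; first exact: mulr_gt0.
have -> : hyp_prod (fun H => a H + b H)%N m q = hyp_prod a m q * hyp_prod b m q.
  by rewrite /hyp_prod -big_split; apply: eq_bigr => H _; rewrite exprD.
by rewrite mulrACA.
Unshelve. all: by end_near. Qed.

Lemma b_function_pos g : Cinfty M g -> (forall q, 0 < g q) -> b_function g.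
Proof.
move=> Cg g0; apply/b_functionP; exists (fun=> 0)%N => m; exists g => //.
near=> q; split=> //; rewrite /hyp_prod big1 ?mulr1// => H _; exact: expr0.
Unshelve. all: by end_near. Qed.

Lemma b_function1 : b_function (1 : M -> R).
Proof. by apply: b_function_pos => [|q]; [exact: Cinfty_cst | exact: ltr01]. Qed.

Lemma b_functionX g k : b_function g -> b_function (g ^+ k).
Proof.
by move=> bg; elim: k => [|k IH]; [exact: b_function1 | rewrite exprS; exact: b_functionM].
Qed.

Lemma b_function_prod (I : eqType) (s : seq I) (F : I -> M -> R) :
  (forall i, i \in s -> b_function (F i)) -> b_function (\prod_(i <- s) F i).
Proof.
elim: s => [|i s IH] H; first by rewrite big_nil; exact: b_function1.
rewrite big_cons; apply: b_functionM; first by apply: H; rewrite inE eqxx.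
by apply: IH => j js; apply: H; rewrite inE js orbT.
Qed.

Lemma b_function_bdf_of H : bhs H -> b_function (bdf_of H).
Proof.
move=> bH; apply/b_functionP; exists (fun K => nat_of_bool (K == H)) => m.
have Hx := bdf_ofP bH; have Cx := bdf_smooth Hx.
have [Hm|nHm] := pselect (H m).
  exists (fun=> 1); first exact: Cinfty_cst.
  near=> q; split => //; rewrite mul1r /hyp_prod (bigD1_seq H)/=; last 2 first.
  - exact/hyp_seqP.
  - exact: hyp_seq_uniq.
  by rewrite eqxx expr1 big1 ?mulr1// => K /negbTE ->.
exists (bdf_of H) => //; have N := pos_near Cx (bdf_gt0 Hx nHm).
near=> q; split; first by near: q.
rewrite /hyp_prod big_seq_cond big1 ?mulr1// => K /andP[/hyp_seqP[bK Km] _].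
by case: eqP => // KH; case: nHm; rewrite -KH.
Unshelve. all: by end_near. Qed.

End BFunctions.

(** * Logarithmic derivatives, and b-tangent vectors as derivations *)

Section BFields.
Context {R : realType} {M : manifold_with_corners R}.
Local Notation n := (mdim M).
Implicit Types (p q m : M) (f g x : M -> R) (A H : set M) (V W : (M -> R) -> (M -> R)).

Lemma b_field_pd V p : b_field V -> point_derivation (Cinfty M) p (fun f => V f p).
Proof.
move=> [_ VL VM _]; split=> [c f g Cf Cg|f g Cf Cg]; first by rewrite VL.
by rewrite VM.
Qed.

Lemma b_field_smooth V f : b_field V -> Cinfty M f -> Cinfty M (V f).
Proof. by case=> H _ _ _; exact: H. Qed.

Lemma b_field_near V f g p : b_field V -> Cinfty M f -> Cinfty M g ->
  (\forall q \near p, f q = g q) -> \forall q \near p, V f q = V g q.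
Proof.
move=> bV Cf Cg /near_join; apply: filterS => q H.
exact: pd_near (b_field_pd q bV) Cf Cg H.
Qed.

Lemma b_field_bdf V H x : b_field V -> bhs H -> bdf H x ->
  exists2 h, Cinfty M h & forall q, V x q = h q * x q.
Proof.
move=> bV bH Hx; apply: glue_division; first exact: bdf_smooth Hx.
  by move=> q iq; rewrite gt_eqF// (bdf_gt0 Hx)//; exact: iq.
move=> q; apply: (bdf_divide q bH Hx); first exact: b_field_smooth bV (bdf_smooth Hx).
by case: bV => _ _ _ H4 p Hp; apply: (H4 H x bH) Hp => [|p' Hp']; [exact: bdf_smooth Hx|exact/(bdf_eq0 p' Hx)].
Qed.

(** Tangency makes [V x] divisible by each defining function [x], and logarithmic derivatives add up
    over the local factorization of [g]. The local quotients are then glued. *)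
Lemma log_derivative V g : b_field V -> b_function g ->
  exists2 h, Cinfty M h & forall q, V g q = h q * g q.
Proof.
move=> bV bg; have Cg := b_function_smooth bg.
apply: glue_division => // [q iq|m]; first by rewrite gt_eqF// b_function_interior.
have /b_functionP[a aE] := bg; have [al Cal alE] := aE m.
have CP := Cinfty_hyp_prod a m.
have [k Ck kE] : exists2 k, Cinfty M k & forall q, V (hyp_prod a m) q = k q * hyp_prod a m q.
  rewrite hyp_prodE; have : {in hyp_seq m, forall H, bhs H} by move=> H /hyp_seqP[].
  elim: (hyp_seq m) => [|H s IH] bs.
    exists (fun=> 0); first exact: Cinfty_cst.
    by move=> q; rewrite big_nil mul0r; exact: (pd_cst 1 (b_field_pd q bV)).
  have [|k Ck kE] := IH; first by move=> K Ks; apply: bs; rewrite inE Ks orbT.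
  have bH : bhs H by apply: bs; rewrite inE eqxx.
  have Hx := bdf_ofP bH; have Cx := bdf_smooth Hx; have [h Ch hE] := b_field_bdf bV bH Hx.
  have XE j q : V (bdf_of H ^+ j) q = (j%:R * h q) * (bdf_of H ^+ j) q.
    elim: j => [|j IHj]; first by rewrite mul0r mul0r; exact: (pd_cst 1 (b_field_pd q bV)).
    rewrite exprS (b_field_pd q bV).2//; last exact: CinftyX.
    by rewrite IHj hE mulfctE -natr1; ring.
  exists (fun q => (a H)%:R * h q + k q).
    by apply: CinftyD => //; apply: CinftyM => //; exact: Cinfty_cst.
  move=> q; rewrite big_cons (b_field_pd q bV).2//; last 2 first.
  - exact: CinftyX.
  - rewrite big_seq_cond; apply: Cinfty_prod => K; rewrite andbT => Ks.
    by apply: CinftyX; apply: (bdf_smooth (bdf_ofP (bs K _))); rewrite inE Ks orbT.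
  by rewrite kE XE mulfctE; ring.
have am : al m != 0 by rewrite gt_eqF//; case: (nbhs_singleton alE).
have [be Cbe beE] := smooth_at_ratio (b_field_smooth bV Cal) Cal am.
exists (be + k); first exact: CinftyD.
have N1 : \forall q \near m, g q = (al * hyp_prod a m) q by apply: filterS alE => q [].
have N2 := b_field_near bV Cg (CinftyM Cal CP) N1.
near=> q; have -> : V g q = V (al * hyp_prod a m) q by near: q.
have -> : g q = (al * hyp_prod a m) q by near: q.
rewrite (b_field_pd q bV).2// kE mulfctE -[(be + k) q]/(be q + k q).
by have -> : V al q = be q * al q by [near: q]; ring.
Unshelve. all: by end_near. Qed.

Lemma dlogP V g : b_field V -> b_function g ->
  Cinfty M (dlog V g) /\ forall q, V g q = dlog V g q * g q.
Proof.
move=> bV bg; have [h Ch hE] := log_derivative bV bg.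
suff -> : dlog V g = h by [].
apply/funext => p; rewrite /dlog; case: xgetP => [c _ [h' [Ch' hE' ->]]|/(_ (h p))]; last first.
  by move=> H; exfalso; apply: H; exists h.
apply: (nbhs_singleton (dense_eq Ch' Ch _)); near=> q => iq.
by apply: (mulIf (lt0r_neq0 (b_function_interior bg iq))); rewrite -hE hE'.
Unshelve. all: by end_near. Qed.

(** The equation is needed only at interior points, where [g] is positive; density extends the
    conclusion to the boundary. *)
Lemma dlog_near V g h p : b_field V -> b_function g -> Cinfty M h ->
  (\forall q \near p, interior_pt q -> V g q = h q * g q) -> \forall q \near p, dlog V g q = h q.
Proof.
move=> bV bg Ch H; have [Cd dE] := dlogP bV bg.
apply: (dense_eq Cd Ch); apply: filterS H => q H iq.
by apply: (mulIf (lt0r_neq0 (b_function_interior bg iq))); rewrite -dE H.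
Qed.

Lemma dlogE V g h : b_field V -> b_function g -> Cinfty M h ->
  (forall q, V g q = h q * g q) -> dlog V g = h.
Proof.
move=> bV bg Ch H; apply/funext => p; apply: (nbhs_singleton (dlog_near bV bg Ch _)).
by near=> q.
Unshelve. all: by end_near. Qed.

(* An intrinsic description of the fibre [bT p], in terms of germs only. *)
Definition b_derivation p (v : bvec M) : Prop :=
  [/\ (forall f, ~ Cinfty M f -> v.1 f = 0) /\ (forall g, ~ b_function g -> v.2 g = 0),
      point_derivation (Cinfty M) p v.1,
      forall g h, b_function g -> b_function h -> v.2 (g * h) = v.2 g + v.2 h,
      forall g, b_function g -> v.1 g = g p * v.2 g
    & forall g h be, b_function g -> b_function h -> Cinfty M be -> 0 < be p ->
        (\forall q \near p, g q = be q * h q) -> v.2 g = v.2 h + v.1 be / be p].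

Lemma bvec_eq (v w : bvec M) : (forall f, v.1 f = w.1 f) -> (forall g, v.2 g = w.2 g) -> v = w.
Proof. by case: v w => v1 v2 [w1 w2] /= /funext -> /funext ->. Qed.

Lemma b_value1 V p f : Cinfty M f -> (b_value V p).1 f = V f p.
Proof. by move=> Cf; rewrite /b_value /= asboolT. Qed.

Lemma b_value2 V p g : b_function g -> (b_value V p).2 g = dlog V g p.
Proof. by move=> Cf; rewrite /b_value /= asboolT. Qed.

Lemma point_derivation_eq p (v w : (M -> R) -> R) : (forall f, Cinfty M f -> v f = w f) ->
  point_derivation (Cinfty M) p v -> point_derivation (Cinfty M) p w.
Proof.
move=> vw [vL vM]; split=> [c f g Cf Cg|f g Cf Cg].
  by rewrite -!vw// ?vL//; apply: CinftyD => //; exact: CinftyZ.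
by rewrite -!vw// ?vM//; exact: CinftyM.
Qed.

Lemma b_value_derivation V p : b_field V -> b_derivation p (b_value V p).
Proof.
move=> bV; split.
- by split=> [f Cf|g bg]; rewrite /b_value /= asboolF.
- by apply: point_derivation_eq (b_field_pd p bV) => f Cf; rewrite b_value1.
- move=> g h bg bh; rewrite !b_value2//; last exact: b_functionM.
  have [Cg gE] := dlogP bV bg; have [Ch hE] := dlogP bV bh.
  rewrite (dlogE (h := dlog V g + dlog V h) bV)//; first exact: b_functionM.
    exact: CinftyD.
  move=> q; rewrite (b_field_pd q bV).2 ?gE ?hE; try exact: b_function_smooth.
  by rewrite mulfctE -[(dlog V g + dlog V h) q]/(dlog V g q + dlog V h q); ring.
- move=> g bg; rewrite b_value1 ?b_value2//; last exact: b_function_smooth.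
  by rewrite (dlogP bV bg).2 mulrC.
- move=> g h be bg bh Cbe bep gE; rewrite !b_value2// b_value1//.
  have [Cg gE'] := dlogP bV bg; have [Ch hE] := dlogP bV bh.
  have [ib Cib ibE] := Cinfty_inv Cbe (lt0r_neq0 bep).
  have Cs := b_function_smooth.
  have : \forall q \near p, dlog V g q = (dlog V h + V be * ib) q.
    apply: dlog_near => //.
      by apply: CinftyD => //; apply: CinftyM => //; exact: b_field_smooth.
    have N := b_field_near bV (Cs _ _ _ bg) (CinftyM Cbe (Cs _ _ _ bh)) gE.
    have N' := pos_near Cbe bep.
    near=> q => _; have -> : V g q = V (be * h) q by near: q.
    rewrite (b_field_pd q bV).2 ?hE//; last exact: Cs.
    have -> : g q = be q * h q by near: q.
    have b0 : be q != 0 by rewrite gt_eqF//; near: q.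
    rewrite -[(dlog V h + V be * ib) q]/(dlog V h q + V be q * ib q).
    have -> : ib q = (be q)^-1 by near: q.
    by field.
  move=> /nbhs_singleton ->; rewrite -[LHS]/(dlog V h p + V be p * ib p).
  by rewrite (nbhs_singleton ibE).
Unshelve. all: by end_near. Qed.

Lemma b_derivation_lin p c v w : b_derivation p v -> b_derivation p w ->
  b_derivation p (c *: v + w).
Proof.
move=> [[v1 v2] [vL vM] v4 v5 v6] [[w1 w2] [wL wM] w4 w5 w6].
have E1 f : (c *: v + w).1 f = c * v.1 f + w.1 f by [].
have E2 f : (c *: v + w).2 f = c * v.2 f + w.2 f by [].
split; [split=> f Cf|split=> [d f g Cf Cg|f g Cf Cg]|move=> g h bg bh|move=> g bg|
  move=> g h be bg bh Cbe bep gE]; rewrite ?E1 ?E2.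
- by rewrite v1// w1// mulr0 addr0.
- by rewrite v2// w2// mulr0 addr0.
- by rewrite vL// wL//; ring.
- by rewrite vM// wM//; ring.
- by rewrite v4// w4//; ring.
- by rewrite v5// w5//; ring.
- by rewrite (v6 g h be)// (w6 g h be)//; ring.
Qed.

Lemma b_derivation0 p : b_derivation p 0.
Proof.
by split; rewrite /=; [split|split|..] => *; rewrite ?mulr0 ?addr0// -[RHS]/(0 + 0 / _) mul0r addr0.
Qed.

Lemma b_derivation_sum p (I : Type) (s : seq I) (c : I -> R) (v : I -> bvec M) :
  (forall i, b_derivation p (v i)) -> b_derivation p (\sum_(i <- s) c i *: v i).
Proof.
move=> H; elim: s => [|i s IH]; first by rewrite big_nil; exact: b_derivation0.
by rewrite big_cons; exact: b_derivation_lin.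
Qed.

Lemma b_derivation_prod p v (I : eqType) (s : seq I) (F : I -> M -> R) : b_derivation p v ->
  (forall i, i \in s -> b_function (F i)) ->
  v.2 (\prod_(i <- s) F i) = \sum_(i <- s) v.2 (F i).
Proof.
move=> vp; have [_ _ vM _ _] := vp; elim: s => [|i s IH] bF.
  rewrite !big_nil; have := vM _ _ b_function1 b_function1.
  by rewrite mulr1 => /eqP; rewrite -subr_eq0 opprD addNKr oppr_eq0 => /eqP.
have bs : forall j, j \in s -> b_function (F j) by move=> j js; apply: bF; rewrite inE js orbT.
rewrite !big_cons vM ?IH//; last exact: b_function_prod.
by apply: bF; rewrite inE eqxx.
Qed.

Lemma b_derivation_exp p v g k : b_derivation p v -> b_function g -> v.2 (g ^+ k) = k%:R * v.2 g.
Proof.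
move=> vp bg; have := @b_derivation_prod p v nat (iota 0 k) (fun=> g) vp (fun _ _ => bg).
by rewrite !big_const_seq count_predT size_iota -!Monoid.iteropE /= -/(GRing.exp g k) => ->; rewrite -/(GRing.natmul _ _) mulr_natl.
Qed.

Lemma b_field_lin V W c : b_field V -> b_field W -> Cinfty M c ->
  b_field (fun f => c * V f + W f).
Proof.
move=> [V1 V2 V3 V4] [W1 W2 W3 W4] Cc; split.
- by move=> f Cf; apply: CinftyD; [apply: CinftyM => //; exact: V1|exact: W1].
- move=> d f g Cf Cg; rewrite V2// W2//; apply/funext => q.
  rewrite -[LHS]/(c q * (d * V f q + V g q) + (d * W f q + W g q)).
  by rewrite -[RHS]/(d * (c q * V f q + W f q) + (c q * V g q + W g q)); ring.
- by move=> f g Cf Cg; rewrite V3// W3// !mulrDr addrACA !(mulrCA c).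
- move=> H f bH Cf f0 p Hp; rewrite -[LHS]/(c p * V f p + W f p).
  by rewrite (V4 H f bH)// (W4 H f bH)// mulr0 addr0.
Qed.

Lemma b_field0 : b_field (fun _ : M -> R => 0 : M -> R).
Proof.
split=> //; first by move=> f _; exact: Cinfty_cst.
  by move=> c f g _ _; rewrite scaler0 addr0.
by move=> f g _ _; rewrite !mulr0 addr0.
Qed.

Lemma b_value_lin V W c p : b_field V -> b_field W -> Cinfty M c ->
  b_value (fun f => c * V f + W f) p = c p *: b_value V p + b_value W p.
Proof.
move=> bV bW Cc; have bX := b_field_lin bV bW Cc.
apply: bvec_eq => f.
  rewrite -[RHS]/(c p * (b_value V p).1 f + (b_value W p).1 f).
  by rewrite /b_value /=; case: asboolP => // _; rewrite mulr0 addr0.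
rewrite -[RHS]/(c p * (b_value V p).2 f + (b_value W p).2 f).
rewrite /b_value /=; case: asboolP => [bf|_]; last by rewrite mulr0 addr0.
have [C1 E1] := dlogP bV bf; have [C2 E2] := dlogP bW bf.
rewrite (dlogE (h := c * dlog V f + dlog W f) bX)//.
  by apply: CinftyD => //; exact: CinftyM.
move=> q; rewrite -[LHS]/(c q * V f q + W f q) E1 E2.
by rewrite -[(c * _ + _) q]/(c q * dlog V f q + dlog W f q); ring.
Qed.

Lemma b_value0 p : b_value (fun _ : M -> R => 0 : M -> R) p = 0.
Proof.
apply: bvec_eq => f; rewrite /b_value /=; case: asboolP => // bf.
rewrite (dlogE (h := fun=> 0) b_field0)//; first exact: Cinfty_cst.
by move=> q; rewrite mul0r.
Qed.

Lemma b_value_sum k (c : 'I_k -> M -> R) (V : 'I_k -> (M -> R) -> (M -> R)) :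
  (forall i, Cinfty M (c i)) -> (forall i, b_field (V i)) ->
  exists2 W, b_field W & forall p, b_value W p = \sum_i c i p *: b_value (V i) p.
Proof.
move=> Cc bV.
have H (s : seq 'I_k) : exists2 W, b_field W & forall p, b_value W p = \sum_(i <- s) c i p *: b_value (V i) p.
  elim: s => [|i s [W bW WE]].
    by exists (fun=> 0) => [|p]; [exact: b_field0 | rewrite big_nil b_value0].
  exists (fun f => c i * V i f + W f); first exact: b_field_lin.
  by move=> p; rewrite big_cons b_value_lin// WE.
by have [W bW WE] := H (index_enum 'I_k); exists W.
Qed.

End BFields.

(** * Local frames, and the fibre of the b-tangent bundle *)

Section Frame.
Context {R : realType} {M : manifold_with_corners R}.
Local Notation n := (mdim M).
Implicit Types (p q m : M) (f g x : M -> R) (A H : set M) (V W : (M -> R) -> (M -> R)).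

Lemma pos_extension p g : Cinfty M g -> 0 < g p ->
  exists k, [/\ Cinfty M k, forall q, 0 < k q & \forall q \near p, k q = g q].
Proof.
move=> Cg gp; have [chi [Cchi chi1 chi01 chi0]] := bump (pos_near Cg gp).
exists (chi * g + (1 - chi)); split.
- apply: CinftyD; first exact: CinftyM.
  by apply: CinftyB => //; exact: Cinfty_cst.
- move=> q; rewrite -[X in 0 < X]/(chi q * g q + (1 - chi q)).
  have /andP[c0 c1] := chi01 q.
  have [gq|ngq] := pselect (0 < g q); last first.
    by rewrite (nbhs_singleton (chi0 q ngq)) mul0r subr0 add0r ltr01.
  have [->|cn] := eqVneq (chi q) 0; first by rewrite mul0r subr0 add0r ltr01.
  by rewrite ltr_pwDl ?subr_ge0// mulr_gt0// lt_neqAle eq_sym cn.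
- near=> q; rewrite -[LHS]/(chi q * g q + (1 - chi q)).
  have -> : chi q = 1 by near: q.
  by rewrite mul1r subrr addr0.
Unshelve. all: by end_near. Qed.

Lemma partial_face r (phi : M -> 'rV[R]_n) U eps (i l : 'I_n) f q : chart r phi U eps ->
  U q -> l != i -> phi q 0 l = 0 -> (forall q', U q' -> phi q' 0 l = 0 -> f q' = 0) ->
  partial phi U i f q = 0.
Proof.
move=> HU Uq li ql f0; have B := box_ray HU i Uq.
rewrite /partial; apply: lim_near_cst => //; near=> s.
have Bs : box r eps (s *: (delta_mx 0 i : 'rV[R]_n) + phi q) by near: s.
have [Us Es] := psiP HU q Bs.
rewrite (f0 _ Us) ?(f0 _ Uq)// ?subrr ?scaler0//.
by rewrite Es !mxE (negbTE li) andbF mulr0 add0r.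
Unshelve. all: by end_near. Qed.

(** The components of [v] in the local basis [x_j d/dx_j], [d/dy_l], that is, its pairings with
    [dx_j/x_j] for [j < r] and with [dy_l] for the other indices. *)
Definition theta (r : nat) (z : 'I_n -> M -> R) (v : bvec M) : 'rV[R]_n :=
  \row_j (if (j < r)%N then v.2 (z j) else v.1 (z j)).

Lemma theta_lin r z c v w : theta r z (c *: v + w) = c *: theta r z v + theta r z w.
Proof. by apply/rowP => j; rewrite !mxE; case: ifP. Qed.

Lemma theta_sum r z (I : Type) (s : seq I) (c : I -> R) (v : I -> bvec M) :
  theta r z (\sum_(i <- s) c i *: v i) = \sum_(i <- s) c i *: theta r z (v i).
Proof.
elim: s => [|i s IH]; last by rewrite !big_cons theta_lin IH.
by rewrite !big_nil; apply/rowP => j; rewrite !mxE; case: ifP.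
Qed.

Definition coordinate_functions r (phi : M -> 'rV[R]_n) p (z : 'I_n -> M -> R) :=
  [/\ forall i, Cinfty M (z i), forall i : 'I_n, (i < r)%N -> b_function (z i)
    & forall i, \forall q \near p, z i q = phi q 0 i].

Definition frame r (z : 'I_n -> M -> R) (e : 'I_n -> (M -> R) -> M -> R) p :=
  (forall i, b_field (e i)) /\
  \forall q \near p, (forall i, theta r z (b_value (e i) q) = delta_mx 0 i) /\
    forall v, b_derivation q v -> theta r z v = 0 -> v = 0.

Lemma frame_exists p r (phi : M -> 'rV[R]_n) : coordinates p r phi ->
  exists z e, coordinate_functions r phi p z /\ frame r z e p.
Proof.
move=> /coordinates_chart[p0 [U [eps [HU Up]]]].
have pz (i : 'I_n) : phi p 0 i = 0 by rewrite p0 mxE.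
(* Coordinates live only on [U]. Near [p] the defining function of the [i]-th face is [g] times the
   coordinate, so its product with a globally positive extension of [1 / g] is a global b-function
   equal to the coordinate near [p]. *)
have zex (i : 'I_n) : exists z, [/\ Cinfty M z, (i < r)%N -> b_function z & \forall q \near p, z q = phi q 0 i].
  have [ir|ir] := boolP (i < r)%N; last first.
    by have [z Cz zE] := coord_ext HU i Up; exists z.
  pose H := face_hyp r phi U eps p i.
  have bH : bhs H by exact: (face_hyp_bhs HU).
  have Hx := bdf_ofP bH.
  have [g Cg [gp gE]] := bdf_coord HU Up p0 ir Hx Up (pz i).
  have [h Ch hE] := Cinfty_inv Cg (lt0r_neq0 gp).
  have hp : 0 < h p by rewrite (nbhs_singleton hE) invr_gt0.
  have [k [Ck k0 kE]] := pos_extension Ch hp.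
  have bz : b_function (k * bdf_of H).
    by apply: b_functionM; [exact: b_function_pos | exact: b_function_bdf_of].
  exists (k * bdf_of H); split => //; first exact: b_function_smooth.
  have N := pos_near Cg gp; near=> q; rewrite mulfctE.
  have -> : bdf_of H q = g q * phi q 0 i by near: q.
  have -> : k q = h q by near: q.
  have -> : h q = (g q)^-1 by near: q.
  by rewrite mulKf// gt_eqF//; near: q.
have [z zP] := choice zex; exists z.
have Cz i : Cinfty M (z i) by case: (zP i).
have bz (i : 'I_n) : (i < r)%N -> b_function (z i) by case: (zP i).
have zE i : \forall q \near p, z i q = phi q 0 i by case: (zP i).
have [chi [Cchi chi1 chi01 chi0]] := bump (chart_near HU Up).
(* With this weight [e i] is [x_i d/dx_i] or [d/dy_i] near [p], made global by the cut-off [chi]. *)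
pose w (i : 'I_n) q := if (i < r)%N then phi q 0 i else 1.
pose e (i : 'I_n) f q := if `[< U q >] then chi q * w i q * partial phi U i f q else 0.
have eU i f q : U q -> e i f q = chi q * w i q * partial phi U i f q.
  by move=> Uq; rewrite /e asboolT.
have eN i f q : ~ U q -> e i f q = 0 by move=> nU; rewrite /e asboolF.
have be i : b_field (e i).
  split.
  - move=> f Cf; apply/smooth_atP => q; have [Uq|nU] := pselect (U q); last first.
      apply: smooth_at_near (smooth_at_cst q 0); have N := chi0 q nU; near=> q'.
      rewrite /e; case: asboolP => // _; have -> : chi q' = 0 by near: q'.
      by rewrite !mul0r.
    apply: (@smooth_at_near _ _ _ (chi * w i * partial phi U i f)).
      by apply: filterS (chart_near HU Uq) => q' /eU ->.
    apply: smooth_atM; last exact: (smooth_at_partial HU).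
    apply: smooth_atM; first exact: smooth_atW.
    by rewrite /w; case: (i < r)%N; [exact: (smooth_at_phi HU) | exact: smooth_at_cst].
  - move=> c f g Cf Cg; apply/funext => q; rewrite -[RHS]/(c * e i f q + e i g q).
    have [Uq|nU] := pselect (U q); last by rewrite !eN// mulr0 addr0.
    by rewrite !eU// (partial_derivation HU i Uq).1//; ring.
  - move=> f g Cf Cg; apply/funext => q; rewrite -[RHS]/(f q * e i g q + g q * e i f q).
    have [Uq|nU] := pselect (U q); last by rewrite !eN// !mulr0 addr0.
    by rewrite !eU// (partial_derivation HU i Uq).2//; ring.
  - move=> H f bH Cf f0 q Hq; have [Uq|nU] := pselect (U q); last by rewrite eN.
    have [l [lr ql] HE] := bhs_face_hyp HU p bH Hq Uq; rewrite eU//.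
    (* Tangency to the face [l]: for [l = i] the weight vanishes there, and otherwise [d/dx_i]
       differentiates along the face. *)
    have [li|li] := eqVneq l i; first by rewrite /w -li lr ql mulr0 mul0r.
    rewrite (partial_face HU Uq li ql) ?mulr0// => q' Uq' q'l; apply: f0.
    by rewrite HE; apply: (face_hyp_coord HU).
exists e; split; first by split.
split => //.
have NU := chart_near HU Up.
have Nz : \forall q \near p, forall i, z i q = phi q 0 i by apply: filter_forall.
have Ee : \forall q \near p, forall i j, e i (z j) q = w i q * (j == i)%:R.
  have NJ := near_join Nz.
  near=> q; have Uq : U q by near: q.
  have zq : \forall q' \near q, forall i, z i q' = phi q' 0 i by near: q.
  move=> i j; rewrite eU// (@partial_coord _ _ _ _ _ _ HU _ i j)//; last first.
    by apply: filterS zq => q' ->.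
  by have -> : chi q = 1 by [near: q]; rewrite mul1r.
have Ed (i j : 'I_n) : (j < r)%N -> \forall q \near p, dlog (e i) (z j) q = (j == i)%:R.
  move=> jr; apply: (dlog_near (h := fun=> (j == i)%:R)); [exact: be|exact: bz|exact: Cinfty_cst|].
  near=> q => _.
  have -> : e i (z j) q = w i q * (j == i)%:R by move: (i) (j); near: q.
  have -> : z j q = phi q 0 j by move: (j); near: q.
  by case: eqP => [<-|_]; rewrite /w ?jr mulrC ?mul0r.
have Ed' : \forall q \near p, forall i j : 'I_n, (j < r)%N -> dlog (e i) (z j) q = (j == i)%:R.
  apply: filter_forall => i; apply: filter_forall => j.
  by have [jr|jr] := boolP (j < r)%N; [apply: filterS (Ed i j jr) | near=> q].
have NJ := near_join Nz.
near=> q; split.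
  move=> i; apply/rowP => j; rewrite !mxE eqxx andTb; case: ifPn => jr.
    by rewrite b_value2; [move: (i) (j) jr; near: q|exact: bz].
  rewrite b_value1//; have -> : e i (z j) q = w i q * (j == i)%:R by move: (i) (j); near: q.
  by case: eqP => [<-|_]; rewrite ?mulr0// /w (negbTE jr) mulr1.
have Uq : U q by near: q.
have zq : \forall q' \near q, forall i, z i q' = phi q' 0 i by near: q.
have zq' i : \forall q' \near q, z i q' = phi q' 0 i by apply: filterS zq.
move=> v [[v1 v2] vpd vM vE vloc] th0.
have th (j : 'I_n) : (if (j < r)%N then v.2 (z j) else v.1 (z j)) = 0.
  by move: th0 => /rowP/(_ j); rewrite !mxE.
have vz (j : 'I_n) : v.1 (z j) = 0.
  by have := th j; case: ifPn => // jr vj; rewrite vE ?vj ?mulr0//; exact: bz.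
have v10 f : v.1 f = 0.
  have [Cf|nCf] := pselect (Cinfty M f); last exact: v1.
  by rewrite (derivation_partial HU Uq vpd Cf Cz zq') big1// => i _; rewrite vz mulr0.
apply: bvec_eq => // g; rewrite -[RHS]/(0 : R).
have [bg|nbg] := pselect (b_function g); last exact: v2.
(* As [v.1] is zero, the last clause of [b_derivation] allows positive smooth factors to be dropped:
   [g] reduces to a product of defining functions, and each of these to one of the [z l]. *)
have /b_functionP[a aE] := bg; have [al Cal alE] := aE q.
have bsx H : H \in hyp_seq q -> b_function (bdf_of H ^+ a H).
  by move=> /hyp_seqP[bH _]; apply: b_functionX; exact: b_function_bdf_of.
rewrite (vloc g (hyp_prod a q) al) ?v10 ?mul0r ?addr0//; last 3 first.
- by rewrite hyp_prodE; exact: b_function_prod.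
- by case: (nbhs_singleton alE).
- by apply: filterS alE => q' [].
rewrite hyp_prodE (@b_derivation_prod _ _ q)// big_seq_cond big1// => H /andP[/hyp_seqP[bH Hq] _].
rewrite (@b_derivation_exp _ _ q)//; last exact: b_function_bdf_of.
have [l [lr ql] HE] := bhs_face_hyp HU p bH Hq Uq.
have := bdf_ofP bH; rewrite {1}HE => Hx.
have [g' Cg' [gq' gE']] := bdf_coord HU Up p0 lr Hx Uq ql.
rewrite (vloc _ (z l) g') ?v10 ?mul0r ?addr0//.
- by have := th l; rewrite lr => ->; rewrite mulr0.
- exact: b_function_bdf_of.
- exact: bz.
have zl := zq' l; near=> q'; have -> : z l q' = phi q' 0 l by near: q'.
by near: q'.
Unshelve. all: by end_near. Qed.

Lemma frame_expand r z e p : frame r z e p -> \forall q \near p, forall v, b_derivation q v ->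
  v = \sum_i theta r z v 0 i *: b_value (e i) q.
Proof.
move=> [be]; apply: filterS => q [thE inj] v vq.
pose w := \sum_i theta r z v 0 i *: b_value (e i) q.
have wq : b_derivation q w by apply: b_derivation_sum => i; exact: b_value_derivation.
apply/eqP; rewrite -subr_eq0; apply/eqP; rewrite -/w.
have E : v - w = (-1) *: w + v by rewrite scaleN1r addrC.
rewrite E; apply: inj; first exact: b_derivation_lin.
rewrite theta_lin scaleN1r /w theta_sum.
rewrite (eq_bigr (fun i => theta r z v 0 i *: delta_mx 0 i)) -?row_sum_delta ?addNr//.
by move=> i _; rewrite thE.
Qed.

(** Conversely, a derivation is expanded in a frame at [p], and the combination of the frame fields
    with these constant coefficients is a global b-field. *)
Lemma bTE p v : bT p v <-> b_derivation p v.
Proof.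
split=> [[V bV ->]|vp]; first exact: b_value_derivation.
have [r [phi H]] := mwc_coordinates p; have [z [e [_ fr]]] := frame_exists H.
rewrite (nbhs_singleton (frame_expand fr) v vp).
have [W bW WE] := b_value_sum (c := fun i => fun=> theta r z v 0 i) (V := e)
  (fun i => Cinfty_cst _) fr.1.
by exists W.
Qed.

End Frame.

(** * Sections along a map *)

Section BMaps.
Context {R : realType} {M N : manifold_with_corners R}.
Implicit Types (p q m : M) (F : M -> N).

Lemma interior_b_map_smooth F : interior_b_map F -> smooth_map F.
Proof. by case=> -[]. Qed.

Lemma interior_b_map_bdf F H x : interior_b_map F -> bhs H -> bdf H x -> b_function (x \o F).
Proof. by move=> [[_ H1] H2] bH Hx; have [/(H2 H x bH Hx)|] := H1 H x bH Hx. Qed.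

(** Each [bdf_of H' \o F] factors with exponents [e H' H], so the exponent of the composite along
    [H] at [m] is the sum [S m H]. The difficulty is that this sum runs over the hypersurfaces
    through [F m], whereas a b-function has exponents independent of [m]. *)
Lemma b_function_comp F g : interior_b_map F -> b_function g -> b_function (g \o F).
Proof.
move=> HF /b_functionP[a aE]; have CF := interior_b_map_smooth HF.
have ex H' : exists e : set M -> nat, bhs H' -> forall m,
    exists2 alpha, Cinfty M alpha & \forall q \near m, 0 < alpha q /\
      bdf_of H' (F q) = alpha q * hyp_prod e m q.
  have [bH|nbH] := pselect (bhs H'); last by exists (fun=> 0)%N.
  by have /b_functionP[e eE] := interior_b_map_bdf HF bH (bdf_ofP bH); exists e.
have [e eE] := choice ex.
(* A positive exponent along [H] makes [bdf_of H' \o F] vanish on all of [H]. The non-zero terms of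
   [S m H] are therefore the same for all [m] in [H]. *)
have pos H' H m : bhs H' -> bhs H -> H m -> e H' H != 0%N -> H' (F m).
  move=> bH' bH Hm e0; have [al _ /nbhs_singleton[_ E]] := eE _ bH' m.
  apply/(bdf_eq0 _ (bdf_ofP bH')); rewrite E /hyp_prod (bigD1_seq H)/=; last 2 first.
  - exact/hyp_seqP.
  - exact: hyp_seq_uniq.
  have -> : bdf_of H m = 0 by apply/(bdf_eq0 _ (bdf_ofP bH)).
  by rewrite expr0n (negbTE e0) mul0r mulr0.
pose S m H := (\sum_(H' <- hyp_seq (F m)) a H' * e H' H)%N.
have SE m m' H : bhs H -> H m -> H m' -> S m H = S m' H.
  move=> bH Hm Hm'.
  have K k : H k -> S k H = (\sum_(H' <- [seq H' <- hyp_seq (F k) | e H' H != 0]) a H' * e H' H)%N.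
    move=> _; rewrite big_filter /S (bigID (fun H' => e H' H != 0%N))/= [X in (_ + X)%N]big1 ?addn0//.
    by move=> H'; rewrite negbK => /eqP ->; rewrite muln0.
  rewrite (K _ Hm) (K _ Hm'); apply: perm_big; apply: uniq_perm.
  - exact/filter_uniq/hyp_seq_uniq.
  - exact/filter_uniq/hyp_seq_uniq.
  move=> H'; rewrite !mem_filter; case: (eqVneq (e H' H) 0%N) => //= e0.
  by apply/hyp_seqP/hyp_seqP => -[bH' _]; split => //; exact: (pos H' H).
pose c H := xget 0%N [set k | exists2 m, H m & k = S m H].
have cE m H : bhs H -> H m -> c H = S m H.
  move=> bH Hm; rewrite /c; case: xgetP => [k _ [m' Hm' ->]|/(_ (S m H))]; first exact: SE.
  by move=> K; exfalso; apply: K; exists m.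
apply/b_functionP; exists c => m; have [al Cal alE] := aE (F m).
have key (s : seq (set N)) : {in s, forall H', bhs H'} ->
  exists2 rho, Cinfty M rho & \forall q \near m, 0 < rho q /\
    \prod_(H' <- s) bdf_of H' (F q) ^+ a H' =
    rho q * \prod_(H <- hyp_seq m) bdf_of H q ^+ (\sum_(H' <- s) a H' * e H' H)%N.
  elim: s => [|H' s IH] bs.
    exists (fun=> 1); first exact: Cinfty_cst.
    near=> q; rewrite big_nil mul1r big1// => H _; first by rewrite big_nil.
  have [|rho Crho rhoE] := IH; first by move=> K Ks; apply: bs; rewrite inE Ks orbT.
  have bH : bhs H' by apply: bs; rewrite inE eqxx.
  have [be Cbe beE] := eE _ bH m.
  exists (be ^+ a H' * rho); first by apply: CinftyM => //; exact: CinftyX.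
  near=> q; rewrite big_cons mulfctE exprfE.
  have [r0 ->] : 0 < rho q /\ \prod_(H' <- s) bdf_of H' (F q) ^+ a H' =
    rho q * \prod_(H <- hyp_seq m) bdf_of H q ^+ (\sum_(H' <- s) a H' * e H' H)%N by near: q.
  have [b0 ->] : 0 < be q /\ bdf_of H' (F q) = be q * hyp_prod (e H') m q by near: q.
  split; first by rewrite mulr_gt0// exprn_gt0.
  rewrite exprMn mulrACA; congr (_ * _).
  rewrite /hyp_prod -prodrXl -big_split; apply: eq_bigr => H _ /=.
  by rewrite big_cons exprD -exprM mulnC.
have [|rho Crho rhoE] := key (hyp_seq (F m)); first by move=> H /hyp_seqP[].
have CalF := CF _ Cal.
have NF : \forall q \near m, 0 < al (F q) /\ g (F q) = al (F q) * hyp_prod a (F m) (F q).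
  exact: (smooth_map_continuous CF alE).
exists ((al \o F) * rho); first exact: CinftyM.
near=> q; rewrite mulfctE /=.
have [a0 ->] : 0 < al (F q) /\ g (F q) = al (F q) * hyp_prod a (F m) (F q) by near: q.
have [r0 rE] : 0 < rho q /\ hyp_prod a (F m) (F q) =
  rho q * \prod_(H <- hyp_seq m) bdf_of H q ^+ (\sum_(H' <- hyp_seq (F m)) a H' * e H' H)%N by near: q.
split; first exact: mulr_gt0.
rewrite rE -mulrA; congr (_ * (_ * _)); rewrite /hyp_prod big_seq [RHS]big_seq.
by apply: eq_bigr => H /hyp_seqP[bH Hm]; rewrite (cE m).
Unshelve. all: by end_near. Qed.

Lemma b_differential_lin F c v w :
  b_differential F (c *: v + w) = c *: b_differential F v + b_differential F w.
Proof.
apply: bvec_eq => f.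
  rewrite -[RHS]/(c * (b_differential F v).1 f + (b_differential F w).1 f).
  by rewrite /b_differential /=; case: asboolP => // _; rewrite mulr0 addr0.
rewrite -[RHS]/(c * (b_differential F v).2 f + (b_differential F w).2 f).
by rewrite /b_differential /=; case: asboolP => // _; rewrite mulr0 addr0.
Qed.

Lemma b_differential0 F : b_differential F 0 = 0.
Proof. by apply: bvec_eq => f; rewrite /b_differential /=; case: asboolP. Qed.

Lemma b_differentialB F v w : b_differential F (v - w) = b_differential F v - b_differential F w.
Proof. by rewrite addrC -scaleN1r b_differential_lin scaleN1r addrC. Qed.

Lemma b_differential1 F v f : Cinfty N f -> (b_differential F v).1 f = v.1 (f \o F).
Proof. by move=> Cf; rewrite /b_differential /= asboolT. Qed.

Lemma b_differential2 F v g : b_function g -> (b_differential F v).2 g = v.2 (g \o F).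
Proof. by move=> Cf; rewrite /b_differential /= asboolT. Qed.

Lemma b_differential_derivation F p v : interior_b_map F -> b_derivation p v ->
  b_derivation (F p) (b_differential F v).
Proof.
move=> HF [[v1 v2] [vL vM] v4 v5 v6]; have CF := interior_b_map_smooth HF.
have bF := b_function_comp HF.
split.
- by split=> f Cf; rewrite /b_differential /= asboolF.
- split=> [c f g Cf Cg|f g Cf Cg]; rewrite !b_differential1//.
  + by rewrite -vL//; exact: CF.
  + by apply: CinftyD => //; exact: CinftyZ.
  + by rewrite -vM//; exact: CF.
  + exact: CinftyM.
- move=> g h bg bh; rewrite !b_differential2//; last exact: b_functionM.
  by rewrite -v4//; exact: bF.
- move=> g bg; rewrite b_differential1 ?b_differential2//; last exact: b_function_smooth.
  by rewrite v5//; exact: bF.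
- move=> g h be bg bh Cbe be0 gE; rewrite !b_differential2// b_differential1//.
  apply: v6; [exact: bF|exact: bF|exact: CF|exact: be0|].
  exact: (smooth_map_continuous CF gE).
Qed.

End BMaps.

Section Along.
Context {R : realType}.
Implicit Types M N P Q : manifold_with_corners R.

Lemma b_differential_comp M N P (F : M -> N) (G : N -> P) v : interior_b_map G ->
  b_differential (G \o F) v = b_differential G (b_differential F v).
Proof.
move=> HG; apply: bvec_eq => f.
  have [Cf|nCf] := pselect (Cinfty P f); last by rewrite /b_differential /= !(asboolF nCf).
  by rewrite !b_differential1//; exact: interior_b_map_smooth HG _ Cf.
have [bf|nbf] := pselect (b_function f); last by rewrite /b_differential /= !(asboolF nbf).
by rewrite !b_differential2//; exact: b_function_comp.
Qed.

Lemma b_differential_id M (p : M) v : b_derivation p v -> b_differential id v = v.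
Proof.
move=> [[v1 v2] _ _ _ _]; apply: bvec_eq => f; rewrite /b_differential /=; case: asboolP => // H.
  by rewrite v1.
by rewrite v2.
Qed.

Lemma smooth_map_comp M N P (F : M -> N) (G : N -> P) : smooth_map F -> smooth_map G ->
  smooth_map (G \o F).
Proof. by move=> HF HG f Cf; apply: (HF (f \o G)); exact: HG. Qed.

(* Smooth sections of the pull-back of the b-tangent bundle, by pairings. *)
Definition along P M (G : P -> M) (t : P -> bvec M) :=
  [/\ forall q, b_derivation (G q) (t q),
      forall f, Cinfty M f -> Cinfty P (fun q => (t q).1 f)
    & forall g, b_function g -> Cinfty P (fun q => (t q).2 g)].

Lemma along_push P M N (G : P -> M) (F : M -> N) t : along G t -> interior_b_map F ->
  along (F \o G) (fun q => b_differential F (t q)).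
Proof.
move=> [t1 t2 t3] HF; have CF := interior_b_map_smooth HF; split=> [q|f Cf|g bg].
- exact: b_differential_derivation.
- rewrite (_ : (fun q => _) = fun q => (t q).1 (f \o F)); first by apply: t2; exact: CF.
  by apply/funext => q; rewrite b_differential1.
- rewrite (_ : (fun q => _) = fun q => (t q).2 (g \o F)); first by apply: t3; exact: b_function_comp.
  by apply/funext => q; rewrite b_differential2.
Qed.

Lemma along_pre P Q M (G : P -> M) (K : Q -> P) t : along G t -> smooth_map K ->
  along (G \o K) (t \o K).
Proof. by move=> [t1 t2 t3] CK; split=> [q|f /t2/CK|g /t3/CK] //; exact: t1. Qed.

Lemma along_lin P M (G : P -> M) (c : P -> R) t u : Cinfty P c -> along G t -> along G u ->
  along G (fun q => c q *: t q + u q).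
Proof.
move=> Cc [t1 t2 t3] [u1 u2 u3]; split=> [q|f Cf|g bg]; first exact: b_derivation_lin.
  by apply: CinftyD; [apply: CinftyM => //; exact: t2|exact: u2].
by apply: CinftyD; [apply: CinftyM => //; exact: t3|exact: u3].
Qed.

Lemma along0 P M (G : P -> M) : along G (fun=> 0).
Proof. by split=> [q|f Cf|g bg]; [exact: b_derivation0 | exact: Cinfty_cst | exact: Cinfty_cst]. Qed.

Lemma along_sum P M (G : P -> M) k (c : 'I_k -> P -> R) (t : 'I_k -> P -> bvec M) :
  (forall i, Cinfty P (c i)) -> (forall i, along G (t i)) ->
  along G (fun q => \sum_i c i q *: t i q).
Proof.
move=> Cc Ht; elim: (index_enum _) => [|i s IH].
  rewrite (_ : (fun q => _) = fun=> 0); first exact: along0.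
  by apply/funext => q; rewrite big_nil.
rewrite (_ : (fun q => _) = fun q => c i q *: t i q + \sum_(j <- s) c j q *: t j q).
  exact: along_lin.
by apply/funext => q; rewrite big_cons.
Qed.

Lemma along_field P M (G : P -> M) V : smooth_map G -> b_field V ->
  along G (fun q => b_value V (G q)).
Proof.
move=> CG bV; split=> [q|f Cf|g bg]; first exact: b_value_derivation.
  rewrite (_ : (fun q => _) = V f \o G); first by apply: CG; exact: b_field_smooth.
  by apply/funext => q; rewrite b_value1.
rewrite (_ : (fun q => _) = dlog V g \o G); first by apply: CG; case: (dlogP bV bg).
by apply/funext => q; rewrite b_value2.
Qed.

Lemma along_near P M (G : P -> M) t : (forall q : P, exists2 u, along G u & \forall q' \near q, t q' = u q') ->
  along G t.
Proof.
move=> H; split=> [q|f Cf|g bg].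
- by have [u [u1 _ _] /nbhs_singleton ->] := H q.
- apply/smooth_atP => q; have [u [_ u2 _] E] := H q.
  by exists (fun q => (u q).1 f); [exact: u2 | apply: filterS E => q' ->].
- apply/smooth_atP => q; have [u [_ _ u3] E] := H q.
  by exists (fun q => (u q).2 g); [exact: u3 | apply: filterS E => q' ->].
Qed.

Lemma along_pullback_section P M (G : P -> M) t : smooth_map G ->
  smooth_pullback_section G t -> along G t.
Proof.
move=> CG H; apply: along_near => q; have [k [c [V [Cc bV E]]]] := H q.
exists (fun q => \sum_i c i q *: b_value (V i) (G q)) => //.
by apply: along_sum => // i; exact: along_field.
Qed.

(** For tangency, a function vanishing on [H] is locally a smooth multiple of [bdf_of H], whose
    derivative is [bdf_of H] times its smooth logarithmic derivative. *)
Lemma along_id M (s : M -> bvec M) : along id s ->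
  b_field (section_apply s) /\ forall q, s q = b_value (section_apply s) q.
Proof.
move=> [s1 s2 s3].
have bs : b_field (section_apply s).
  split=> [f Cf|c f g Cf Cg|f g Cf Cg|H f bH Cf f0 p Hp].
  - exact: s2.
  - apply/funext => q; rewrite -[RHS]/(c * (s q).1 f + (s q).1 g).
    by have [_ [sL _] _ _ _] := s1 q; rewrite /section_apply sL.
  - apply/funext => q; rewrite -[RHS]/(f q * (s q).1 g + g q * (s q).1 f).
    by have [_ [_ sM] _ _ _] := s1 q; rewrite /section_apply sM.
  - have [_ sp _ sE _] := s1 p; have Hx := bdf_ofP bH; have Cx := bdf_smooth Hx.
    have [g Cg E] := bdf_divide p bH Hx Cf f0.
    rewrite /section_apply (pd_near sp Cf (CinftyM Cg Cx) E) sp.2// sE; last exact: b_function_bdf_of.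
    by rewrite ((bdf_eq0 _ Hx).2 Hp) !mul0r mulr0 addr0.
split=> // q; have [[v1 v2] _ _ _ _] := s1 q.
apply: bvec_eq => f.
  have [Cf|nCf] := pselect (Cinfty M f); first by rewrite b_value1.
  by rewrite v1// /b_value /= asboolF.
have [bf|nbf] := pselect (b_function f); last by rewrite v2// /b_value /= asboolF.
rewrite b_value2// (dlogE (h := fun q => (s q).2 f) bs bf)//; first exact: s3.
by move=> p; have [_ _ _ sE _] := s1 p; rewrite /section_apply sE// mulrC.
Qed.

Lemma along_idP M (s : M -> bvec M) : smooth_section_over setT s <-> along id s.
Proof.
split=> [H|Hs p _]; last first.
  have [bs E] := along_id Hs; exists (section_apply s) => //.
  by near=> q => _.
apply: along_near => q; have [V bV E] := H q I; exists (b_value V).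
  exact: along_field.
by apply: filterS E => q'; apply.
Unshelve. all: by end_near. Qed.

Lemma theta_smooth P M (G : P -> M) t r phi p z (j : 'I_(mdim M)) : along G t ->
  coordinate_functions r phi p z -> Cinfty P (fun q => theta r z (t q) 0 j).
Proof.
move=> [_ t2 t3] [Cz bz _].
have [jr|jr] := boolP (j < r)%N.
  rewrite (_ : (fun q => _) = fun q => (t q).2 (z j)); first by apply: t3; exact: bz.
  by apply/funext => q; rewrite mxE jr.
rewrite (_ : (fun q => _) = fun q => (t q).1 (z j)); first exact: t2.
by apply/funext => q; rewrite mxE (negbTE jr).
Qed.

(** The retraction [K] extends the coefficients of [t] off the image of [G] by composition. *)
Lemma along_extend P M (G : P -> M) (K : M -> P) t q0 : smooth_map G -> smooth_map K ->
  (forall q, K (G q) = q) -> along G t ->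
  exists2 V, b_field V & \forall p \near G q0, forall q, p = G q -> t q = b_value V p.
Proof.
move=> CG CK KG Ht; have [r [phi H]] := mwc_coordinates (G q0).
have [z [e [Hz He]]] := frame_exists H.
have [V bV VE] := @b_value_sum R M _ (fun j p => theta r z (t (K p)) 0 j) e
  (fun j => CK _ (theta_smooth j Ht Hz)) He.1.
exists V => //; apply: filterS (frame_expand He) => p Hp q pq.
by rewrite VE pq KG -pq -Hp// pq; case: Ht.
Qed.

End Along.

(** * b-fibrations and commutators *)

Section BFibrations.
Context {R : realType}.
Implicit Types M N P Q : manifold_with_corners R.

(* The columns of [B] are the indicators of the disjoint sets [J j] (or [{s j}]), so that
   [S] only has to pick one element of each of them. *)
Lemma b_fibration_matrix M N (F : M -> N) (m : M) : interior_b_map F -> b_fibration F ->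
  exists r z e r' phi' z' e' (B : 'M[R]_(mdim M, mdim N)) (S : 'M[R]_(mdim N, mdim M)),
  [/\ frame r z e m, coordinate_functions r' phi' (F m) z' /\ frame r' z' e' (F m),
      S *m B = 1%:M
    & \forall q \near m, forall v, b_derivation q v ->
        theta r' z' (b_differential F v) = theta r z v *m B].
Proof.
move=> HF [_ _ /(_ m)[r [phi [r' [phi' [Hphi [Hphi' [J [s [sI sE JD JE]]]]]]]]]].
have CF := interior_b_map_smooth HF.
have [z [e [Hz He]]] := frame_exists Hphi; have [z' [e' [Hz' He']]] := frame_exists Hphi'.
pose B : 'M[R]_(mdim M, mdim N) :=
  \matrix_(i, j) (if (j < r')%N then i \in J j else i == s j)%:R.
(* The set [J j] is not empty: an empty product is one, while the coordinate of index [j] vanishes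
   at the centre [F m]. *)
have i0P (j : 'I_(mdim N)) : exists i, if (j < r')%N then i \in J j else i == s j.
  case: (boolP (j < r')%N) => jr; last by exists (s j).
  have [/eqP J0|/set0Pn//] := boolP (J j == finset.set0).
  have [_ /nbhs_singleton] := JE j jr; rewrite J0 big_set0.
  have [-> _] := coordinates_chart Hphi'.
  by rewrite mxE => /esym/eqP; rewrite oner_eq0.
have [i0 i0E] := choice i0P.
pose S : 'M[R]_(mdim N, mdim M) := \matrix_(j, i) (i == i0 j)%:R.
exists r, z, e, r', phi', z', e', B, S; split => //.
  apply/matrixP => j j'; rewrite !mxE (bigD1 (i0 j))//= !mxE eqxx mul1r big1 ?addr0; last first.
    by move=> i /negbTE ij; rewrite !mxE ij mul0r.
  congr (nat_of_bool _)%:R; have := i0E j.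
  case: (ltnP j r') => jr; case: (ltnP j' r') => jr' ij.
  - have [<-//|jj'] := eqVneq j j'; apply/negP => ij'.
    by have /negP := JD j j' jr jr' jj'; apply; apply/existsP; exists (i0 j); rewrite ij.
  - have := (JE j jr).1 _ ij; have := (sE j' jr').1.
    have -> : (j == j') = false by apply/eqP => E; move: jr'; rewrite -E leqNgt jr.
    by move=> A C; apply/eqP => E; move: A; rewrite leqNgt -E C.
  - have -> : (j == j') = false by apply/eqP => E; move: jr; rewrite E leqNgt jr'.
    apply/negP => /((JE j' jr').1 _); have := (sE j jr).1.
    by rewrite (eqP ij) leqNgt => /negbTE ->.
  - rewrite (eqP ij); have [->|jj'] := eqVneq j j'; first by rewrite eqxx.
    by apply/negP => /eqP /(sI _ _ jr jr') /eqP; rewrite (negbTE jj').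
have [Cz bz zE] := Hz; have [Cz' bz' zE'] := Hz'.
have N1 : \forall q \near m, forall i, z i q = phi q 0 i by apply: filter_forall.
have N2 : \forall q \near m, forall j, z' j (F q) = phi' (F q) 0 j.
  by apply: filter_forall => j; exact: (smooth_map_continuous CF (zE' j)).
have N3 : \forall q \near m, forall j : 'I_(mdim N), (r' <= j)%N -> phi' (F q) 0 j = phi q 0 (s j).
  apply: filter_forall => j; have [jr|jr] := boolP (r' <= j)%N; last by near=> q.
  by apply: filterS (sE j jr).2.
have N4 : \forall q \near m, forall j : 'I_(mdim N), (j < r')%N ->
    phi' (F q) 0 j = \prod_(i in J j) phi q 0 i.
  apply: filter_forall => j; have [jr|jr] := boolP (j < r')%N; last by near=> q.
  by apply: filterS (JE j jr).2.
have NN : \forall q \near m, forall j : 'I_(mdim N),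
    z' j (F q) = if (j < r')%N then \prod_(i in J j) z i q else z (s j) q.
  near=> q => j; have -> : z' j (F q) = phi' (F q) 0 j by move: (j); near: q.
  have zq : forall i, z i q = phi q 0 i by near: q.
  case: ltnP => jr.
    have -> : phi' (F q) 0 j = \prod_(i in J j) phi q 0 i by move: (j) jr; near: q.
    by apply: eq_bigr => i _; rewrite zq.
  by rewrite zq; move: (j) jr; near: q.
apply: filterS (near_join NN) => q qE v vq; have [_ vpd vM vE vloc] := vq.
apply/rowP => j; rewrite !mxE; have jE : \forall q' \near q, z' j (F q') =
    if (j < r')%N then \prod_(i in J j) z i q' else z (s j) q' by apply: filterS qE.
case: ltnP jE => jr jE.
  (* The logarithmic differential of a product is the sum of those of its factors, which gives the
     column of [B] indexed by [j]. *)
  have bJ : {in enum (J j), forall i, b_function (z i)}.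
    by move=> i; rewrite mem_enum => /((JE j jr).1) /bz.
  have bP := b_function_prod bJ.
  rewrite b_differential2; last exact: bz'.
  rewrite (vloc _ (\prod_(i <- enum (J j)) z i) 1) ?(pd_cst 1 vpd) ?mul0r ?addr0//; last 3 first.
  - by apply: b_function_comp => //; exact: bz'.
  - exact: Cinfty_cst.
  - apply: filterS jE => q' /= ->; rewrite -[1 q']/(1 : R) mul1r fct_prodE.
    by rewrite big_enum.
  rewrite (b_derivation_prod vq bJ) big_enum /= big_mkcond /=; apply: eq_bigr => i _.
  rewrite !mxE; have jr' := jr; rewrite jr'; case: ifP => iJ; last by rewrite mulr0.
  by rewrite ((JE j jr).1 i iJ) mulr1.
rewrite b_differential1//.
have Cz'F : Cinfty M (z' j \o F) by exact: CF.
rewrite (pd_near vpd Cz'F (Cz (s j)) jE) (bigD1 (s j))//= !mxE ltnNge (sE j jr).1 ltnNge jr eqxx mulr1.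
by rewrite big1 ?addr0// => i /negbTE ij; rewrite !mxE (ltnNge j) jr ij mulr0.
Unshelve. all: by end_near. Qed.

(** In frames [F_*] is right multiplication by the constant matrix [B], and [S *m B = 1]:
    multiplying the components of [t] by [S] gives a smooth lift wherever the frames are valid. *)
Lemma b_fibration_lift M N P (F : M -> N) (G : P -> M) t (q0 : P) :
  interior_b_map F -> b_fibration F -> smooth_map G -> along (F \o G) t ->
  exists2 u, along G u & \forall q \near q0, b_differential F (u q) = t q.
Proof.
move=> HF bF CG Ht.
have [r [z [e [r' [phi' [z' [e' [B [S [He [Hz' He'] SB FE]]]]]]]]]] := b_fibration_matrix (G q0) HF bF.
pose c i q := (theta r' z' (t q) *m S) 0 i.
have Cc i : Cinfty P (c i).
  rewrite (_ : c i = \sum_j ((fun q => theta r' z' (t q) 0 j) * (fun=> S j i))).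
    apply: Cinfty_sum => j _; apply: CinftyM; [exact: theta_smooth Ht Hz' | exact: Cinfty_cst].
  by apply/funext => q; rewrite fct_sumE /c mxE.
have Hu : along G (fun q => \sum_i c i q *: b_value (e i) (G q)).
  by apply: along_sum => // i; apply: along_field => //; exact: He.1.
exists (fun q => \sum_i c i q *: b_value (e i) (G q)) => //.
have N1 := smooth_map_continuous CG FE.
have N2 := smooth_map_continuous CG He.2.
have CFG := smooth_map_continuous (smooth_map_comp CG (interior_b_map_smooth HF)).
have N3 := CFG _ _ He'.2.
near=> q; set u := \sum_i _.
have uq : b_derivation (G q) u by have [H _ _] := Hu; exact: H.
have tq : b_derivation (F (G q)) (t q) by have [H _ _] := Ht; exact: H.
have [thE _] : (forall i, theta r z (b_value (e i) (G q)) = delta_mx 0 i) /\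
    forall v, b_derivation (G q) v -> theta r z v = 0 -> v = 0 by near: q.
have [_ inj] : (forall i, theta r' z' (b_value (e' i) (F (G q))) = delta_mx 0 i) /\
    forall v, b_derivation (F (G q)) v -> theta r' z' v = 0 -> v = 0 by near: q.
have FEq : forall v, b_derivation (G q) v ->
        theta r' z' (b_differential F v) = theta r z v *m B by near: q.
apply/eqP; rewrite -subr_eq0 addrC -scaleN1r; apply/eqP; apply: inj.
  by apply: b_derivation_lin => //; exact: b_differential_derivation.
rewrite theta_lin scaleN1r FEq// /u theta_sum.
rewrite (eq_bigr (fun i => c i q *: delta_mx 0 i)); last by move=> i _; rewrite thE.
by rewrite -row_sum_delta -mulmxA SB mulmx1 addNr.
Unshelve. all: by end_near. Qed.

Lemma smooth_map_id M : smooth_map (id : M -> M). Proof. by []. Qed.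

Lemma b_fibration_surj M N (F : M -> N) (m : M) w : interior_b_map F -> b_fibration F ->
  b_derivation (F m) w -> exists2 v, b_derivation m v & b_differential F v = w.
Proof.
move=> HF bF /bTE[V bV ->].
have Ht := along_field (interior_b_map_smooth HF) bV.
have [u [Hu _ _] E] := @b_fibration_lift M N M F id _ m HF bF (@smooth_map_id M) Ht.
by exists (u m); [exact: Hu | exact: (nbhs_singleton E)].
Qed.

(** A count of dimensions: the null spaces of [F_*] and [K_*] have equal dimension, and the image
    under [G_*] of the first contains the second, so [G_*] is injective on the first. The truncated
    subtraction in the hypothesis is the rank of a kernel as given by [mxrank_ker]. *)
Lemma b_fibration_null_injective M N P Q (F : M -> N) (G : M -> P) (K : P -> Q) (p : M) :
  interior_b_map F -> b_fibration F -> interior_b_map G -> interior_b_map K -> b_fibration K ->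
  (mdim M - mdim N = mdim P - mdim Q)%N ->
  (forall w, b_derivation (G p) w -> b_differential K w = 0 ->
     exists v, [/\ b_derivation p v, b_differential F v = 0 & b_differential G v = w]) ->
  forall v, b_derivation p v -> b_differential F v = 0 -> b_differential G v = 0 -> v = 0.
Proof.
move=> HF bF HG HK bK dimE surj.
have [r [z [e [r' [phi' [z' [e' [B [S [He [Hz' He'] SB FE]]]]]]]]]] := b_fibration_matrix p HF bF.
have [s [x [f [s' [chi' [x' [f' [C [T [Hf [Hx' Hf'] TC KE]]]]]]]]]] := b_fibration_matrix (G p) HK bK.
have {}FE := nbhs_singleton FE; have {}KE := nbhs_singleton KE.
have [thE inj] := nbhs_singleton He.2; have [thE' inj'] := nbhs_singleton He'.2.
have [thF injF] := nbhs_singleton Hf.2; have [thF' injF'] := nbhs_singleton Hf'.2.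
have expand := nbhs_singleton (frame_expand He).
pose Gm : 'M[R]_(mdim M, mdim P) := \matrix_i theta s x (b_differential G (b_value (e i) p)).
have GE v : b_derivation p v -> theta s x (b_differential G v) = theta r z v *m Gm.
  move=> vp; rewrite {1}(expand v vp) mulmx_sum_row.
  have -> : b_differential G (\sum_i theta r z v 0 i *: b_value (e i) p) =
      \sum_i theta r z v 0 i *: b_differential G (b_value (e i) p).
    elim: (index_enum _) => [|i l IH]; first by rewrite !big_nil b_differential0.
    by rewrite !big_cons b_differential_lin IH.
  by rewrite theta_sum; apply: eq_bigr => i _; rewrite rowK.
have rB : \rank B = mdim N.
  by apply/eqP; apply/row_fullP; exists S.
have rC : \rank C = mdim Q.
  by apply/eqP; apply/row_fullP; exists T.
have sub : (kermx C <= kermx B *m Gm)%MS.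
  apply/row_subP => i; set w := row i _.
  have wC : w *m C = 0 by apply/sub_kermxP; exact: row_sub.
  pose W := \sum_j w 0 j *: b_value (f j) (G p).
  have Wd : b_derivation (G p) W.
    by apply: b_derivation_sum => j; apply: b_value_derivation; exact: Hf.1.
  have thW : theta s x W = w.
    rewrite /W theta_sum (eq_bigr (fun j => w 0 j *: delta_mx 0 j)) -?row_sum_delta//.
    by move=> j _; rewrite thF.
  have KW : b_differential K W = 0.
    by apply: injF'; [exact: b_differential_derivation | rewrite KE// thW].
  have [v [vp Fv Gv]] := surj W Wd KW.
  rewrite -thW -Gv GE//; apply: submxMr; apply/sub_kermxP.
  by rewrite -FE// Fv; apply/rowP => j; rewrite !mxE; case: ifP.
have cap0 : (kermx B :&: kermx Gm)%MS = 0.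
  apply/eqP; rewrite -mxrank_eq0 -(eqn_add2l (\rank (kermx B *m Gm))) mxrank_mul_ker addn0.
  rewrite eqn_leq -{2}(mxrank_mul_ker (kermx B) Gm) leq_addr andbT.
  by apply: leq_trans (mxrankS sub); rewrite !mxrank_ker rB rC dimE.
move=> v vp Fv Gv; apply: inj => //; apply/eqP; rewrite -submx0 -cap0 sub_capmx.
apply/andP; split; apply/sub_kermxP.
  by rewrite -FE// Fv; apply/rowP => j; rewrite !mxE; case: ifP.
by rewrite -GE// Gv; apply/rowP => j; rewrite !mxE; case: ifP.
Qed.

End BFibrations.

(** * Commutators of b-fields: naturality under related maps and the Jacobi identity *)

Section RelatedFields.
Context {R : realType}.
Implicit Types M N : manifold_with_corners R.

Lemma b_fieldD M (V : (M -> R) -> M -> R) f g : b_field V -> Cinfty M f -> Cinfty M g ->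
  V (f + g) = V f + V g.
Proof. by move=> [_ VL _ _] Cf Cg; rewrite -[f in LHS]scale1r VL// scale1r. Qed.

Lemma b_fieldB M (V : (M -> R) -> M -> R) f g : b_field V -> Cinfty M f -> Cinfty M g ->
  V (f - g) = V f - V g.
Proof.
by move=> [_ VL _ _] Cf Cg; rewrite addrC -scaleN1r VL// scaleN1r addrC.
Qed.

Definition commutator M (V W : (M -> R) -> M -> R) : (M -> R) -> M -> R :=
  fun f => V (W f) - W (V f).

Lemma b_field_commutator M (V W : (M -> R) -> M -> R) :
  b_field V -> b_field W -> b_field (commutator V W).
Proof.
move=> bV bW; have [V1 V2 V3 V4] := bV; have [W1 W2 W3 W4] := bW; split.
- by move=> f Cf; apply: CinftyB; [apply/V1/W1|apply/W1/V1].
- move=> c f g Cf Cg; rewrite /commutator (W2 c f g Cf Cg) (V2 c _ _ (W1 _ Cf) (W1 _ Cg)).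
  by rewrite (V2 c f g Cf Cg) (W2 c _ _ (V1 _ Cf) (V1 _ Cg)) scalerBr opprD addrACA.
- move=> f g Cf Cg; rewrite /commutator W3// V3//.
  have CVf := V1 _ Cf; have CVg := V1 _ Cg; have CWf := W1 _ Cf; have CWg := W1 _ Cg.
  rewrite (b_fieldD bV) ?(b_fieldD bW); try exact: CinftyM.
  rewrite !V3// !W3//; apply/funext => q.
  rewrite -[LHS]/(f q * V (W g) q + W g q * V f q + (g q * V (W f) q + W f q * V g q)
     - (f q * W (V g) q + V g q * W f q + (g q * W (V f) q + V f q * W g q))).
  rewrite -[RHS]/(f q * (V (W g) q - W (V g) q) + g q * (V (W f) q - W (V f) q)).
  move: (V (W g) q) (W (V g) q) (V (W f) q) (W (V f) q) (V f q) (V g q) (W f q) (W g q).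
  by move=> *; ring.
- move=> H f bH Cf f0 p Hp; rewrite /commutator -[LHS]/(V (W f) p - W (V f) p).
  by rewrite (V4 H (W f) bH (W1 _ Cf))// ?(W4 H (V f) bH (V1 _ Cf)) ?subrr// => p' Hp';
    [exact: (V4 H f bH) | exact: (W4 H f bH)].
Qed.

(** Expanding [V (W g)] and [W (V g)] with the logarithmic derivatives, the two products
    [dlog V g * dlog W g * g] cancel. *)
Lemma dlog_commutator M (V W : (M -> R) -> M -> R) g : b_field V -> b_field W -> b_function g ->
  dlog (commutator V W) g = V (dlog W g) - W (dlog V g).
Proof.
move=> bV bW bg; have [CV VE] := dlogP bV bg; have [CW WE] := dlogP bW bg.
have Cg := b_function_smooth bg.
apply: dlogE => //; first exact: b_field_commutator.
  by apply: CinftyB; exact: b_field_smooth.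
have VEf : V g = dlog V g * g by apply/funext.
have WEf : W g = dlog W g * g by apply/funext.
move=> q; rewrite /commutator VEf WEf.
have [_ _ V3 _] := bV; have [_ _ W3 _] := bW.
rewrite V3// W3// {1}VEf {1}WEf.
rewrite -[LHS]/(dlog W g q * (dlog V g q * g q) + g q * V (dlog W g) q
  - (dlog V g q * (dlog W g q * g q) + g q * W (dlog V g) q)).
rewrite -[RHS]/((V (dlog W g) q - W (dlog V g) q) * g q).
move: (V (dlog W g) q) (W (dlog V g) q) (dlog V g q) (dlog W g q) => *; ring.
Qed.

(** The relation is assumed near [p] since a commutator differentiates the coefficients once. Both
    kinds of pairings are compared, the logarithmic ones through [dlog_commutator]. *)
Lemma related_commutator M N (F : M -> N) (V W : (M -> R) -> M -> R) (X Y : (N -> R) -> N -> R) p :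
  interior_b_map F -> b_field V -> b_field W -> b_field X -> b_field Y ->
  (\forall q \near p, b_differential F (b_value V q) = b_value X (F q)) ->
  (\forall q \near p, b_differential F (b_value W q) = b_value Y (F q)) ->
  b_differential F (b_value (commutator V W) p) = b_value (commutator X Y) (F p).
Proof.
move=> HF bV bW bX bY VX WY; have CF := interior_b_map_smooth HF.
have bVW := b_field_commutator bV bW; have bXY := b_field_commutator bX bY.
have rel1 (A : (M -> R) -> M -> R) (B : (N -> R) -> N -> R) f : b_field A -> b_field B -> Cinfty N f ->
    (\forall q \near p, b_differential F (b_value A q) = b_value B (F q)) ->
    \forall q \near p, A (f \o F) q = B f (F q).
  move=> bA bB Cf; apply: filterS => q /(congr1 (fun v => v.1 f)).
  by rewrite b_differential1// !b_value1//; exact: CF.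
have rel2 (A : (M -> R) -> M -> R) (B : (N -> R) -> N -> R) g : b_field A -> b_field B -> b_function g ->
    (\forall q \near p, b_differential F (b_value A q) = b_value B (F q)) ->
    \forall q \near p, dlog A (g \o F) q = dlog B g (F q).
  move=> bA bB bg; apply: filterS => q /(congr1 (fun v => v.2 g)).
  by rewrite b_differential2// !b_value2//; exact: b_function_comp.
have step (A : (M -> R) -> M -> R) (B : (N -> R) -> N -> R) u w : b_field A -> b_field B ->
    Cinfty M u -> Cinfty N w -> (\forall q \near p, u q = w (F q)) ->
    (\forall q \near p, b_differential F (b_value A q) = b_value B (F q)) ->
    A u p = B w (F p).
  move=> bA bB Cu Cw uw AB.
  have := pd_near (b_field_pd p bA) Cu (CF _ Cw) uw => ->.
  exact: (nbhs_singleton (rel1 _ _ _ bA bB Cw AB)).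
apply: bvec_eq => f.
  have [Cf|nCf] := pselect (Cinfty N f); last by rewrite /b_differential /b_value /= !(asboolF nCf).
  have CfF : Cinfty M (f \o F) by exact: CF.
  rewrite b_differential1// !b_value1//.
  rewrite -[LHS]/(V (W (f \o F)) p - W (V (f \o F)) p) -[RHS]/(X (Y f) (F p) - Y (X f) (F p)).
  congr (_ - _); (apply: step => //; [exact: b_field_smooth|exact: b_field_smooth|exact: rel1]).
have [bf|nbf] := pselect (b_function f); last by rewrite /b_differential /b_value /= !(asboolF nbf).
have bfF := b_function_comp HF bf.
rewrite b_differential2// !b_value2// !dlog_commutator//.
rewrite -[LHS]/(V (dlog W (f \o F)) p - W (dlog V (f \o F)) p).
rewrite -[RHS]/(X (dlog Y f) (F p) - Y (dlog X f) (F p)).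
by congr (_ - _); (apply: step => //; [exact: (dlogP _ _).1|exact: (dlogP _ _).1|exact: rel2]).
Qed.

Lemma commutator_related0 M N (F : M -> N) (V W : (M -> R) -> M -> R) p :
  interior_b_map F -> b_field V -> b_field W ->
  (\forall q \near p, b_differential F (b_value V q) = 0) ->
  (\forall q \near p, b_differential F (b_value W q) = 0) ->
  b_differential F (b_value (commutator V W) p) = 0.
Proof.
move=> HF bV bW V0 W0.
rewrite (@related_commutator M N F V W (fun=> 0) (fun=> 0)) //; try exact: b_field0.
- rewrite -[RHS](b_value0 (F p)); congr (b_value _ _).
  by apply/funext => f; rewrite /commutator subrr.
- by apply: filterS V0 => q ->; rewrite b_value0.
- by apply: filterS W0 => q ->; rewrite b_value0.
Qed.

Lemma jacobi_commutator M (U V W : (M -> R) -> M -> R) p : b_field U -> b_field V -> b_field W ->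
  b_value (commutator U (commutator V W)) p + b_value (commutator V (commutator W U)) p
  + b_value (commutator W (commutator U V)) p = 0.
Proof.
move=> bU bV bW; have bc := b_field_commutator.
pose A := commutator U (commutator V W); pose B := commutator V (commutator W U).
pose C := commutator W (commutator U V).
have bA : b_field A by apply/bc => //; exact: bc.
have bB : b_field B by apply/bc => //; exact: bc.
have bC : b_field C by apply/bc => //; exact: bc.
have add (X Y : (M -> R) -> M -> R) : b_field X -> b_field Y ->
    b_field (fun f => (fun=> 1) * X f + Y f) /\
    b_value (fun f => (fun=> 1) * X f + Y f) p = b_value X p + b_value Y p.
  move=> bX bY; split; first by apply: b_field_lin => //; exact: Cinfty_cst.
  by rewrite b_value_lin ?scale1r//; exact: Cinfty_cst.
have [bAB AB] := add A B bA bB.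
have [bABC ABC] := add _ C bAB bC.
rewrite -/A -/B -/C -AB -ABC; set S := (fun f => _).
have S0 f : Cinfty M f -> S f = 0.
  move=> Cf; apply/funext => q; rewrite -[LHS]/(1 * (1 * A f q + B f q) + C f q).
  have CU g : Cinfty M g -> Cinfty M (U g) by exact: b_field_smooth.
  have CV g : Cinfty M g -> Cinfty M (V g) by exact: b_field_smooth.
  have CW g : Cinfty M g -> Cinfty M (W g) by exact: b_field_smooth.
  rewrite /A /B /C /commutator.
  rewrite !(b_fieldB bU) ?(b_fieldB bV) ?(b_fieldB bW); try by [apply/CU/CV|apply/CU/CW|apply/CV/CU|apply/CV/CW|apply/CW/CU|apply/CW/CV].
  rewrite -[LHS]/(1 * (1 * (U (V (W f)) q - U (W (V f)) q - (V (W (U f)) q - W (V (U f)) q))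
    + (V (W (U f)) q - V (U (W f)) q - (W (U (V f)) q - U (W (V f)) q)))
    + (W (U (V f)) q - W (V (U f)) q - (U (V (W f)) q - V (U (W f)) q))).
  move: (U (V (W f)) q) (U (W (V f)) q) (V (W (U f)) q) (W (V (U f)) q) (V (U (W f)) q) (W (U (V f)) q).
  by move=> *; rewrite -[RHS]/(0 : R); ring.
apply: bvec_eq => f; rewrite -[RHS]/(0 : R) /b_value /=; case: asboolP => // Hf.
  by rewrite S0.
rewrite (dlogE (h := fun=> 0))//; first exact: Cinfty_cst.
by move=> q; rewrite S0 ?mul0r//; exact: b_function_smooth.
Qed.

End RelatedFields.

(** * The bracket *)


Section RelativeLift.
Context {R : realType}.
Implicit Types P A B Q : manifold_with_corners R.

Lemma along_pullbackP P A (G : P -> A) t : smooth_map G ->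
  smooth_pullback_section G t <-> along G t.
Proof.
move=> CG; split=> [|Ht q0]; first exact: along_pullback_section.
have [r [phi H]] := mwc_coordinates (G q0).
have [z [e [Hz He]]] := frame_exists H.
exists (mdim A), (fun j q => theta r z (t q) 0 j), e; split.
- by move=> j; exact: theta_smooth Ht Hz.
- exact: He.1.
- have N : \forall q \near q0, forall v, b_derivation (G q) v ->
      v = \sum_i theta r z v 0 i *: b_value (e i) (G q).
    exact: smooth_map_continuous CG _ _ (frame_expand He).
  by apply: filterS N => q Hq; apply: Hq; case: Ht.
Qed.

(* [u - G_* K_* u] is killed by [K_*], and [F_*] does not see the correction
   as [F G K = d e F]. *)
Lemma lift_correction P A B Q (G : P -> A) (K : A -> P) (F : A -> B) (e : B -> Q) (d : Q -> B) q u :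
  interior_b_map G -> interior_b_map K -> interior_b_map F -> interior_b_map e ->
  interior_b_map d -> K \o G = id -> F \o G \o K = d \o e \o F ->
  b_derivation (G q) u -> b_differential e (b_differential F u) = 0 ->
  [/\ b_derivation (G q) (u - b_differential G (b_differential K u)),
      b_differential K (u - b_differential G (b_differential K u)) = 0
    & b_differential F (u - b_differential G (b_differential K u)) = b_differential F u].
Proof.
move=> HG HK HF He Hd KG FGK uq eF.
have KGq : K (G q) = q by rewrite -[LHS]/((K \o G) q) KG.
have Kq := b_differential_derivation HK uq.
split.
- rewrite addrC -scaleN1r; apply: b_derivation_lin => //.
  by rewrite -{1}KGq; exact: b_differential_derivation.
- by rewrite b_differentialB -b_differential_comp// KG (b_differential_id Kq) subrr.
- rewrite b_differentialB -[b_differential F (b_differential G _)]b_differential_comp//.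
  have -> : b_differential (F \o G) (b_differential K u) = 0; last by rewrite subr0.
  rewrite b_differential_comp// -(b_differential_comp K)// -b_differential_comp// compA FGK.
  by rewrite -compA b_differential_comp// b_differential_comp// eF b_differential0.
Qed.

(** It is used twice with [e = PiR] and [d = diag]: for [G = s], [K = PiF], [F = PiS], which gives
    the lift of a section, and for [G = sig], [K = Pi234], [F = Pi12], which gives its analogue on
    [M[4]]. *)
Lemma relative_lift P A B Q (G : P -> A) (K : A -> P) (F : A -> B) (e : B -> Q) (d : Q -> B) t (q0 : P) :
  interior_b_map G -> interior_b_map K -> interior_b_map F -> interior_b_map e ->
  interior_b_map d -> b_fibration F -> K \o G = id -> F \o G \o K = d \o e \o F ->
  along (F \o G) t -> (forall q, b_differential e (t q) = 0) ->
  exists2 u, along G u &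
    \forall q \near q0, b_differential K (u q) = 0 /\ b_differential F (u q) = t q.
Proof.
move=> HG HK HF He Hd bF KG FGK Ht t0.
have [u Hu uE] := b_fibration_lift q0 HF bF (interior_b_map_smooth HG) Ht.
exists (fun q => -1 *: b_differential G (b_differential K (u q)) + u q).
  apply: along_lin => //; first exact: Cinfty_cst.
  have := along_push (along_push Hu HK) HG; rewrite (_ : G \o (K \o G) = G)//.
  by rewrite KG.
apply: filterS uE => q uq; rewrite scaleN1r addrC.
have [Hq _ _] := Hu.
have [|_ -> ->] := lift_correction HG HK HF He Hd KG FGK (Hq q) => //.
by rewrite uq t0.
Qed.

Lemma b_differential_square A B B' Q (F : A -> B) (G : B -> Q) (F' : A -> B') (G' : B' -> Q) v :
  interior_b_map G -> interior_b_map G' -> G \o F = G' \o F' ->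
  b_differential G (b_differential F v) = b_differential G' (b_differential F' v).
Proof. by move=> HG HG' E; rewrite -!b_differential_comp// E. Qed.

End RelativeLift.

Section Commutators.
Context {R : realType} {M : manifold_with_corners R}.
Implicit Types A B C : (M -> R) -> M -> R.

Lemma b_value_ext A B p : (forall f, Cinfty M f -> A f = B f) -> b_value A p = b_value B p.
Proof.
move=> AB; apply: bvec_eq => f; rewrite /b_value /=; case: asboolP => // Hf; first by rewrite AB.
by rewrite /dlog AB//; exact: b_function_smooth.
Qed.

Lemma commutator_linr A B C F p : b_field A -> b_field B -> b_field C -> Cinfty M F ->
  b_value (commutator A (fun f => F * B f + C f)) p =
  F p *: b_value (commutator A B) p + A F p *: b_value B p + b_value (commutator A C) p.
Proof.
move=> bA bB bC CF; have CAF := b_field_smooth bA CF.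
have bAB := b_field_commutator bA bB; have bAC := b_field_commutator bA bC.
have bBC := b_field_lin bB bAC CAF.
rewrite -addrA -(b_value_lin p bB bAC CAF) -(b_value_lin p bAB bBC CF).
apply: b_value_ext => f Cf; rewrite /commutator.
have CBf := b_field_smooth bB Cf; have CCf := b_field_smooth bC Cf.
rewrite (b_fieldD bA (CinftyM CF CBf) CCf); have [_ _ AM _] := bA; rewrite AM//.
apply/funext => q.
rewrite -[LHS]/(F q * A (B f) q + B f q * A F q + A (C f) q - (F q * B (A f) q + C (A f) q)).
rewrite -[RHS]/(F q * (A (B f) q - B (A f) q) + (A F q * B f q + (A (C f) q - C (A f) q))).
move: (F q) (A (B f) q) (B f q) (A F q) (A (C f) q) (B (A f) q) (C (A f) q) => *; ring.
Qed.

Lemma commutator_antisym A B p : b_field A -> b_field B ->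
  b_value (commutator A B) p = - b_value (commutator B A) p.
Proof.
move=> bA bB; have bc := b_field_commutator bB bA.
have := @b_value_lin R M _ _ (fun=> -1) p bc b_field0 (Cinfty_cst _).
rewrite b_value0 addr0 scaleN1r => <-; apply: b_value_ext => f _; apply/funext => q.
rewrite -[LHS]/(A (B f) q - B (A f) q) -[RHS]/(-1 * (B (A f) q - A (B f) q) + 0).
by rewrite addr0 mulN1r opprB.
Qed.

End Commutators.

(** * The extension of sections, its compatibility with commutators, and the algebroid axioms *)

Section Bracket.
Context {R : realType} (M : generalized_product R).
Implicit Types V W : M 0%N -> bvec (M 1%N).

Lemma gp_map_comp l m n (I : 'I_n.+1 -> 'I_m.+1) (K : 'I_m.+1 -> 'I_l.+1) (L : 'I_n.+1 -> 'I_l.+1) :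
  (forall i, K (I i) = L i) -> gp_map M I \o gp_map M K = gp_map M L.
Proof.
move=> KI; apply/funext => p /=; rewrite -gp_comp; congr (gp_map M _ p).
exact/funext.
Qed.

Lemma gp_map_cancel m n (I : 'I_n.+1 -> 'I_m.+1) (K : 'I_m.+1 -> 'I_n.+1) :
  cancel I K -> gp_map M I \o gp_map M K = id.
Proof.
by move=> IK; rewrite (@gp_map_comp _ _ _ I K id)//; apply/funext => p; exact: gp_id.
Qed.

Lemma gp_map_comp2 l m m' n (I : 'I_n.+1 -> 'I_m.+1) (K : 'I_m.+1 -> 'I_l.+1)
    (I' : 'I_n.+1 -> 'I_m'.+1) (K' : 'I_m'.+1 -> 'I_l.+1) :
  (forall i, K (I i) = K' (I' i)) ->
  gp_map M I \o gp_map M K = gp_map M I' \o gp_map M K'.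
Proof. by move=> H; rewrite (gp_map_comp H) (@gp_map_comp _ _ _ I' K' (K' \o I')). Qed.

Lemma gp_b_fibration_lift n (h : 'I_n.+2) : b_fibration (gp_map M (lift h)).
Proof. exact/gp_b_fibration/lift_inj. Qed.

(** The identities below can be read on the model [M[k] = X^k], where [gp_map] acts by reindexing:
    [s] is [(x, y) -> (x, x, y)], [t] is [(x, y) -> (x, y, y)], and [PiS], [PiC], [PiF] send
    [(x, y, z)] to [(x, y)], [(x, z)], [(y, z)]. *)
Let s : M 1%N -> M 2%N :=
  gp_map M (fun i : 'I_3 => if i == ord_max then ord_max else ord0 : 'I_2).
Let t : M 1%N -> M 2%N :=
  gp_map M (fun i : 'I_3 => if i == ord0 then ord0 else ord_max : 'I_2).
Local Notation PiL := (@PiL R M).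
Local Notation PiR := (@PiR R M).
Local Notation PiS := (@PiS R M).
Local Notation PiC := (@PiC R M).
Local Notation PiF := (@PiF R M).
Local Notation diag := (@diag R M).

Local Ltac index := by case=> [[|[|[|[|]]]] ?] //=; apply/val_inj.

Let sF : PiF \o s = id. Proof. apply: gp_map_cancel; index. Qed.
Let sC : PiC \o s = id. Proof. apply: gp_map_cancel; index. Qed.
Let sS : PiS \o s = diag \o PiL. Proof. apply: gp_map_comp2; index. Qed.
Let tC : PiC \o t = id. Proof. apply: gp_map_cancel; index. Qed.
Let tS : PiS \o t = id. Proof. apply: gp_map_cancel; index. Qed.
Let tF : PiF \o t = diag \o PiR. Proof. apply: gp_map_comp2; index. Qed.
Let Ld : PiL \o diag = id. Proof. apply: gp_map_cancel; index. Qed.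
Let st : s \o diag = t \o diag. Proof. apply: gp_map_comp2; index. Qed.
Let RS : PiR \o PiS = PiL \o PiF. Proof. apply: gp_map_comp2; index. Qed.
Let RC : PiR \o PiC = PiR \o PiF. Proof. apply: gp_map_comp2; index. Qed.
Let LC : PiL \o PiC = PiL \o PiS. Proof. apply: gp_map_comp2; index. Qed.
Let sSF : PiS \o s \o PiF = diag \o PiR \o PiS.
Proof.
apply: (etrans (congr1 (fun g => g \o PiF) sS)).
exact: (congr1 (fun g => diag \o g) (esym RS)).
Qed.

Let bs : interior_b_map s. Proof. exact: gp_b_map. Qed.
Let bt : interior_b_map t. Proof. exact: gp_b_map. Qed.
Let bL : interior_b_map PiL. Proof. exact: gp_b_map. Qed.
Let bR : interior_b_map PiR. Proof. exact: gp_b_map. Qed.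
Let bS : interior_b_map PiS. Proof. exact: gp_b_map. Qed.
Let bC : interior_b_map PiC. Proof. exact: gp_b_map. Qed.
Let bF : interior_b_map PiF. Proof. exact: gp_b_map. Qed.
Let bd : interior_b_map diag. Proof. exact: gp_b_map. Qed.
Let fS : b_fibration PiS. Proof. exact: gp_b_fibration_lift. Qed.
Let fF : b_fibration PiF. Proof. exact: gp_b_fibration_lift. Qed.
Let fR : b_fibration PiR.
Proof. by apply: gp_b_fibration => i j _; rewrite [i]ord1 [j]ord1. Qed.

Lemma EsectionsP V : Esections V <->
  along diag V /\ forall m, b_differential PiR (V m) = 0.
Proof.
have Hd := along_pullbackP V (interior_b_map_smooth bd).
split=> [[/Hd aV EV]|[aV V0]]; first by split=> // m; case: (EV m).
split; first exact/Hd.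
by move=> m; split => //; apply/bTE; case: aV.
Qed.

(** Surjectivity of [PiS_*] from the null space of [PiF_*] onto that of [PiR_*] comes from
    [lift_correction], which is available at the points [s q]. *)
Let lift_unique q v v' : b_derivation (s q) v -> b_derivation (s q) v' ->
  b_differential PiF v = b_differential PiF v' ->
  b_differential PiS v = b_differential PiS v' -> v = v'.
Proof.
move=> Hv Hv' vF vS; apply/eqP; rewrite -subr_eq0; apply/eqP.
(* Both sides are the increment [gp_kappa] of the affine dimension formula; the additive form [E] is
   proved first, over the integers. *)
have dimE : (mdim (M 2%N) - mdim (M 1%N) = mdim (M 1%N) - mdim (M 0%N))%N.
  have := gp_dim M 0; have := gp_dim M 1; have := gp_dim M 2.
  rewrite mul0r addr0 mul1r => E2 E1 E0.
  have E : (mdim (M 2%N) + mdim (M 0%N) = mdim (M 1%N) + mdim (M 1%N))%N.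
    apply/eqP; rewrite -eqz_nat !PoszD E2 E1 E0; apply/eqP; ring.
  by lia.
apply: (b_fibration_null_injective bF fF bS bR fR dimE (p := s q)).
- move=> w Hw w0; have [u Hu uE] := b_fibration_surj bS fS Hw.
  have [|H1 H2 H3] := lift_correction bs bF bS bR bd sF sSF Hu; first by rewrite uE.
  by eexists; split; [exact: H1|exact: H2|rewrite H3].
- by rewrite addrC -scaleN1r; exact: b_derivation_lin.
- by rewrite b_differentialB vF subrr.
- by rewrite b_differentialB vS subrr.
Qed.

(** At [p = (x, x, y)] the base point [PiL (PiF p)] is [x], the point whose image under [diag] is
    [PiS p]. *)
Let lifts V p : set (bvec (M 2%N)) :=
  [set w | [/\ b_derivation p w, b_differential PiF w = 0
             & b_differential PiS w = V (PiL (PiF p))]].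

Let lifted V p := xget 0 (lifts V p).

Let sFq q : PiF (s q) = q. Proof. by rewrite -[LHS]/((PiF \o s) q) sF. Qed.
Let sCq q : PiC (s q) = q. Proof. by rewrite -[LHS]/((PiC \o s) q) sC. Qed.

Let lifts_unique V q w w' : lifts V (s q) w -> lifts V (s q) w' -> w = w'.
Proof.
by move=> [w1 w2 w3] [w'1 w'2 w'3]; apply: (lift_unique w1) => //; rewrite ?w2 ?w3.
Qed.

Let lifted_eq V q w : lifts V (s q) w -> lifted V (s q) = w.
Proof. move=> Hw; apply: (lifts_unique (V := V) _ Hw).
by rewrite /lifted; case: xgetP => [w' _ //|/(_ w)]. Qed.

(** Smooth lifts exist locally by [relative_lift]; pointwise uniqueness makes them agree with
    [lifted V], which is therefore smooth. *)
Let lifted_along V : Esections V ->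
  along s (lifted V \o s) /\ forall q, lifts V (s q) (lifted V (s q)).
Proof.
move=> /EsectionsP[aV V0].
have aVL : along (PiS \o s) (V \o PiL).
  by rewrite sS; apply: along_pre => //; exact: interior_b_map_smooth.
have H (q0 : M 1%N) : exists2 u, along s u & \forall q \near q0, lifts V (s q) (u q).
  have [u Hu uE] := relative_lift q0 bs bF bS bR bd fS sF sSF aVL (fun q => V0 (PiL q)).
  exists u => //; apply: filterS uE => q [uF uS]; split; rewrite ?sFq//.
  by case: Hu.
split=> [|q].
  apply: along_near => q0; have [u Hu uE] := H q0; exists u => //.
  by apply: filterS uE => q /lifted_eq.
by have [u _ /nbhs_singleton uq] := H q; rewrite (lifted_eq uq).
Qed.

Let D12P p : D12 p <-> exists q, p = s q.
Proof. by split=> [[q _ <-]|[q ->]]; exists q. Qed.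

(** Smoothness over [D12] requires local extensions to fields on [M[3]]. They come from
    [along_extend], as [PiF] is a retraction for [s]. *)
Let lifted_is_lift V : Esections V -> is_lift V (lifted V).
Proof.
move=> EV; have [aw Hw] := lifted_along EV; split=> [_ /D12P[q ->]|_ /D12P[q ->]|_ m /D12P[q ->]].
- have [X bX XE] := along_extend q (interior_b_map_smooth bs) (interior_b_map_smooth bF) sFq aw.
  by exists X => //; apply: filterS XE => p H /D12P[q' E]; rewrite -(H q' E) E.
- by have [H1 H2 _] := Hw q; split => //; exact/bTE.
- have [_ _ ->] := Hw q; rewrite sFq -[PiS (s q)]/((PiS \o s) q) sS => /(congr1 PiL) /=.
  by rewrite -[LHS]/((PiL \o diag) m) -[RHS]/((PiL \o diag) (PiL q)) Ld => ->.
Qed.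

Let is_lift_lifted V X q : is_lift V X -> X (s q) = lifted V (s q).
Proof.
move=> [_ H1 H2]; apply/esym/lifted_eq; have Dq : D12 (s q) by apply/D12P; exists q.
have [/bTE H3 H4] := H1 _ Dq; split => //; rewrite sFq; apply: H2 => //.
by rewrite -[RHS]/((PiS \o s) q) sS.
Qed.

Let tildeE V q : Esections V -> tilde V q = b_differential PiC (lifted V (s q)).
Proof.
move=> EV; rewrite /tilde; case: xgetP => [Vt _ [W HW /(_ (s q))]|].
  by rewrite sCq (is_lift_lifted q HW); apply; apply/D12P; exists q.
move=> /(_ (fun q => b_differential PiC (lifted V (s q))))[].
exists (lifted V); first exact: lifted_is_lift.
by move=> _ /D12P[q' ->]; rewrite sCq.
Qed.

Let tilde_along V : Esections V -> along id (tilde V).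
Proof.
move=> EV; have [aw _] := lifted_along EV.
have := along_push aw bC; rewrite sC; congr along.
by apply/funext => q; rewrite tildeE.
Qed.

Let tilde_null V q : Esections V -> b_differential PiR (tilde V q) = 0.
Proof.
move=> EV; have [_ /(_ q)[_ wF _]] := lifted_along EV.
by rewrite tildeE// -b_differential_comp// RC b_differential_comp// wF b_differential0.
Qed.

(** From [PiL \o PiC = PiL \o PiS] it follows that the extension of [V] is related by [PiL] to the
    vector field that is the anchor of [V]. This makes the anchor a morphism of brackets. *)
Let tilde_anchor V q : Esections V ->
  b_differential PiL (tilde V q) = b_differential PiL (V (PiL q)).
Proof.
move=> EV; have [_ /(_ q)[_ _ wS]] := lifted_along EV.
by rewrite tildeE// -b_differential_comp// LC b_differential_comp// wS sFq.
Qed.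

(** Over the triple diagonal [s] and [t] agree, and the lift is [t_* (V m)]: it projects to [V m]
    under both [PiS] and [PiC], and [PiF \o t = diag \o PiR] shows that [PiF_*] kills it. *)
Let tilde_diag V m : Esections V -> tilde V (diag m) = V m.
Proof.
move=> EV; have /EsectionsP[[aV _ _] V0] := EV.
rewrite tildeE// (lifted_eq (w := b_differential t (V m))).
  by rewrite -b_differential_comp// tC (b_differential_id (aV m)).
have E : s (diag m) = t (diag m) by rewrite -[LHS]/((s \o diag) m) st.
split.
- by rewrite E; exact: b_differential_derivation.
- by rewrite -b_differential_comp// tF b_differential_comp// V0 b_differential0.
- rewrite -b_differential_comp// tS (b_differential_id (aV m)) sFq.
  by rewrite -[PiL (diag m)]/((PiL \o diag) m) Ld.
Qed.

Lemma tilde_well_definedP V : Esections V -> tilde_well_defined V.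
Proof.
move=> EV; split.
- by exists (lifted V); exact: lifted_is_lift.
- by move=> W W' HW HW' _ /D12P[q ->]; rewrite (is_lift_lifted q HW) (is_lift_lifted q HW').
- by move=> W HW _ /D12P[q ->]; rewrite sCq tildeE// (is_lift_lifted q HW).
- split; first exact/along_idP/tilde_along.
  move=> q; split; last exact: tilde_null.
  by apply/bTE; case: (tilde_along EV).
- by move=> m; exact: tilde_diag.
Qed.

Let tildeF V := section_apply (tilde V).

Let tildeF_field V : Esections V -> b_field (tildeF V).
Proof. by move=> /tilde_along/along_id[]. Qed.

Let tildeF_value V q : Esections V -> b_value (tildeF V) q = tilde V q.
Proof. by move=> /tilde_along/along_id[_ /(_ q)]. Qed.

Let Pi123 : M 3%N -> M 2%N := gp_map M (lift (ord_max : 'I_4)).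
Let Pi124 : M 3%N -> M 2%N := gp_map M (lift (Ordinal (isT : (2 < 4)%N))).
Let Pi134 : M 3%N -> M 2%N := gp_map M (lift (Ordinal (isT : (1 < 4)%N))).
Let Pi234 : M 3%N -> M 2%N := gp_map M (lift (ord0 : 'I_4)).
Let Pi12 : M 3%N -> M 1%N := gp_map M (lift (ord_max : 'I_4) \o lift (ord_max : 'I_3)).
Let sig : M 2%N -> M 3%N := gp_map M (fun i : 'I_4 => if i == ord_max then ord_max
  else if (i < 2)%N then ord0 else Ordinal (isT : (1 < 3)%N)).

(* [V~] extends to [M[3]] as a field which is tangent to the fibres of [PiF]
   and is related to [V~] by both [PiS] and [PiC]: it is the image under [Pi134]
   of the lift of [V] to the vectors on [M[4]] over the partial diagonal
   [x_1 = x_2] which are killed by [Pi234]. *)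
Let related_extension V (p0 : M 2%N) : Esections V -> exists2 A, b_field A &
  \forall p \near p0, [/\ b_differential PiF (b_value A p) = 0,
    b_differential PiS (b_value A p) = tilde V (PiS p)
  & b_differential PiC (b_value A p) = tilde V (PiC p)].
Proof.
move=> EV; have /EsectionsP[aV V0] := EV.
have b123 : interior_b_map Pi123 by exact: gp_b_map.
have b124 : interior_b_map Pi124 by exact: gp_b_map.
have b134 : interior_b_map Pi134 by exact: gp_b_map.
have b234 : interior_b_map Pi234 by exact: gp_b_map.
have b12 : interior_b_map Pi12 by exact: gp_b_map.
have bsig : interior_b_map sig by exact: gp_b_map.
have f12 : b_fibration Pi12 by apply: gp_b_fibration; apply: inj_comp; exact: lift_inj.
have sig234 : Pi234 \o sig = id by apply: gp_map_cancel; index.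
have sig134 : Pi134 \o sig = id by apply: gp_map_cancel; index.
have sig123 : Pi123 \o sig = s \o PiS by apply: gp_map_comp2; index.
have sig124 : Pi124 \o sig = s \o PiC by apply: gp_map_comp2; index.
have sig12 : Pi12 \o sig = diag \o (PiL \o PiS).
  have -> : PiL \o PiS = gp_map M (fun=> ord0) by apply: gp_map_comp; index.
  by apply: gp_map_comp2; index.
have sig12' : Pi12 \o sig \o Pi234 = diag \o PiR \o Pi12.
  have -> : Pi12 \o sig = gp_map M (fun=> ord0) by apply: gp_map_comp; index.
  have -> : diag \o PiR = gp_map M (fun=> ord_max) by apply: gp_map_comp; index.
  by apply: gp_map_comp2; index.
have F134 : PiF \o Pi134 = PiF \o Pi234 by apply: gp_map_comp2; index.
have S134 : PiS \o Pi134 = PiC \o Pi123 by apply: gp_map_comp2; index.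
have C134 : PiC \o Pi134 = PiC \o Pi124 by apply: gp_map_comp2; index.
have F123 : PiF \o Pi123 = PiS \o Pi234 by apply: gp_map_comp2; index.
have F124 : PiF \o Pi124 = PiC \o Pi234 by apply: gp_map_comp2; index.
have S123 : PiS \o Pi123 = Pi12 by apply: gp_map_comp; index.
have S124 : PiS \o Pi124 = Pi12 by apply: gp_map_comp; index.
(* The data to be lifted at [(x, x, y, z)] is the vector [V x] at [(x, x)]. *)
have aVS : along (Pi12 \o sig) (V \o (PiL \o PiS)).
  rewrite sig12; apply: along_pre => //.
  by apply: smooth_map_comp; exact: interior_b_map_smooth.
have [Z HZ ZE] := relative_lift p0 bsig b234 b12 bR bd f12 sig234 sig12' aVS
  (fun p => V0 (PiL (PiS p))).
have := along_push HZ b134; rewrite sig134 => /along_id[bA AE].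
eexists; first exact: bA.
apply: filterS ZE => p [Z234 Z12]; have [Zp _ _] := HZ.
rewrite -AE; split.
- apply: (etrans (b_differential_square _ bF bF F134)).
  by rewrite Z234; exact: b_differential0.
(* The image of [Z p] under [Pi123], at the point [s (PiS p)], has the two projections which
   characterize the lift of [V]; by uniqueness its image under [PiC] is [tilde V (PiS p)]. The case
   of [PiC] below is the same with [Pi124]. *)
- apply: (etrans (b_differential_square _ bS bC S134)).
  rewrite tildeE//; congr b_differential; apply/esym/lifted_eq; split.
  + rewrite -[s (PiS p)]/((s \o PiS) p) -sig123; exact: b_differential_derivation.
  + apply: (etrans (b_differential_square _ bF bS F123)).
    by rewrite Z234; exact: b_differential0.
  + by rewrite -b_differential_comp// S123 Z12 sFq.
- apply: (etrans (b_differential_square _ bC bC C134)).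
  rewrite tildeE//; congr b_differential; apply/esym/lifted_eq; split.
  + rewrite -[s (PiC p)]/((s \o PiC) p) -sig124; exact: b_differential_derivation.
  + apply: (etrans (b_differential_square _ bF bC F124)).
    by rewrite Z234; exact: b_differential0.
  + rewrite -b_differential_comp// S124 Z12 sFq /=.
    exact: (congr1 (fun g => V (g p)) (esym LC)).
Qed.

Let bracketE V W m : Ebracket V W m = b_value (commutator (tildeF V) (tildeF W)) (diag m).
Proof. by []. Qed.

Let bracket_section V W : Esections V -> Esections W -> Esections (Ebracket V W).
Proof.
move=> EV EW; have bV := tildeF_field EV; have bW := tildeF_field EW.
apply/EsectionsP; split.
  by apply: along_field; [exact: interior_b_map_smooth | exact: b_field_commutator].
move=> m; apply: commutator_related0 => //.
- by near=> q; rewrite tildeF_value//; exact: tilde_null.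
- by near=> q; rewrite tildeF_value//; exact: tilde_null.
Unshelve. all: by end_near. Qed.

(** At [s q], naturality under [PiF] and [PiS] shows that the commutator of the extensions [A] and
    [B] is the lift of the bracket; naturality under [PiC] computes its image. *)
Lemma tilde_bracket V W q : Esections V -> Esections W ->
  tilde (Ebracket V W) q = b_value (commutator (section_apply (tilde V)) (section_apply (tilde W))) q.
Proof.
move=> EV EW; have bV := tildeF_field EV; have bW := tildeF_field EW.
have [A bA AE] := related_extension (s q) EV.
have [B bB BE] := related_extension (s q) EW.
have bAB := b_field_commutator bA bB.
have rel : forall (F : M 2%N -> M 1%N), interior_b_map F ->
    (\forall p \near s q, b_differential F (b_value A p) = tilde V (F p)) ->
    (\forall p \near s q, b_differential F (b_value B p) = tilde W (F p)) ->
    b_differential F (b_value (commutator A B) (s q)) =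
    b_value (commutator (tildeF V) (tildeF W)) (F (s q)).
  move=> F HF FA FB; apply: related_commutator => //.
    by apply: filterS FA => p ->; rewrite tildeF_value.
  by apply: filterS FB => p ->; rewrite tildeF_value.
rewrite tildeE; last exact: bracket_section.
rewrite (lifted_eq (w := b_value (commutator A B) (s q))).
  by rewrite rel ?sCq//; [apply: filterS AE => p [] | apply: filterS BE => p []].
split; first exact: b_value_derivation.
- by apply: commutator_related0 => //; [apply: filterS AE => p [] | apply: filterS BE => p []].
- rewrite rel//; [|by apply: filterS AE => p []|by apply: filterS BE => p []].
  by rewrite sFq bracketE -[PiS (s q)]/((PiS \o s) q) sS.
Qed.

Let Esections_lin f V W : Cinfty (M 0%N) f -> Esections V -> Esections W ->
  Esections (fun m => f m *: V m + W m).
Proof.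
move=> Cf /EsectionsP[aV V0] /EsectionsP[aW W0]; apply/EsectionsP.
split=> [|m]; first exact: along_lin.
by rewrite b_differential_lin V0 W0 scaler0 addr0.
Qed.

(** The lift at [s q] only involves [V (PiL q)], so that [f] extends to [M[2]] as [f \o PiL]. *)
Let tilde_lin f V W q : Cinfty (M 0%N) f -> Esections V -> Esections W ->
  tilde (fun m => f m *: V m + W m) q = f (PiL q) *: tilde V q + tilde W q.
Proof.
move=> Cf EV EW; have [_ /(_ q)[V1 V2 V3]] := lifted_along EV.
have [_ /(_ q)[W1 W2 W3]] := lifted_along EW.
rewrite !tildeE//; last exact: Esections_lin.
rewrite -b_differential_lin; congr b_differential; apply: lifted_eq; split.
- exact: b_derivation_lin.
- by rewrite b_differential_lin V2 W2 scaler0 addr0.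
- by rewrite b_differential_lin V3 W3 sFq.
Qed.

Let Lm m : PiL (diag m) = m. Proof. by rewrite -[LHS]/((PiL \o diag) m) Ld. Qed.

(** Differentiating [f \o PiL] along the extension of [V] at the diagonal gives the anchor term. The
    case [W' = 0] is the Leibniz rule, and constant [f] gives linearity. *)
Let bracket_linr f V W W' : Cinfty (M 0%N) f -> Esections V -> Esections W -> Esections W' ->
  Ebracket V (fun m => f m *: W m + W' m) =
  fun m => f m *: Ebracket V W m + (b_differential PiL (V m)).1 f *: W m + Ebracket V W' m.
Proof.
move=> Cf EV EW EW'; apply/funext => m.
have bV := tildeF_field EV; have bW := tildeF_field EW; have bW' := tildeF_field EW'.
have CL : Cinfty (M 1%N) (f \o PiL) by exact: (interior_b_map_smooth bL).
have fL : (f \o PiL) (diag m) = f m by rewrite /= Lm.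
have Vf : tildeF V (f \o PiL) (diag m) = (b_differential PiL (V m)).1 f.
  by rewrite b_differential1// -(tilde_diag m EV).
have := commutator_linr (diag m) bV bW bW' CL.
rewrite (tildeF_value (diag m) EW) (tilde_diag m EW) fL Vf; apply: etrans.
rewrite bracketE; congr (b_value (commutator _ _) _); apply/funext => g; apply/funext => q.
by rewrite /tildeF /section_apply tilde_lin.
Qed.

Let Esections0 : Esections (fun=> 0 : bvec (M 1%N)).
Proof. by apply/EsectionsP; split=> [|m]; [exact: along0 | exact: b_differential0]. Qed.

Let bracket0 V : Esections V -> Ebracket V (fun=> 0) = fun=> 0.
Proof.
move=> EV; have := bracket_linr (@Cinfty_cst R (M 0%N) (-1)) EV Esections0 Esections0.
rewrite (_ : (fun m => _ *: _ + _) = fun=> 0); last by apply/funext => m; rewrite scaler0 addr0.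
by move=> /funeqP H; apply/funext => m; rewrite H scaler0 addr0 scaleN1r addNr.
Qed.

Let bracket_antisym V W : Esections V -> Esections W -> Ebracket V W = - Ebracket W V.
Proof.
move=> EV EW; apply/funext => m; rewrite -[RHS]/(- Ebracket W V m) !bracketE.
by apply: commutator_antisym; exact: tildeF_field.
Qed.

Let bracket_linr_cst (c : R) V W W' : Esections V -> Esections W -> Esections W' ->
  Ebracket V (c *: W + W') = c *: Ebracket V W + Ebracket V W'.
Proof.
move=> EV EW EW'; rewrite -[c *: W + W']/(fun m => c *: W m + W' m).
rewrite (bracket_linr (@Cinfty_cst R (M 0%N) c) EV EW EW'); apply/funext => m.
have /EsectionsP[[/(_ m) aV _ _] _] := EV.
have [_ pV _ _ _] := b_differential_derivation bL aV.
by rewrite (pd_cst c pV) scale0r addr0.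
Qed.

Let anchor_along V : Esections V -> along id (fun m => b_differential PiL (V m)).
Proof. by move=> /EsectionsP[aV _]; rewrite -Ld; exact: along_push. Qed.

Lemma bracket_lie_algebroid :
  lie_algebroid (@Efibre R M) (@Esections R M) (@Ebracket R M) (@anchor R M).
Proof.
split.
- exact: bracket_section.
- move=> c V V' W EV EV' EW; have EcV : Esections (c *: V + V').
    exact: (Esections_lin (@Cinfty_cst R (M 0%N) c) EV EV').
  rewrite (bracket_antisym EcV EW) (bracket_linr_cst c EW EV EV').
  by rewrite (bracket_antisym EV EW) (bracket_antisym EV' EW) opprD scalerN.
- exact: bracket_linr_cst.
- move=> V EV; apply/funext => m; rewrite bracketE -[RHS](b_value0 (diag m)).
  by apply: b_value_ext => f _; rewrite /commutator subrr.
(* The inner bracket enters the outer one through its own extension, which [tilde_bracket]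
   identifies with a commutator of fields on [M[2]]; the Jacobi identity for these is then evaluated
   on the diagonal. *)
- move=> U V W EU EV EW; apply/funext => m.
  have bU := tildeF_field EU; have bV := tildeF_field EV; have bW := tildeF_field EW.
  have E A B C : Esections A -> Esections B -> Esections C ->
      Ebracket A (Ebracket B C) m =
      b_value (commutator (tildeF A) (commutator (tildeF B) (tildeF C))) (diag m).
    move=> EA EB EC; rewrite bracketE; apply: b_value_ext => f Cf.
    have sE g : Cinfty (M 1%N) g -> tildeF (Ebracket B C) g = commutator (tildeF B) (tildeF C) g.
      by move=> Cg; apply/funext => q; rewrite /tildeF /section_apply tilde_bracket// b_value1.
    by rewrite /commutator !sE//; apply: b_field_smooth => //; exact: tildeF_field.
  rewrite -[LHS]/(Ebracket U (Ebracket V W) m + Ebracket V (Ebracket W U) m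
    + Ebracket W (Ebracket U V) m).
  by rewrite !E//; exact: jacobi_commutator.
- move=> m v [/bTE Hv _]; apply/bTE; rewrite -[X in b_derivation X]Lm.
  exact: b_differential_derivation.
- by move=> m c v w _ _; exact: b_differential_lin.
- by move=> V /anchor_along aV; exact/along_idP.
(* By [tilde_anchor] the extensions are related by [PiL] to the anchored fields on all of [M[2]], so
   their commutators are related at [diag m], which [PiL] maps to [m]. *)
- move=> V W EV EW; apply/funext => m.
  have [bV EV'] := along_id (anchor_along EV); have [bW EW'] := along_id (anchor_along EW).
  transitivity (b_value (commutator (section_apply (fun m => b_differential PiL (V m)))
      (section_apply (fun m => b_differential PiL (W m)))) (PiL (diag m))); last by rewrite Lm.
  apply: related_commutator => //; try exact: tildeF_field.
  + by near=> q; rewrite tildeF_value// tilde_anchor// -EV'.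
  + by near=> q; rewrite tildeF_value// tilde_anchor// -EW'.
- move=> f V W Cf EV EW.
  have E : (fun m => f m *: W m) = (fun m => f m *: W m + 0).
    by apply/funext => m; rewrite addr0.
  rewrite E; split; first exact: (Esections_lin Cf EW Esections0).
  rewrite (bracket_linr Cf EV EW Esections0) bracket0//.
  by apply/funext => m; rewrite addr0.
Unshelve. all: by end_near. Qed.

End Bracket.

Theorem theorem3 (R : realType) (M : generalized_product R) :
  (forall V, Esections (M := M) V -> tilde_well_defined V) /\
  lie_algebroid (@Efibre R M) (@Esections R M) (@Ebracket R M) (@anchor R M).
Proof.
by split; [move=> V; exact: tilde_well_definedP | exact: bracket_lie_algebroid].
Qed.
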